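(* Let $F$ be an interpolation Banach lattice on $[0,1]$ with respect to the pair $(L^\infty,L^\infty(1/t))$, and let $\theta(t)=1+\frac{1}{2\log(t/e)}$, $t\in(0,1)$. For a Banach pair $\vec A$ and $q\in[1,\infty]$ consider the equivalence $$(\ast)\qquad \Vert a\Vert_{\langle\vec A\rangle_F^K}\asymp\Big\Vert t\cdot\Vert a\Vert_{\langle\vec A\rangle_{\theta(t),q}^{K\blacktriangleleft}}\Big\Vert_F\quad\text{for all } a\in\langle\vec A\rangle_F^K .$$ The following conditions are equivalent: (a) the operator $Tf(t)=f(t^2)/t$ is bounded on $F$; (b) for every Banach pair $\vec A=(A_0,A_1)$ and for each $q\in[1,\infty]$ the equivalence $(\ast)$ holds; (c) for every Banach pair $\vec A=(A_0,A_1)$ we have, with constants independent of $a\in\langle\vec A\rangle_F^K+\tilde A_1$, $s>0$ and $q\in[1,\infty]$, $$K(s,a;\langle\vec A\rangle_F^K,\tilde A_1)\asymp K\big(s,\ t\cdot\Vert a\Vert_{\langle\vec A\rangle_{\theta(t),q}^{K\blacktriangleleft}};\ F,L^\infty(1/t)\big);$$ (d) there exist a Banach pair $\vec A$ that is $Conv_0$-abundant on $[0,1]$ and $q\in[1,\infty]$ such that $(\ast)$ holds.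
   Context: A Banach pair $\vec A=(A_0,A_1)$ consists of two Banach spaces continuously embedded in a common Hausdorff topological vector space. For $x\in A_0+A_1$, $t>0$, $K(t,x;A_0,A_1)=K(t,x;\vec A)=\inf\{\Vert a_0\Vert_{A_0}+t\Vert a_1\Vert_{A_1}: x=a_0+a_1,\ a_i\in A_i\}$. $\tilde A_1$ denotes the Gagliardo completion of $A_1$: the space of $a\in A_0+A_1$ with $\Vert a\Vert_{\tilde A_1}=\sup_{t>0}t^{-1}K(t,a;\vec A)<\infty$. $L^\infty=L^\infty[0,1]$ and $\Vert f\Vert_{L^\infty(1/t)}=\Vert f(t)/t\Vert_{L^\infty}$. A Banach lattice $F$ of measurable functions on $[0,1]$ is an interpolation lattice with respect to $(L^\infty,L^\infty(1/t))$ if $L^\infty(1/t)\subset F\subset L^\infty$ continuously and every linear operator bounded on both $L^\infty$ and $L^\infty(1/t)$ is bounded on $F$. $\langle\vec A\rangle_F^K=\{x\in A_0+A_1:\Vert x\Vert_{\langle\vec A\rangle_F^K}:=\Vert K(\cdot,x;\vec A)\Vert_F<\infty\}$. For $0<\theta<1$, $1\le q<\infty$: $\Vert x\Vert_{\langle\vec A\rangle_{\theta,q}^{K\blacktriangleleft}}=(q\theta(1-\theta))^{1/q}\left(\int_0^1 (s^{-\theta}K(s,x;\vec A))^q\frac{ds}{s}\right)^{1/q}$; for $q=\infty$: $\sup_{0<s<1}s^{-\theta}K(s,x;\vec A)$. A Banach pair $\vec A$ is $Conv_0$-abundant on $[0,1]$ if there is a constant $C>0$ such that for every concave increasing function $f$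 on $[0,1]$ with $\lim_{t\to0}f(t)=0$ there is $a\in A_0+A_1$ with $C^{-1}f(t)\le K(t,a;\vec A)\le Cf(t)$, $0\le t\le1$. $X\asymp Y$ means $cX\le Y\le CX$ with positive constants $c,C$ independent of $a$ (and of the other variables where indicated). *)

(* Defs.v *)
From HB Require Import structures.
From mathcomp Require Import all_boot all_order all_algebra.
From mathcomp Require Import all_classical all_reals all_analysis.

Set Implicit Arguments.
Unset Strict Implicit.
Unset Printing Implicit Defensive.
Import Order.TTheory GRing.Theory Num.Theory.
Import numFieldNormedType.Exports.

Local Open Scope classical_set_scope.
Local Open Scope ring_scope.
Local Open Scope ereal_scope.

(* A normed space X inside an ambient vector space V is encoded by its extended
   norm N : V -> \bar R, equal to +oo exactly off X, so X = [set x | N x < +oo].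
   Spaces of functions on [0, 1] are encoded in the same way on R -> R, with
   almost everywhere equal functions not identified: every notion below only
   depends on the values on [0, 1] up to a null set. *)
Section interpolation.
Context {R : realType}.

Definition carrier (V : Type) (N : V -> \bar R) : set V := [set x | N x < +oo].

Definition sum_space (V : zmodType) (N0 N1 : V -> \bar R) : set V :=
  [set x | exists a0 a1, [/\ carrier N0 a0, carrier N1 a1 & x = (a0 + a1)%R]].

(* The value is +oo when x lies outside the sum of the two spaces. *)
Definition K_functional (V : zmodType) (N0 N1 : V -> \bar R) (t : R) (x : V)
    : \bar R :=
  ereal_inf [set r | exists a0 a1,
    [/\ carrier N0 a0, carrier N1 a1, x = (a0 + a1)%R
      & r = N0 a0 + t%:E * N1 a1]].

Definition bounded_operator (V W : Type) (N : V -> \bar R) (M : W -> \bar R)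
    (T : V -> W) : Prop :=
  exists2 C : R, (0 < C)%R & forall x, carrier N x -> M (T x) <= C%:E * N x.

Definition equivalent_on (V : Type) (D : set V) (X Y : V -> \bar R) : Prop :=
  exists c C : R, [/\ (0 < c)%R, (0 < C)%R
    & forall a, D a -> c%:E * X a <= Y a /\ Y a <= C%:E * X a].

Definition I01 : set R := `[0%R, 1%R]%classic.

Notation leb := (@lebesgue_measure R).

Definition norm_Linfty (f : R -> R) : \bar R :=
  if `[< measurable_fun I01 f >] then 'N[leb]_+oo[EFin \o (f \_ I01)]
  else +oo.

Definition norm_Linfty_inv (f : R -> R) : \bar R :=
  norm_Linfty (fun t => f t / t)%R.

Record banach_lattice := BanachLattice {
  lattice_norm :> (R -> R) -> \bar R ;
  lattice_norm_ge0 : forall f, 0 <= lattice_norm f ;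
  lattice_measurable : forall f, carrier lattice_norm f -> measurable_fun I01 f ;
  lattice_norm_eq0 : forall f, lattice_norm f = 0 ->
    f = cst 0%R %[ae leb in I01] ;
  lattice_normZ : forall (c : R) f,
    lattice_norm (fun t => c * f t)%R = `|c|%:E * lattice_norm f ;
  lattice_normD : forall f g,
    lattice_norm (fun t => f t + g t)%R <= lattice_norm f + lattice_norm g ;
  lattice_solid : forall f g : R -> R, measurable_fun I01 f ->
    {ae leb, forall t, I01 t -> (`|f t| <= `|g t|)%R} ->
    lattice_norm f <= lattice_norm g ;
  lattice_complete : forall u : nat -> (R -> R),
    (forall n, carrier lattice_norm (u n)) ->
    (forall e : R, (0 < e)%R -> exists k, forall m n, (k <= m)%N -> (k <= n)%N ->
      lattice_norm (fun t => u m t - u n t)%R < e%:E) ->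
    exists2 f, carrier lattice_norm f
      & lattice_norm (fun t => u n t - f t)%R @[n --> \oo] --> 0 }.

(* The operator acts on L^oo, which contains L^oo(1/t); linearity is required
   up to null sets, as the functions stand for their classes. *)
Definition linear_on_Linfty (T : (R -> R) -> (R -> R)) : Prop :=
  forall (c : R) f g, carrier norm_Linfty f -> carrier norm_Linfty g ->
    T (fun t => c * f t + g t)%R
    = (fun t => c * T f t + T g t)%R %[ae leb in I01].

Definition interpolation_lattice (F : banach_lattice) : Prop :=
  [/\ bounded_operator norm_Linfty_inv F id,
      bounded_operator F norm_Linfty id
    & forall T : (R -> R) -> (R -> R), linear_on_Linfty T ->
        bounded_operator norm_Linfty norm_Linfty T ->
        bounded_operator norm_Linfty_inv norm_Linfty_inv T ->
        bounded_operator F F T].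

(* The value at an extended real-valued g of a functional Phi of (classes of)
   real functions on [0, 1]; it is +oo when g is infinite on a nonnull set. *)
Definition on_extended (Phi : (R -> R) -> \bar R) (g : R -> \bar R) : \bar R :=
  ereal_inf [set Phi h | h in [set h | g = EFin \o h %[ae leb in I01]]].

Record banach_pair := BanachPair {
  ambient : topologicalLmodType R ;
  ambient_hausdorff : hausdorff_space ambient ;
  space0 : completeNormedModType R ;
  space1 : completeNormedModType R ;
  embed0 : {linear space0 -> ambient} ;
  embed1 : {linear space1 -> ambient} ;
  embed0_inj : injective embed0 ;
  embed1_inj : injective embed1 ;
  embed0_continuous : continuous embed0 ;
  embed1_continuous : continuous embed1 }.

Definition norm0 (A : banach_pair) (x : ambient A) : \bar R :=
  ereal_inf [set `|a|%:E | a in [set a : space0 A | embed0 A a = x]].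

Definition norm1 (A : banach_pair) (x : ambient A) : \bar R :=
  ereal_inf [set `|a|%:E | a in [set a : space1 A | embed1 A a = x]].

Definition K_pair (A : banach_pair) (t : R) (x : ambient A) : \bar R :=
  K_functional (@norm0 A) (@norm1 A) t x.

Definition norm_gagliardo1 (A : banach_pair) (a : ambient A) : \bar R :=
  ereal_sup [set (t^-1)%:E * K_pair t a | t in [set t : R | (0 < t)%R]].

Definition norm_FK (F : banach_lattice) (A : banach_pair) (x : ambient A)
    : \bar R :=
  on_extended F (fun t => K_pair t x).

(* The normalized truncated norm for 0 < theta < 1 and 1 <= q <= +oo; the
   second branch is then the case q = +oo. *)
Definition norm_theta_q (A : banach_pair) (theta : R) (q : \bar R)
    (x : ambient A) : \bar R :=
  match q with
  | q'%:E => ((q' * theta * (1 - theta)) `^ q'^-1)%:E *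
      (\int[leb]_(s in `]0%R, 1%R[)
         (((s `^ (- theta))%:E * K_pair s x) `^ q' * (s^-1)%:E)) `^ q'^-1
  | _ => ereal_sup
      [set (s `^ (- theta))%:E * K_pair s x | s in `]0%R, 1%R[%classic]
  end.

(* Ranges over ]1/2, 1[ for t in ]0, 1[; values elsewhere are irrelevant. *)
Definition theta_of (t : R) : R := (1 + (2 * ln (t / expR 1))^-1)%R.

Definition theta_profile (A : banach_pair) (q : \bar R) (a : ambient A)
    : R -> \bar R :=
  fun t => t%:E * norm_theta_q (theta_of t) q a.

(* Nonnegativity only constrains f 0, which it forces to be 0. *)
Definition conv0_function (f : R -> R) : Prop :=
  [/\ forall t, I01 t -> (0 <= f t)%R,
      convex_function I01 (fun t => - f t)%R,
      {in I01 &, {homo f : s t / (s <= t)%R}}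
    & f t @[t --> 0^'+] --> (0 : R)%R].

Definition conv0_abundant (A : banach_pair) : Prop :=
  exists2 C : R, (0 < C)%R & forall f, conv0_function f ->
    exists2 a, sum_space (@norm0 A) (@norm1 A) a &
      forall t, I01 t ->
        (C^-1 * f t)%:E <= K_pair t a /\ K_pair t a <= (C * f t)%:E.

Definition extrapolation_description (F : banach_lattice) (A : banach_pair)
    (q : \bar R) : Prop :=
  equivalent_on (carrier (@norm_FK F A)) (@norm_FK F A)
    (fun a => on_extended F (theta_profile q a)).

Definition square_dilation (f : R -> R) : R -> R := fun t => (f (t ^+ 2) / t)%R.

End interpolation.
Arguments banach_lattice : clear implicits.
Arguments banach_pair : clear implicits.

(* Main.v *)
Require Import Defs.
From HB Require Import structures.
From mathcomp Require Import all_boot all_order all_algebra.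
From mathcomp Require Import all_classical all_reals all_analysis.
From mathcomp Require Import ess_sup_inf measurable_realfun lra.
Import Order.TTheory GRing.Theory Num.Theory.
Import numFieldNormedType.Exports.
Set Implicit Arguments.
Unset Strict Implicit.
Unset Printing Implicit Defensive.
Local Open Scope classical_set_scope.
Local Open Scope ring_scope.
Local Open Scope ereal_scope.

(** Write L = 1 + log (1/t), so that 1 - theta(t) = 1/(2L), and let K be the
    quasi-concave function K(., a).  Testing the integral at s <= t and at
    s <= t^2, where s^(1 - theta) is bounded below, gives
    t ||a||_(theta(t),q) >= c max (K(t), K(t^2)/t) uniformly in q.  Conversely
    s^-theta K(s) <= M s^((1-theta)/2) for
    M = sup_s s^(-(1+theta)/2) K(s), so the norms for all q are at most 2M; on
    the block t^(2^(j+1)) <= s <= t^(2^j) with t <= 1/e the factor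
    s^((1-theta)/2) is at most exp (-2^j/8), whence t M is dominated by
    K + sum_j exp (-2^j/8) T^(j+1) K, a series which converges in F when T is
    bounded.  This is (a) => (b).

    (a) => (c) uses the subadditivity of t M in one direction; in the other,
    a decomposition K(t) <~ |h0(t)| + B t is lifted to a by splitting a almost
    optimally at the largest t0 with K(t0) >= lambda B t0.  (c) => (b) is the
    case of a large s, when both K-functionals are the norms of the larger
    spaces.  (b) => (d) needs one abundant pair: bounded functions on the line
    and the same space weighted by t.  For (d) => (a), a function f of F is
    replaced by its least concave majorant, again in F by interpolation (a
    single positive averaging operator recovers it up to a constant); if it
    vanishes at 0 it is realized as K(., a), and it does vanish at 0 because
    otherwise 1 is in F and the ramps min (1, t/e) contradict the
    equivalence.

    In both places where only "T f in F for all f in F" is clear, boundedness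
    follows from positivity and completeness. *)

(** * Almost everywhere statements on [0, 1] *)

(** The exponent is tuned to squaring: t^(1 - theta(t)) = exp (ln t / (2 (1 - ln t))) stays between
    exp (-1/2) and 1. The weight is therefore harmless at s = t and s = t^2, and it decays doubly
    exponentially in j along the points t^(2^j) once t is away from 1. For a quasi-concave function,
    K(s)/s on a block is at most its value at the left end of the block, and these values are the
    iterates of T up to a factor t; so T need only be bounded, whatever its norm. Uniformity in q
    comes from the normalising factor, which cancels the 1/(q (1 - theta)) produced by integrating a
    power.

    The obstacle in (d) => (a) is that abundance realizes only concave functions, whereas taking the
    least concave majorant is not linear, so interpolation does not apply to it. The operator that
    recovers the majorant is built from the function itself; its norm on F is thus not controlled
    uniformly, and only membership in F results. Since functions stand for their classes, null sets
    matter at two points: composition with t^2, and the infimum over uncountably many affine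
    bounds. *)

Section linfty.
Context {R : realType}.
Notation leb := (@lebesgue_measure R).
Implicit Types f g : R -> R.

Lemma measurable_I01 : measurable (@I01 R).
Proof. exact: measurable_itv. Qed.

Lemma leb_I01_eq1 : leb (@I01 R) = 1.
Proof. by rewrite /I01 lebesgue_measure_itv/= lte_fin ltr01 sube0. Qed.

Lemma leb_setT_gt0 : 0 < leb [set: R].
Proof.
apply: (@lt_le_trans _ _ (leb (@I01 R))); first by rewrite leb_I01_eq1.
by apply: le_measure; rewrite ?inE//; exact: measurable_I01.
Qed.

(** A null set contains no nonempty open interval. This turns an almost everywhere estimate into one
    at a point of prescribed location. *)
Lemma ae_exists_itv (P : R -> Prop) (a b : R) :
  (0 <= a)%R -> (a < b)%R -> (b <= 1)%R ->
  {ae leb, forall t, I01 t -> P t} -> exists t, [/\ (a < t)%R, (t < b)%R & P t].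
Proof.
move=> a0 ab b1 [N [mN N0 subN]]; apply: contrapT => nP.
have : `]a, b[%classic `<=` N.
  move=> t /=; rewrite in_itv/= => /andP[at_ tb]; apply: subN => /= Pt.
  apply: nP; exists t; split => //; apply: Pt.
  by rewrite /I01/= in_itv/=; apply/andP; split; lra.
move=> /(@le_measure _ _ _ leb) H.
have : leb `]a, b[%classic <= leb N by apply: H; rewrite inE//; exact: measurable_itv.
by rewrite N0 lebesgue_measure_itv/= lte_fin ab -EFinD lee_fin; lra.
Qed.

Lemma ae_I01_oo (P : R -> Prop) :
  (forall t, (0 < t)%R -> (t < 1)%R -> P t) -> {ae leb, forall t, I01 t -> P t}.
Proof.
move=> H; exists [set 0%R; 1%R]; split.
- by apply: measurableU; exact: measurable_set1.
- by apply: countable_lebesgue_measure0; apply: finite_set_countable; exact: finite_set2.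
- move=> t /= nP; apply: contrapT => /not_orP[t0 t1]; apply: nP.
  rewrite /I01/= in_itv/= => /andP[t00 t11]; apply: H.
    by rewrite lt_neqAle t00 andbT eq_sym; apply/eqP.
  by rewrite lt_neqAle t11 andbT; apply/eqP.
Qed.

Lemma ae_I01W (P : R -> Prop) :
  (forall t, P t) -> {ae leb, forall t, I01 t -> P t}.
Proof. by move=> H; apply: ae_I01_oo => t _ _. Qed.

Lemma ae_I01S (P Q : R -> Prop) : (forall t, I01 t -> P t -> Q t) ->
  {ae leb, forall t, I01 t -> P t} -> {ae leb, forall t, I01 t -> Q t}.
Proof.
move=> PQ; apply: (@filterS _ _ (ae_filter_ringOfSetsType leb)) => t Pt tI.
by apply: PQ => //; exact: Pt.
Qed.

Lemma ae_I01S2 (P1 P2 Q : R -> Prop) :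
  (forall t, I01 t -> P1 t -> P2 t -> Q t) ->
  {ae leb, forall t, I01 t -> P1 t} -> {ae leb, forall t, I01 t -> P2 t} ->
  {ae leb, forall t, I01 t -> Q t}.
Proof.
move=> PQ; apply: (@filterS2 _ _ (ae_filter_ringOfSetsType leb)) => t P1t P2t tI.
by apply: PQ => //; [exact: P1t|exact: P2t].
Qed.

Lemma norm_Linfty_ge0 f : 0 <= norm_Linfty f.
Proof. by rewrite /norm_Linfty; case: ifPn => // _; exact: Lnorm_ge0. Qed.

Lemma norm_LinftyP f (M : R) : (0 <= M)%R ->
  norm_Linfty f <= M%:E <->
  measurable_fun (@I01 R) f /\ {ae leb, forall t, I01 t -> (`|f t| <= M)%R}.
Proof.
move=> M0; rewrite /norm_Linfty.
have E : ('N[leb]_+oo[EFin \o (f \_ (@I01 R))] <= M%:E) <->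
    {ae leb, forall t, I01 t -> (`|f t| <= M)%R}.
  rewrite unlock leb_setT_gt0; split => [/ess_supP|] H.
    apply: (filterS _ H) => t /=; rewrite patchE => + tI.
    by rewrite mem_set//= lee_fin.
  apply/ess_supP; apply: (@filterS _ _ (ae_filter_ringOfSetsType leb) _ _ _ H).
  move=> t /=; rewrite patchE lee_fin => Ht.
  by case: ifPn => [/[1!inE] /Ht//|_]; rewrite normr0.
split.
  case: ifPn => [/asboolP mf /E|_]; first by split.
  by rewrite leNgt ltry.
by move=> [mf /E]; rewrite ifT//; apply/asboolP.
Qed.

Lemma carrier_norm_LinftyP f : carrier norm_Linfty f ->
  exists2 M : R, (0 <= M)%R & norm_Linfty f = M%:E.
Proof.
rewrite /carrier/=; have := norm_Linfty_ge0 f.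
by case: (norm_Linfty f) => // r; rewrite lee_fin => r0 _; exists r.
Qed.

Lemma measurable_fun_divt f : measurable_fun (@I01 R) f ->
  measurable_fun (@I01 R) (fun t => f t / t)%R.
Proof.
move=> mf; apply: measurable_funM => //.
apply: (@eq_measurable_fun _ _ _ _ _ (fun t : R => t `^ (-1))%R).
  move=> t; rewrite inE /I01/= in_itv/= => /andP[t0 _].
  by rewrite powR_inv1.
by apply: measurable_funTS; exact: measurable_powR.
Qed.

Lemma norm_Linfty_inv_bound f (M : R) : (0 <= M)%R ->
  norm_Linfty_inv f <= M%:E ->
  {ae leb, forall t, I01 t -> (`|f t| <= M * t)%R}.
Proof.
move=> M0 /norm_LinftyP -/(_ M0)[_ H].
have H1 : {ae leb, forall t, I01 t -> (0 < t)%R} by apply: ae_I01_oo.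
move: H1 H; apply: ae_I01S2 => t tI t0.
by rewrite normrM normfV (gtr0_norm t0) ler_pdivrMr.
Qed.

Lemma norm_Linfty_inv_le f (M : R) : (0 <= M)%R -> measurable_fun (@I01 R) f ->
  {ae leb, forall t, I01 t -> (`|f t| <= M * t)%R} ->
  norm_Linfty_inv f <= M%:E.
Proof.
move=> M0 mf H; apply/norm_LinftyP => //; split; first exact: measurable_fun_divt.
have H1 : {ae leb, forall t, I01 t -> (0 < t)%R} by apply: ae_I01_oo.
move: H1 H; apply: ae_I01S2 => t tI t0.
by rewrite normrM normfV (gtr0_norm t0) ler_pdivrMr.
Qed.

Lemma norm_Linfty_inv_ge0 f : 0 <= norm_Linfty_inv f.
Proof. exact: norm_Linfty_ge0. Qed.

Lemma carrier_norm_Linfty_invP f : carrier norm_Linfty_inv f ->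
  exists2 M : R, (0 <= M)%R & norm_Linfty_inv f = M%:E.
Proof. exact: carrier_norm_LinftyP. Qed.

End linfty.

(** * Banach lattices *)

Section lattice.
Context {R : realType} (F : banach_lattice R).
Notation leb := (@lebesgue_measure R).
Implicit Types f g h : R -> R.

Lemma cvge0_small (u : nat -> \bar R) (e : R) : u n @[n --> \oo] --> 0 ->
  (0 < e)%R -> exists N, forall n, (N <= n)%N -> u n < e%:E.
Proof.
move=> u0 e0.
have /u0 [N _ HN] : nbhs (0 : \bar R) [set x | x < e%:E].
  by apply: open_ereal_lt'; rewrite lte_fin.
by exists N => n Nn; exact: HN.
Qed.

Lemma lattice_norm0 : F (fun=> 0%R) = 0.
Proof.
have := @lattice_normZ _ F 0%R (fun=> 0%R).
by rewrite normr0 mul0e; under eq_fun do rewrite mul0r.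
Qed.

Lemma lattice_normN f : F (fun t => - f t)%R = F f.
Proof.
have := @lattice_normZ _ F (-1)%R f.
by rewrite normrN1 mul1e; under eq_fun do rewrite mulN1r.
Qed.

Lemma lattice_norm_pZ (c : R) f : (0 <= c)%R ->
  F (fun t => c * f t)%R = c%:E * F f.
Proof. by move=> c0; rewrite lattice_normZ ger0_norm. Qed.

Lemma lattice_le (c : R) f g : (0 <= c)%R -> measurable_fun (@I01 R) f ->
  {ae leb, forall t, I01 t -> (`|f t| <= c * `|g t|)%R} -> F f <= c%:E * F g.
Proof.
move=> c0 mf H; rewrite -lattice_norm_pZ//; apply: lattice_solid => //.
by move: H; apply: ae_I01S => t _; rewrite normrM ger0_norm.
Qed.

Lemma lattice_norm_abs f : measurable_fun (@I01 R) f ->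
  F (fun t => `|f t|)%R = F f.
Proof.
move=> mf; apply/eqP; rewrite eq_le; apply/andP; split; apply: lattice_solid => //.
- exact: measurableT_comp.
- by apply: ae_I01W => t; rewrite normr_id.
- by apply: ae_I01W => t; rewrite normr_id.
Qed.

Lemma lattice_fin_num f : carrier F f -> exists2 r : R, (0 <= r)%R & F f = r%:E.
Proof.
rewrite /carrier/=; have := lattice_norm_ge0 F f.
by case: (F f) => // r; rewrite lee_fin => r0 _; exists r.
Qed.

(** The partial sums [S n] are Cauchy with remainders M / 2^n, so they converge in F to some f. No
    almost everywhere convergent subsequence is extracted: for m >= n the positive part of S n - f
    is at most |S m - f|, whose norm tends to 0, so this positive part has norm 0. *)
Lemma lattice_series (u : nat -> R -> R) (M : R) : (0 <= M)%R ->
  (forall n t, I01 t -> (0 <= u n t)%R) ->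
  (forall n, F (u n) <= (M / 2 ^+ n.+1)%:E) ->
  exists f, F f <= M%:E /\
    {ae leb, forall t, I01 t -> forall n, (\sum_(k < n) u k t <= f t)%R}.
Proof.
move=> M0 u0 uM.
pose S n t := (\sum_(k < n) u k t)%R.
have Sdiff m n : F (fun t => S (n + m)%N t - S n t)%R <=
    (M / 2 ^+ n - M / 2 ^+ (n + m))%:E.
  elim: m => [|m IH].
    rewrite addn0 subrr; under eq_fun do rewrite subrr.
    by rewrite lattice_norm0.
  have -> : (fun t => S (n + m.+1)%N t - S n t)%R =
            (fun t => (S (n + m)%N t - S n t) + u (n + m)%N t)%R.
    by apply/funext => t; rewrite /S addnS big_ord_recr/= addrAC.
  apply: (le_trans (lattice_normD _ _ _)).
  apply: (le_trans (leeD IH (uM _))).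
  rewrite -EFinD lee_fin addnS exprS invfM.
  have ? : (0 <= M * (2 ^+ (n + m))^-1)%R by rewrite mulr_ge0// invr_ge0 exprn_ge0.
  lra.
have Sc n : F (S n) <= M%:E.
  have := Sdiff n 0%N; rewrite add0n expr0 divr1.
  rewrite [X in F X](_ : _ = S n); last first.
    by apply/funext => t; rewrite /S big_ord0 subr0.
  move=> /le_trans; apply; rewrite lee_fin.
  have ? : (0 <= M / (2 ^+ n))%R by rewrite divr_ge0// exprn_ge0.
  lra.
have SM n m : (n <= m)%N ->
    F (fun t => S m t - S n t)%R <= (M / 2 ^+ n)%:E.
  move=> nm; have := Sdiff (m - n)%N n; rewrite subnKC// => /le_trans; apply.
  rewrite lee_fin.
  have ? : (0 <= M / (2 ^+ m))%R by rewrite divr_ge0// exprn_ge0.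
  lra.
have Ssmall (e : R) : (0 < e)%R -> exists k, (M / 2 ^+ k < e)%R.
  move=> e0; exists (Num.truncn (M / e)).+1.
  rewrite ltr_pdivrMr ?exprn_gt0// mulrC -ltr_pdivrMr//.
  apply: (lt_trans (truncnS_gt _)).
  by rewrite -natrX ltr_nat; exact: ltn_expl.
have SF n : carrier F (S n) by rewrite /carrier/= (le_lt_trans (Sc n))// ltry.
have [||f Ff cf] := @lattice_complete _ F S.
- exact: SF.
- move=> e e0; have [k ke] := Ssmall e e0; exists k => m n km kn.
  wlog nm : m n km kn / (n <= m)%N.
    move=> H; have [|/ltnW mn] := leqP n m; first exact: H.
    rewrite -lattice_normN; under eq_fun do rewrite opprB.
    exact: H.
  apply: (le_lt_trans (SM _ _ nm)); rewrite lte_fin (le_lt_trans _ ke)//.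
  by rewrite ler_wpM2l// lef_pV2 ?posrE ?exprn_gt0// ler_eXn2l// ltr1n.
have mS n : measurable_fun (@I01 R) (S n) by exact: (lattice_measurable (SF n)).
have mf : measurable_fun (@I01 R) f by exact: (lattice_measurable Ff).
exists f; split.
  apply/lee_addgt0Pr => e e0.
  have [N HN] := cvge0_small cf e0.
  have := @lattice_normD _ F (S N) (fun t => - (S N t - f t))%R.
  rewrite lattice_normN; under eq_fun do rewrite opprB addrC subrK.
  move=> /le_trans; apply; apply: leeD => //.
  by apply: ltW; exact: HN.
have H n : {ae leb, forall t, I01 t -> (S n t <= f t)%R}.
  have Smon m t : I01 t -> (n <= m)%N -> (S n t <= S m t)%R.
    move=> tI nm; rewrite /S -(subnKC nm) big_split_ord/= lerDl.
    by apply: sumr_ge0 => i _; exact: u0.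
  pose p t := Num.max (S n t - f t)%R 0%R.
  have mp : measurable_fun (@I01 R) p.
    by apply: measurable_maxr => //; exact: measurable_funB.
  have : F p = 0.
    apply/eqP; rewrite eq_le lattice_norm_ge0 andbT.
    apply/lee_addgt0Pr => e e0; rewrite add0e.
    have [N HN] := cvge0_small cf e0.
    apply: (le_trans _ (ltW (HN (maxn N n) (leq_maxl _ _)))).
    apply: lattice_solid => //; apply: ae_I01_oo => t t0 t1.
    have tI : I01 t by rewrite /I01/= in_itv/= !ltW.
    have := Smon (maxn N n) t tI (leq_maxr _ _).
    rewrite /p => Hle; rewrite [leLHS]ger0_norm ?le_max ?lexx ?orbT//.
    rewrite ge_max normr_ge0 andbT (le_trans _ (ler_norm _))//.
    by rewrite lerD2r.
  move=> /lattice_norm_eq0; apply: ae_I01S => t _ /= pt0.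
  by rewrite -subr_le0 -pt0 le_max lexx.
have := ae_foralln (mu := leb) H.
apply: (@filterS _ _ (ae_filter_ringOfSetsType leb)) => t Ht tI n.
exact: Ht.
Qed.

(* Otherwise there are u_n >= 0 with F u_n <= 2^-(n+1) and Psi u_n >= n, and
   Psi is infinite at a function of F dominating all of them. *)
Lemma positive_bounded (Psi : (R -> R) -> \bar R) :
  (forall f g, carrier F f -> carrier F g -> (forall t, I01 t -> 0 <= f t)%R ->
    {ae leb, forall t, I01 t -> (f t <= g t)%R} -> Psi f <= Psi g) ->
  (forall (c : R) f, (0 < c)%R -> carrier F f ->
    c%:E * Psi f <= Psi (fun t => c * f t)%R) ->
  (forall f, carrier F f -> (forall t, I01 t -> 0 <= f t)%R -> Psi f < +oo) ->
  exists2 C : R, (0 < C)%R & forall f, carrier F f ->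
    (forall t, I01 t -> 0 <= f t)%R -> Psi f <= C%:E * F f.
Proof.
move=> mono homo fin; apply: contrapT => nC.
have H (n : nat) : exists f, [/\ forall t, (I01 t -> 0 <= f t)%R,
    F f <= (1 / 2 ^+ n.+1)%:E & n%:R%:E <= Psi f].
  apply: contrapT => nf; apply: nC; exists (n.+1%:R * 2 ^+ n.+1)%R => [|f Ff f0].
    by rewrite mulr_gt0 ?exprn_gt0.
  have [r r0 Er] := lattice_fin_num Ff; rewrite leNgt Er; apply/negP => Cf.
  apply: nf.
  (* If F f = 0 while Psi f = p > 0, multiplying f by n.+1 / p costs nothing in F and makes Psi
     large. *)
  have [rE|r1] := eqVneq r 0%R.
    move: Cf; rewrite rE mule0 => Pf.
    have := fin f Ff f0; move: Pf (@homo).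
    case Ep : (Psi f) => [p||]//; rewrite lte_fin => p0 hom _.
    exists (fun t => (n.+1%:R / p) * f t)%R; split.
    - by move=> t /f0 ft; rewrite mulr_ge0// divr_ge0// ltW.
    - rewrite lattice_norm_pZ ?divr_ge0 ?(ltW p0)// Er rE mule0 lee_fin.
      by rewrite divr_ge0// exprn_ge0.
    - apply: le_trans (hom _ _ _ Ff); last by rewrite divr_gt0.
      by rewrite Ep lee_fin divfK ?gt_eqF// ler_nat.
  have {r1}r0 : (0 < r)%R by rewrite lt_neqAle eq_sym r1.
  exists (fun t => (1 / (2 ^+ n.+1 * r)) * f t)%R; split.
  - by move=> t /f0 ft; rewrite mulr_ge0// divr_ge0// mulr_ge0 ?exprn_ge0 ?ltW.
  - rewrite lattice_norm_pZ ?divr_ge0 ?mulr_ge0 ?exprn_ge0 ?(ltW r0)// Er lee_fin.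
    by rewrite invfM mulrA divfK ?gt_eqF.
  - apply: le_trans (homo _ _ _ Ff); last by rewrite divr_gt0 ?mulr_gt0 ?exprn_gt0.
    apply: (@le_trans _ _ ((1 / (2 ^+ n.+1 * r))%:E * ((n.+1%:R * 2 ^+ n.+1)%:E * r%:E))).
      rewrite -!EFinM lee_fin -[X in (_ <= _ * X)%R]mulrA mulrCA mul1r mulVf ?mulr1 ?ler_nat//.
      by rewrite mulf_neq0 ?expf_neq0 ?gt_eqF.
    by rewrite lee_wpmul2l ?(ltW Cf)// lee_fin divr_ge0// mulr_ge0 ?exprn_ge0 ?ltW.
have /choice[u Hu] := H.
have [f [Ff uf]] := @lattice_series u 1%R ler01 (fun n => let: And3 a _ _ := Hu n in a)
  (fun n => let: And3 _ b _ := Hu n in b).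
have {}Ff : carrier F f by rewrite /carrier/= (le_lt_trans Ff)// ltry.
have mf := lattice_measurable Ff.
pose g t := `|f t|%R.
have Fg : carrier F g by rewrite /carrier/= lattice_norm_abs.
have ug n : Psi (u n) <= Psi g.
  have [u0 uF _] := Hu n.
  apply: mono => //.
    by rewrite /carrier/= (le_lt_trans uF)// ltry.
  move: uf; apply: ae_I01S => t tI /(_ n.+1); rewrite big_ord_recr/= => Hle.
  rewrite /g (le_trans _ (ler_norm _))// (le_trans _ Hle)// lerDr.
  by apply: sumr_ge0 => i _; have [+ _ _] := Hu i; exact.
have gfin : Psi g < +oo by apply: fin => // t _; exact: normr_ge0.
have ng n : n%:R%:E <= Psi g by apply: le_trans (ug n); have [] := Hu n.
move: gfin ng; case: (Psi g) => [p _ ng| |_ /(_ 0%N)]//.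
have := ng (Num.truncn p).+1; rewrite lee_fin leNgt => /negP; apply.
exact: truncnS_gt.
Qed.

Lemma on_extended_le (Phi : (R -> R) -> \bar R) (g : R -> \bar R) h :
  g = EFin \o h %[ae leb in @I01 R] -> on_extended Phi g <= Phi h.
Proof. by move=> gh; apply: ereal_inf_lbound; exists h. Qed.

Lemma on_extended_ltP (Phi : (R -> R) -> \bar R) (g : R -> \bar R) (c : \bar R) :
  on_extended Phi g < c ->
  exists2 h, g = EFin \o h %[ae leb in @I01 R] & Phi h < c.
Proof. by move=> /ereal_inf_lt[_ [h gh <-]] Hc; exists h. Qed.

(** Real representatives of g agree almost everywhere, so by solidity F h is a lower bound for the
    infimum, which h itself attains. *)
Lemma on_extendedE (g : R -> \bar R) h : measurable_fun (@I01 R) h ->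
  g = EFin \o h %[ae leb in @I01 R] -> on_extended F g = F h.
Proof.
move=> mh gh; apply/eqP; rewrite eq_le on_extended_le//=.
apply: le_ereal_inf_tmp => _ [k gk <-]; apply: lattice_solid => //.
by move: gh gk; apply: ae_I01S2 => t _ -> [->].
Qed.

Lemma carrier_on_extended (g : R -> \bar R) : on_extended F g < +oo ->
  exists2 h, g = EFin \o h %[ae leb in @I01 R] &
    carrier F h /\ on_extended F g = F h.
Proof.
move=> /on_extended_ltP[h gh Fh]; exists h => //; split => //.
by apply: on_extendedE => //; exact: (lattice_measurable Fh).
Qed.

Lemma ae_fine_dominated (g : R -> \bar R) f :
  (forall t, I01 t -> 0 <= g t) ->
  {ae leb, forall t, I01 t -> g t <= (f t)%:E} ->
  g = EFin \o (fine \o g) %[ae leb in @I01 R].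
Proof.
move=> g0; apply: ae_I01S => t tI gf /=; rewrite fineK//.
by rewrite ge0_fin_numE ?g0// (le_lt_trans gf)// ltry.
Qed.

End lattice.

(** * K-functionals *)

Section K_functional_theory.
Context {R : realType}.

(** The part of the norm axioms that makes sense on a [zmodType]; symmetry stands in for homogeneity
    and is what allows differences. *)
Definition ext_norm (V : zmodType) (N : V -> \bar R) :=
  [/\ forall x, 0 <= N x, N 0%R = 0, forall x y, N (x + y)%R <= N x + N y
    & forall x, N (- x)%R = N x].

Section general.
Context (V : zmodType) (N0 N1 : V -> \bar R).
Hypotheses (hN0 : ext_norm N0) (hN1 : ext_norm N1).
Implicit Types (x y : V) (s t : R).
Local Notation K := (K_functional N0 N1).

Lemma K_le t x x0 x1 : carrier N0 x0 -> carrier N1 x1 -> x = (x0 + x1)%R ->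
  K t x <= N0 x0 + t%:E * N1 x1.
Proof. by move=> c0 c1 E; apply: ereal_inf_lbound; exists x0, x1. Qed.

Lemma K_ltP t x c : K t x < c -> exists x0 x1,
  [/\ carrier N0 x0, carrier N1 x1, x = (x0 + x1)%R & N0 x0 + t%:E * N1 x1 < c].
Proof. by move=> /ereal_inf_lt[_ [x0 [x1 [? ? ? ->]]] ?]; exists x0, x1. Qed.

Lemma K_ge t x c : (forall x0 x1, carrier N0 x0 -> carrier N1 x1 ->
  x = (x0 + x1)%R -> c <= N0 x0 + t%:E * N1 x1) -> c <= K t x.
Proof. by move=> H; apply: le_ereal_inf_tmp => _ [x0 [x1 [? ? ? ->]]]; exact: H. Qed.

Lemma K_ge0 t x : (0 <= t)%R -> 0 <= K t x.
Proof.
have [N0g _ _ _] := hN0; have [N1g _ _ _] := hN1.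
by move=> t0; apply: K_ge => x0 x1 _ _ _; rewrite adde_ge0// mule_ge0.
Qed.

Lemma K_nd s t x : (s <= t)%R -> K s x <= K t x.
Proof.
have [N1g _ _ _] := hN1.
move=> st; apply: K_ge => x0 x1 c0 c1 E; apply: (le_trans (K_le s c0 c1 E)).
by rewrite leeD2l// lee_wpmul2r// lee_fin.
Qed.

(** One decomposition serves both parameters: for s <= t, (s/t) (N0 + t N1) <= N0 + s N1. Hence
    K(t)/t is non-increasing. *)
Lemma K_quasi s t x : (0 < s)%R -> (s <= t)%R -> (s / t)%:E * K t x <= K s x.
Proof.
have [N0g _ _ _] := hN0; have [N1g _ _ _] := hN1.
move=> s0 st; have t0 : (0 < t)%R by exact: lt_le_trans st.
apply: K_ge => x0 x1 c0 c1 E.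
apply: (@le_trans _ _ ((s / t)%:E * (N0 x0 + t%:E * N1 x1))).
  by rewrite lee_wpmul2l ?lee_fin ?divr_ge0 ?(ltW s0) ?(ltW t0)//; exact: K_le.
rewrite ge0_muleDr// ?mule_ge0 ?lee_fin ?(ltW t0)//; apply: leeD.
  rewrite -[leRHS]mul1e lee_wpmul2r// lee_fin ler_pdivrMr// mul1r//.
by rewrite muleA -EFinM divfK// gt_eqF.
Qed.

Lemma K_le0 t x : K t x <= N0 x.
Proof.
have [_ N10 _ _] := hN1.
have [->|Nx] := eqVneq (N0 x) +oo; first exact: leey.
apply: le_trans (@K_le t x x 0%R _ _ _) _; rewrite /carrier/= ?ltey ?N10 ?addr0//.
by rewrite mule0 adde0.
Qed.

Lemma K_le1 t x : (0 < t)%R -> K t x <= t%:E * N1 x.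
Proof.
have [_ N00 _ _] := hN0; move=> t0.
have [->|Nx] := eqVneq (N1 x) +oo; first by rewrite gt0_muley ?lte_fin// leey.
apply: le_trans (@K_le t x 0%R x _ _ _) _; rewrite /carrier/= ?ltey ?N00 ?add0r ?add0e//.
Qed.

Lemma K_D t x y : (0 <= t)%R -> K t (x + y)%R <= K t x + K t y.
Proof.
have [N0g _ N0D _] := hN0; have [N1g _ N1D _] := hN1; move=> t0.
have [xoo|xoo] := eqVneq (K t x) +oo.
  by rewrite xoo addye ?leey// gt_eqF// (lt_le_trans _ (K_ge0 _ t0)).
have [yoo|yoo] := eqVneq (K t y) +oo.
  by rewrite yoo addey ?leey// gt_eqF// (lt_le_trans _ (K_ge0 _ t0)).
have xfin : K t x \is a fin_num by rewrite ge0_fin_numE ?ltey// K_ge0.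
have yfin : K t y \is a fin_num by rewrite ge0_fin_numE ?ltey// K_ge0.
apply/lee_addgt0Pr => e e0; have e20 : (0 < e / 2)%R by rewrite divr_gt0.
have : K t x < K t x + (e / 2)%:E by rewrite lteDl// lte_fin.
move=> /K_ltP[x0 [x1 [cx0 cx1 Ex Hx]]].
have : K t y < K t y + (e / 2)%:E by rewrite lteDl// lte_fin.
move=> /K_ltP[y0 [y1 [cy0 cy1 Ey Hy]]].
apply: (@le_trans _ _ (N0 (x0 + y0)%R + t%:E * N1 (x1 + y1)%R)).
  apply: K_le.
  - by rewrite /carrier/= (le_lt_trans (N0D _ _))// lte_add_pinfty.
  - by rewrite /carrier/= (le_lt_trans (N1D _ _))// lte_add_pinfty.
  - by rewrite Ex Ey addrACA.
have He : K t x + K t y + e%:E = (K t x + (e / 2)%:E) + (K t y + (e / 2)%:E).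
  by rewrite [in RHS]addeACA -EFinD -splitr.
rewrite He; apply: (le_trans _ (leeD (ltW Hx) (ltW Hy))).
rewrite addeACA leeD// -ge0_muleDr// lee_wpmul2l//.
Qed.

Lemma K_N t x : K t (- x)%R = K t x.
Proof.
have [_ _ _ N0N] := hN0; have [_ _ _ N1N] := hN1.
have H y : K t y <= K t (- y)%R.
  apply: K_ge => x0 x1 c0 c1 E.
  rewrite -(N0N x0) -(N1N x1); apply: K_le; rewrite /carrier/= ?N0N ?N1N//.
  by rewrite -opprD -E opprK.
by apply/eqP; rewrite eq_le H -{2}(opprK x) H.
Qed.

Lemma K_lty t x : (0 <= t)%R -> sum_space N0 N1 x -> K t x < +oo.
Proof.
have [N0g _ _ _] := hN0; have [N1g _ _ _] := hN1.
move=> t0 [x0 [x1 [c0 c1 E]]]; apply: (le_lt_trans (K_le t c0 c1 E)).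
rewrite lte_add_pinfty// -[N1 x1]fineK -?EFinM ?ltry//.
by rewrite ge0_fin_numE.
Qed.

Lemma K_lty_all s t x : (0 < s)%R -> (0 < t)%R -> K s x < +oo -> K t x < +oo.
Proof.
move=> s0 t0 /K_ltP[x0 [x1 [c0 c1 E _]]].
by apply: K_lty; [exact: ltW|exists x0, x1].
Qed.

End general.

Section embedded_norm.
Context (V : zmodType) (X : normedModType R) (e : X -> V).

(** Common form of [norm0] and [norm1], to which it is convertible, so that both are treated at
    once. *)
Definition embedded_norm (x : V) : \bar R :=
  ereal_inf [set `|a|%:E | a in [set a : X | e a = x]].

Lemma embedded_norm_ltP x : embedded_norm x < +oo -> exists a, e a = x.
Proof. by move=> /ereal_inf_lt[_ [a ea _] _]; exists a. Qed.

Lemma embedded_normE a : injective e -> embedded_norm (e a) = `|a|%:E.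
Proof.
move=> ei; apply/eqP; rewrite eq_le; apply/andP; split.
  by apply: ereal_inf_lbound; exists a.
by apply: le_ereal_inf_tmp => _ [b /ei -> <-].
Qed.

Lemma embedded_norm_ge0 x : 0 <= embedded_norm x.
Proof. by apply: le_ereal_inf_tmp => _ [a _ <-]; rewrite lee_fin. Qed.

End embedded_norm.

Lemma embedded_ext_norm (V : lmodType R) (X : normedModType R)
  (e : {linear X -> V}) : injective e -> ext_norm (embedded_norm e).
Proof.
move=> ei; split.
- exact: embedded_norm_ge0.
- by rewrite -(linear0 e) embedded_normE// normr0.
- move=> x y.
  have [xoo|] := eqVneq (embedded_norm e x) +oo.
    by rewrite xoo addye ?leey// gt_eqF// (lt_le_trans _ (embedded_norm_ge0 _ _)).
  rewrite -ltey => /embedded_norm_ltP[a <-].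
  have [yoo|] := eqVneq (embedded_norm e y) +oo.
    by rewrite yoo addey ?leey// gt_eqF// (lt_le_trans _ (embedded_norm_ge0 _ _)).
  rewrite -ltey => /embedded_norm_ltP[b <-].
  by rewrite -linearD !embedded_normE// -EFinD lee_fin ler_normD.
- have H x : embedded_norm e (- x)%R <= embedded_norm e x.
    apply: le_ereal_inf_tmp => _ [a ea <-]; apply: ereal_inf_lbound.
    by exists (- a)%R; rewrite ?normrN//= linearN ea.
  by move=> x; apply/eqP; rewrite eq_le H -{1}(opprK x) H.
Qed.

Lemma ext_norm0 (A : banach_pair R) : ext_norm (@norm0 R A).
Proof. exact: (embedded_ext_norm (@embed0_inj R A)). Qed.

Lemma ext_norm1 (A : banach_pair R) : ext_norm (@norm1 R A).
Proof. exact: (embedded_ext_norm (@embed1_inj R A)). Qed.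

(** The last clause says that k t / t is non-increasing, multiplied out. *)
Definition quasi_concave (k : R -> R) :=
  [/\ forall t, (0 < t)%R -> (0 <= k t)%R,
      forall s t, (0 < s)%R -> (s <= t)%R -> (k s <= k t)%R
    & forall s t, (0 < s)%R -> (s <= t)%R -> (s * k t <= t * k s)%R].

Lemma K_pair_quasi_concave (A : banach_pair R) (a : ambient A) :
  (forall t, (0 < t)%R -> K_pair t a < +oo) ->
  quasi_concave (fun t => fine (K_pair t a)).
Proof.
have h0 := ext_norm0 A; have h1 := ext_norm1 A.
move=> Kfin.
have Kf t : (0 < t)%R -> K_pair t a = (fine (K_pair t a))%:E.
  by move=> t0; rewrite fineK// ge0_fin_numE ?Kfin//; apply: K_ge0 => //; exact: ltW.
split.
- by move=> t t0; rewrite fine_ge0//; apply: K_ge0 => //; exact: ltW.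
- move=> s t s0 st; rewrite -lee_fin -!Kf//; last exact: lt_le_trans st.
  exact: K_nd.
- move=> s t s0 st; have t0 : (0 < t)%R by exact: lt_le_trans st.
  have := K_quasi h0 h1 a s0 st.
  rewrite -/(K_pair s a) -/(K_pair t a) Kf// (Kf s)// -EFinM lee_fin.
  by rewrite mulrAC ler_pdivrMr// [(_ * t)%R]mulrC.
Qed.

End K_functional_theory.

(** * The truncated norms *)

Section power_integral.
Context {R : realType}.
Notation leb := (@lebesgue_measure R).

Lemma measurable_powR_on (D : set R) (p : R) :
  measurable_fun D (fun s : R => s `^ p)%R.
Proof. by apply: measurable_funTS; exact: measurable_powR. Qed.

(** The integrand may be singular at 0, so the fundamental theorem is applied on [r n, t] and r n
    tends to 0 by monotone convergence. *)
Lemma integral_powR (al t : R) : (0 < al)%R -> (0 < t)%R ->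
  \int[leb]_(s in `]0%R, t[) (s `^ (al - 1))%:E = (t `^ al / al)%:E.
Proof.
(* The factor 1/2 keeps r n < t already for n = 0. *)
move=> al0 t0; pose r (n : nat) : R := (t / 2 * n.+1%:R^-1)%R.
have r0 n : (0 < r n)%R by rewrite mulr_gt0 ?divr_gt0 ?invr_gt0.
have rt n : (r n < t)%R.
  apply: (@le_lt_trans _ _ (t / 2)%R); last by lra.
  by rewrite ler_piMr ?divr_ge0 ?(ltW t0)// invf_le1// ler1n.
have rcvg : r n @[n --> \oo] --> (0 : R)%R.
  rewrite -(mulr0 (t / 2)%R); apply: cvgM; first exact: cvg_cst.
  exact: cvg_harmonic.
have mp (D : set R) : measurable_fun D (fun s : R => (s `^ (al - 1))%:E).
  by apply/measurable_EFinP; exact: measurable_powR_on.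
pose I n : set R := `[r n, t]%classic.
have FTC n : \int[leb]_(s in I n) (s `^ (al - 1))%:E =
    (t `^ al / al)%:E - (r n `^ al / al)%:E.
  have D (x : R) : (0 < x)%R -> derivable (fun s : R => s `^ al / al)%R x 1%R.
    move=> x0; apply: derivableM; last exact: derivable_cst.
    by apply: derivable_powR; rewrite ?in_itv/= ?andbT.
  have C (x : R) : (0 < x)%R -> {for x, continuous (fun s : R => s `^ al / al)%R}.
    by move=> x0; apply: differentiable_continuous; apply/derivable1_diffP; exact: D.
  apply: (@continuous_FTC2 R (fun s => s `^ (al - 1))%R (fun s => s `^ al / al)%R).
  - exact: rt.
  - apply: continuous_in_subspaceT => x; rewrite inE/= in_itv/= => /andP[rx _].
    apply: differentiable_continuous; apply/derivable1_diffP.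
    by apply: derivable_powR; rewrite ?in_itv/= ?andbT// (lt_le_trans (r0 n)).
  - split.
    + by move=> x; rewrite in_itv/= => /andP[rx _]; apply: D; exact: lt_trans rx.
    + by apply: cvg_at_right_filter; exact: C.
    + by apply: cvg_at_left_filter; exact: C.
  - move=> x; rewrite in_itv/= => /andP[rx _].
    have x0 : (0 < x)%R by exact: lt_trans rx.
    have [+ <-] : is_derive x 1%R (fun s : R => s `^ al / al)%R (x `^ (al - 1))%R.
      have -> : (x `^ (al - 1) = al^-1 * (al * x `^ (al - 1)))%R.
        by rewrite mulrA mulVf ?mul1r// gt_eqF.
      rewrite (_ : (fun s => _) = (fun s => al^-1 *: (s `^ al)))%R; last first.
        by apply/funext => s; rewrite mulrC.
      by apply: is_deriveZ; exact: is_derive1_powR.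
    by rewrite derive1E.
have H : \int[leb]_(x in I i) (x `^ (al - 1))%:E @[i --> \oo]
    --> \int[leb]_(x in \bigcup_i I i) (x `^ (al - 1))%:E.
  apply: ge0_nondecreasing_set_cvg_integral.
  - move=> m n mn; rewrite subsetEset /I => x /=; rewrite !in_itv/= => /andP[rx ->].
    rewrite andbT (le_trans _ rx)// ler_wpM2l ?divr_ge0 ?(ltW t0)//.
    by rewrite lef_pV2 ?posrE// ler_nat.
  - by move=> i; exact: measurable_itv.
  - by move=> i; exact: mp.
  - by move=> i x _; rewrite lee_fin powR_ge0.
rewrite (integral_itv_bndo_bndc (mp _)).
have -> : `]0%R, t]%classic = \bigcup_i I i.
  apply/seteqP; split => x /=.
    rewrite in_itv/= => /andP[x0 xt]; exists (Num.truncn (t / 2 / x)) => //.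
    rewrite /I/= in_itv/= xt andbT ler_pdivrMr// [leRHS]mulrC -ler_pdivrMr//.
    by apply: ltW; exact: truncnS_gt.
  by move=> [n _]; rewrite /I/= !in_itv/= => /andP[rx ->]; rewrite (lt_le_trans _ rx).
apply: (cvg_unique (@ereal_hausdorff R) H).
have -> : (fun n => \int[leb]_(x in I n) (x `^ (al - 1))%:E) =
    (fun n => (t `^ al / al)%:E - (r n `^ al / al)%:E).
  by apply/funext => n; exact: FTC.
suff : (t `^ al / al)%:E - (r n `^ al / al)%:E @[n --> \oo] -->
    (t `^ al / al)%:E - 0%:E by rewrite sube0.
apply: (@cvgeB _ _ _ _ (fun=> (t `^ al / al)%:E)) => //; first exact: cvg_cst.
apply: cvg_EFin; first exact: nearW.
rewrite -(mul0r al^-1%R); apply: cvgM; last exact: cvg_cst.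
have /cvg_at_rightP := powR_cvg0 al0.
by apply; split => // n; exact: r0.
Qed.

Lemma quasi_concave_measurable (k : R -> R) : quasi_concave k ->
  measurable_fun (`]0%R, 1%R[%classic : set R) k /\ measurable_fun (@I01 R) k.
Proof.
move=> [k0 knd _].
have H : measurable_fun (`]0%R, 1%R[%classic : set R) k.
  apply: (@eq_measurable_fun _ _ _ _ _ (fun t : R => if (0 < t)%R then k t else 0%R)).
    by move=> t; rewrite inE/= in_itv/= => /andP[->].
  apply: nondecreasing_measurable => // s t st.
  case: ifPn => s0; last by case: ifPn => // t0; exact: k0.
  by rewrite (lt_le_trans s0 st); exact: knd.
by split=> //; exact: measurable_fun_itv_cc H.
Qed.

End power_integral.

Section profile_bounds.
Context {R : realType} (A : banach_pair R) (a : ambient A).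
Notation leb := (@lebesgue_measure R).
Hypothesis Kfin : forall t, (0 < t)%R -> K_pair t a < +oo.
Let k (t : R) := fine (K_pair t a).

Let kqc : quasi_concave k. Proof. exact: K_pair_quasi_concave. Qed.

Let KE t : (0 < t)%R -> K_pair t a = (k t)%:E.
Proof.
move=> t0; rewrite /k fineK// ge0_fin_numE ?Kfin//.
by apply: K_ge0; [exact: ext_norm0|exact: ext_norm1|exact: ltW].
Qed.

Let k0 t : (0 < t)%R -> (0 <= k t)%R. Proof. by case: kqc => + _ _; exact. Qed.

Lemma norm_theta_y_ge0 (th : R) : 0 <= norm_theta_q th +oo a.
Proof.
apply: (@le_trans _ _ ((2^-1 `^ (- th))%:E * K_pair 2^-1 a)).
  by rewrite KE// -EFinM lee_fin mulr_ge0 ?powR_ge0// k0.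
apply: ereal_sup_ubound; exists 2^-1%R => //=.
by rewrite in_itv/= invr_gt0 invf_lt1 ?ltr0n ?ltr1n.
Qed.

Lemma norm_theta_y_ge (th s : R) : (0 < s)%R -> (s < 1)%R ->
  (s `^ (- th) * k s)%:E <= norm_theta_q th +oo a.
Proof.
move=> s0 s1; apply: ereal_sup_ubound; exists s; first by rewrite /= in_itv/= s0.
by rewrite KE.
Qed.

Lemma norm_theta_finE (th q : R) : norm_theta_q th q%:E a =
  ((q * th * (1 - th)) `^ q^-1)%:E *
  (\int[leb]_(s in `]0%R, 1%R[) ((s `^ (- th) * k s) `^ q * s^-1)%:E) `^ q^-1.
Proof.
rewrite /norm_theta_q; congr (_ * poweR _ _); apply: eq_integral => s.
by rewrite inE/= in_itv/= => /andP[s0 _]; rewrite KE// -EFinM poweR_EFin -EFinM.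
Qed.

Lemma measurable_integrand (th q : R) :
  measurable_fun (`]0%R, 1%R[%classic : set R) (fun s : R => ((s `^ (- th) * k s) `^ q * s^-1)%:E).
Proof.
apply/measurable_EFinP; apply: measurable_funM.
  apply: (measurableT_comp (measurable_powR q)).
  apply: measurable_funM; first exact: measurable_powR_on.
  by have [] := quasi_concave_measurable kqc.
apply: (@eq_measurable_fun _ _ _ _ _ (fun t : R => t `^ (-1))%R).
  by move=> t; rewrite inE/= in_itv/= => /andP[t0 _]; rewrite powR_inv1// ltW.
exact: measurable_powR_on.
Qed.

(* Passing to the exponent (1 + th) / 2 turns every q into q = +oo; since the
   sup norm is trivially subadditive, Minkowski's inequality is not needed. *)
Lemma norm_theta_upper (th : R) (q : \bar R) :
  (0 < th)%R -> (th < 1)%R -> 1 <= q ->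
  norm_theta_q th q a <= 2%:E * norm_theta_q ((1 + th) / 2)%R +oo a.
Proof.
move=> th0 th1; set et := ((1 + th) / 2)%R.
have etth : (et - th = (1 - th) / 2)%R by rewrite /et; lra.
case: q => [q| _|//]; last first.
  apply: (@le_trans _ _ (norm_theta_q et +oo a)); last first.
    by rewrite -[leLHS]mul1e lee_wpmul2r ?norm_theta_y_ge0// lee_fin ler1n.
  apply: ge_ereal_sup => _ [s + <-]; rewrite /= in_itv/= => /andP[s0 s1].
  apply: (le_trans _ (norm_theta_y_ge et s0 s1)).
  rewrite KE// -EFinM lee_fin ler_wpM2r ?k0//; apply: ger_powR.
    by rewrite s0 ltW.
  by rewrite lerN2 /et; lra.
rewrite lee_fin => q1; have q0 : (0 < q)%R by exact: lt_le_trans q1.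
have := norm_theta_y_ge et; have := norm_theta_y_ge0 et.
case: (norm_theta_q et +oo a) => [m||]//; last first.
  by move=> _ _; rewrite gt0_muley ?leey ?lte_fin.
rewrite lee_fin => m0 Hm.
(* By definition of m, s^-th K(s) <= m s^((1 - th)/2), and the q-th power of the right side
   integrates against ds/s to m^q / al. *)
pose al := (q * ((1 - th) / 2))%R.
have al0 : (0 < al)%R by rewrite mulr_gt0// divr_gt0// subr_gt0.
have Hint : \int[leb]_(s in `]0%R, 1%R[) ((s `^ (- th) * k s) `^ q * s^-1)%:E
    <= (m `^ q / al)%:E.
  apply: (@le_trans _ _ (\int[leb]_(s in `]0%R, 1%R[) ((m `^ q)%:E * (s `^ (al - 1))%:E))).
    apply: ge0_le_integral => //.
    - move=> s /=; rewrite in_itv/= => /andP[s0 _].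
      by rewrite lee_fin mulr_ge0 ?powR_ge0// invr_ge0 ltW.
    - exact: measurable_integrand.
    - apply/measurable_EFinP; apply: measurable_funM => //.
      exact: measurable_powR_on.
    - move=> s /=; rewrite in_itv/= => /andP[s0 s1].
      rewrite -EFinM lee_fin powRB; last by rewrite (gt_eqF s0) implybT.
      rewrite powRr1 ?(ltW s0)// mulrA ler_wpM2r ?invr_ge0 ?(ltW s0)//.
      rewrite /al (mulrC q) powRrM -powRM ?powR_ge0// ge0_ler_powR ?nnegrE ?(ltW q0)//.
      + by rewrite mulr_ge0 ?powR_ge0// k0.
      + by rewrite mulr_ge0 ?powR_ge0.
      + rewrite (_ : s `^ (- th) = s `^ ((1 - th) / 2 + - et))%R; last first.
          by congr (_ `^ _)%R; rewrite -etth; lra.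
        rewrite powRD; last by rewrite (gt_eqF s0) implybT.
        rewrite -mulrA [leRHS]mulrC ler_wpM2l ?powR_ge0//.
        by have := Hm s s0 s1; rewrite lee_fin.
  rewrite ge0_integralZl_EFin ?powR_ge0//.
  - by rewrite integral_powR// powR1 -EFinM mul1r.
  - by move=> s _; rewrite lee_fin powR_ge0.
  - by apply/measurable_EFinP; exact: measurable_powR_on.
rewrite norm_theta_finE; set I := (\int[leb]_(_ in _) _).
have : I <= (m `^ q / al)%:E by exact: Hint.
have : 0 <= I.
  apply: integral_ge0 => s /=; rewrite in_itv/= => /andP[s0 _].
  by rewrite lee_fin mulr_ge0 ?powR_ge0// invr_ge0 ltW.
case: I => [i||]//; rewrite !lee_fin => i0 iM.
rewrite -powRM//; last first.
  by rewrite !mulr_ge0 ?subr_ge0 ?ltW.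
have qV : (0 <= q^-1)%R by rewrite invr_ge0 ltW.
apply: (@le_trans _ _ (((2 * m) `^ q) `^ q^-1)%R); last first.
  by rewrite -powRrM mulfV ?gt_eqF// powRr1// mulr_ge0.
apply: ge0_ler_powR => //.
- by rewrite nnegrE mulr_ge0// !mulr_ge0 ?subr_ge0 ?ltW.
- by rewrite nnegrE powR_ge0.
(* The normalisation cancels 1/al up to the factor 2 th, and 2 th <= 2 <= 2^q. *)
- apply: (@le_trans _ _ (q * th * (1 - th) * (m `^ q / al)))%R.
    by rewrite ler_wpM2l// !mulr_ge0 ?subr_ge0 ?ltW.
  have -> : (q * th * (1 - th) * (m `^ q / al) = 2 * th * m `^ q)%R.
    rewrite /al; have : (1 - th != 0)%R by rewrite gt_eqF ?subr_gt0.
    move: (1 - th)%R => x x0.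
    rewrite !invfM invrK; move: (m `^ q)%R => M.
    have -> : (q * th * x * (M * (q^-1 * (x^-1 * 2))) = 2 * th * M *
      (q * q^-1) * (x * x^-1))%R by lra.
    by rewrite (mulfV x0) mulfV ?gt_eqF// !mulr1.
  rewrite powRM//  ler_wpM2r ?powR_ge0//.
  apply: (@le_trans _ _ 2%R); first by rewrite ger_pMr// ltW.
  by rewrite -[leLHS](@powRr1 R)// ler_powR// ler1n.
Qed.

(** For s <= u one has K(s)/s >= K(u)/u, so on ]0, u[ the integrand is at least (K(u)/u)^q s^(q(1 -
    th) - 1). The normalisation cancels the constant of integration and leaves th^(1/q), which is at
    least th >= 1/2 because th < 1 <= q. For q = +oo the point s = u suffices. *)
Lemma norm_theta_lower (th u : R) (q : \bar R) :
  (2^-1 <= th)%R -> (th < 1)%R -> (0 < u)%R -> (u < 1)%R -> 1 <= q ->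
  (2^-1 * u `^ (1 - th) * (k u / u))%:E <= norm_theta_q th q a.
Proof.
move=> th2 th1 u0 u1.
have th0 : (0 < th)%R by apply: lt_le_trans th2; rewrite invr_gt0.
have ku0 : (0 <= k u / u)%R by rewrite divr_ge0 ?k0 ?ltW.
have Es s : (0 < s)%R -> (s `^ (- th) = s `^ (1 - th) / s)%R.
  move=> s0; rewrite (_ : s `^ (- th) = s `^ ((1 - th) + -1))%R; last by congr (_ `^ _)%R; lra.
  rewrite powRD; last by rewrite (gt_eqF s0) implybT.
  by rewrite powR_inv1// ltW.
case: q => [q| _|//]; last first.
  apply: (le_trans _ (norm_theta_y_ge th u0 u1)).
  rewrite Es// lee_fin -mulrA.
  have -> : (u `^ (1 - th) / u * k u = 1 * (u `^ (1 - th) * (k u / u)))%R by lra.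
  by apply: ler_wpM2r; [rewrite mulr_ge0 ?powR_ge0|lra].
rewrite lee_fin => q1; have q0 : (0 < q)%R by exact: lt_le_trans q1.
pose al := (q * (1 - th))%R.
have al0 : (0 < al)%R by rewrite mulr_gt0// subr_gt0.
have Hint : ((k u / u) `^ q * (u `^ al / al))%:E <=
    \int[leb]_(s in `]0%R, 1%R[) ((s `^ (- th) * k s) `^ q * s^-1)%:E.
  apply: (@le_trans _ _ (\int[leb]_(s in `]0%R, u[)
    ((s `^ (- th) * k s) `^ q * s^-1)%:E)); last first.
    apply: ge0_subset_integral => //.
    - exact: measurable_integrand.
    - move=> s /=; rewrite in_itv/= => /andP[s0 _].
      by rewrite lee_fin mulr_ge0 ?powR_ge0// invr_ge0 ltW.
    - move=> s /=; rewrite !in_itv/= => /andP[-> su].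
      exact: lt_trans su u1.
  rewrite EFinM -integral_powR// -ge0_integralZl_EFin ?powR_ge0//; last 2 first.
  - by move=> s _; rewrite lee_fin powR_ge0.
  - by apply/measurable_EFinP; exact: measurable_powR_on.
  apply: ge0_le_integral => //.
  - by move=> s _; rewrite lee_fin mulr_ge0 ?powR_ge0.
  - apply/measurable_EFinP; apply: measurable_funM => //.
    exact: measurable_powR_on.
  - apply: measurable_funS (measurable_integrand th q) => //.
    move=> s /=; rewrite !in_itv/= => /andP[-> su].
    exact: lt_trans su u1.
  - move=> s /=; rewrite in_itv/= => /andP[s0 su].
    rewrite -EFinM lee_fin powRB; last by rewrite (gt_eqF s0) implybT.
    rewrite powRr1 ?(ltW s0)// mulrA ler_wpM2r ?invr_ge0 ?(ltW s0)//.
    rewrite /al (mulrC q) powRrM [leLHS]mulrC -powRM ?powR_ge0//.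
    rewrite ge0_ler_powR ?nnegrE ?(ltW q0)//.
    + by rewrite mulr_ge0 ?powR_ge0.
    + by rewrite mulr_ge0 ?powR_ge0// k0.
    + rewrite Es// -mulrA ler_wpM2l ?powR_ge0//.
      rewrite ler_pdivrMr// -mulrA -(ler_pM2l s0).
      rewrite mulVKf ?gt_eqF// [leRHS]mulrC.
      by have [_ _ kq] := kqc; apply: kq => //; exact: ltW.
rewrite norm_theta_finE.
set I := (\int[leb]_(_ in _) _) in Hint *.
have qV : (0 <= q^-1)%R by rewrite invr_ge0 ltW.
apply: (@le_trans _ _ (((q * th * (1 - th)) `^ q^-1)%:E *
    (((k u / u) `^ q * (u `^ al / al))%:E) `^ q^-1)); last first.
  rewrite lee_wpmul2l ?lee_fin ?powR_ge0//.
  have X0 : 0 <= ((k u / u) `^ q * (u `^ al / al))%:E.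
    by rewrite lee_fin !mulr_ge0 ?powR_ge0// invr_ge0 ltW.
  apply: gt0_ler_poweR => //; rewrite in_itv/= leey andbT//.
  exact: le_trans Hint.
rewrite poweR_EFin -EFinM lee_fin -powRM; last 2 first.
- by rewrite !mulr_ge0 ?subr_ge0 ?ltW.
- by rewrite !mulr_ge0 ?powR_ge0// invr_ge0 ltW.
have -> : (q * th * (1 - th) * ((k u / u) `^ q * (u `^ al / al)) =
    th * (u `^ (1 - th) * (k u / u)) `^ q)%R.
  rewrite [in RHS]powRM ?powR_ge0// -powRrM [((1 - th) * q)%R]mulrC -/al.
  have -> : (q * th * (1 - th) * ((k u / u) `^ q * (u `^ al / al)) =
    th * (u `^ al * (k u / u) `^ q) * (al / al))%R by rewrite /al; lra.
  by rewrite mulfV ?mulr1 ?gt_eqF.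
rewrite powRM ?powR_ge0 ?(ltW th0)// -powRrM mulfV ?gt_eqF// powRr1; last first.
  by rewrite mulr_ge0 ?powR_ge0.
rewrite -mulrA; apply: ler_wpM2r; first by rewrite mulr_ge0 ?powR_ge0.
apply: (le_trans th2); rewrite -[leLHS](@powRr1 _ th) ?(ltW th0)//.
by apply: ger_powR; rewrite ?th0 ?(ltW th1)// invf_le1.
Qed.

End profile_bounds.

(** * The exponent theta(t) *)

Section theta.
Context {R : realType}.
Notation leb := (@lebesgue_measure R).
Implicit Types t : R.

Lemma theta_ofE t : (0 < t)%R -> theta_of t = (1 - (2 * (1 - ln t))^-1)%R.
Proof.
move=> t0; rewrite /theta_of ln_div ?posrE ?expR_gt0// expRK.
by congr (_ + _)%R; rewrite -invrN; congr (_^-1)%R; lra.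
Qed.

Lemma onem_thetaE t : (0 < t)%R -> (1 - theta_of t = (2 * (1 - ln t))^-1)%R.
Proof. by move=> t0; rewrite theta_ofE//; lra. Qed.

Lemma theta_of_itv t : (0 < t)%R -> (t < 1)%R ->
  (2^-1 <= theta_of t)%R /\ (theta_of t < 1)%R.
Proof.
move=> t0 t1; have l0 : (ln t < 0)%R by rewrite ln_lt0// t0.
have := onem_thetaE t0.
have : (0 < (2 * (1 - ln t))^-1)%R by rewrite invr_gt0; lra.
have : ((2 * (1 - ln t))^-1 <= 2^-1)%R by rewrite lef_pV2 ?posrE//; lra.
by move=> ? ? ?; split; lra.
Qed.

Lemma theta_of_ni s t : (0 < s)%R -> (s <= t)%R -> (t < 1)%R ->
  (theta_of t <= theta_of s)%R.
Proof.
move=> s0 st t1; have t0 : (0 < t)%R by exact: lt_le_trans st.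
have l0 : (ln t < 0)%R by rewrite ln_lt0// t0.
have ll : (ln s <= ln t)%R by rewrite ler_ln ?posrE.
rewrite !theta_ofE// lerD2l lerN2 lef_pV2 ?posrE//; lra.
Qed.

(** The exponent of e is r ln t / (2 (1 - ln t)), and ln t / (1 - ln t) > -1. The case r = 1 serves
    the test at t, the case r = 2 the test at t^2. *)
Lemma powR_onem_theta t (r : R) : (0 < t)%R -> (t < 1)%R -> (0 <= r)%R ->
  (expR (- r / 2) <= t `^ (r * (1 - theta_of t)))%R.
Proof.
move=> t0 t1 r0; rewrite /powR gt_eqF// ler_expR onem_thetaE//.
have l0 : (ln t < 0)%R by rewrite ln_lt0// t0.
have d0 : (0 < 2 * (1 - ln t))%R by lra.
rewrite mulrAC ler_pdivlMr//.
have -> : (- r / 2 * (2 * (1 - ln t)) = r * (ln t - 1))%R by lra.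
by rewrite ler_wpM2l//; lra.
Qed.

Lemma measurable_theta_of : measurable_fun (`]0%R, 1%R[%classic : set R) (@theta_of R).
Proof.
apply: (@eq_measurable_fun _ _ R R _ (fun t : R => 1 - (2 * (1 - ln t)) `^ (-1))%R).
  move=> t; rewrite inE/= in_itv/= => /andP[t0 t1].
  have l0 : (ln t < 0)%R by rewrite ln_lt0// t0.
  by rewrite theta_ofE// powR_inv1//; lra.
apply: measurable_funB => //; apply: (measurableT_comp (measurable_powR (-1))).
apply: measurable_funM => //; apply: measurable_funB => //.
exact: measurable_funTS (@measurable_ln R).
Qed.

(** Superlevel sets are intervals. Values are extended because the truncated norms, as functions of
    t, may be infinite. *)
Lemma nonincreasing_emeasurable (f : R -> \bar R) :
  (forall s t : R, (0 < s)%R -> (s <= t)%R -> (t < 1)%R -> f t <= f s) ->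
  measurable_fun (`]0%R, 1%R[%classic : set R) f.
Proof.
move=> fni; apply: (measurability _ (ErealGenOInfty.measurableE R)).
move=> /= _ [_ [a ->]] <-; apply: is_interval_measurable => s t/=.
rewrite !in_itv/= !andbT => -[/andP[s0 s1] fs] [/andP[t0 t1] ft] u /andP[su ut].
have u0 : (0 < u)%R by exact: lt_le_trans su.
have u1 : (u < 1)%R by exact: le_lt_trans t1.
split; first by apply/andP; split.
by rewrite ?in_itv/= ?andbT (lt_le_trans ft)//; exact: fni.
Qed.

End theta.

(** * The profile of an element and its majorant *)

Section profile.
Context {R : realType} (A : banach_pair R) (a : ambient A).
Notation leb := (@lebesgue_measure R).
Hypothesis Kfin : forall t, (0 < t)%R -> K_pair t a < +oo.
Let k (t : R) := fine (K_pair t a).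

Let kqc : quasi_concave k. Proof. exact: K_pair_quasi_concave. Qed.

Let k0 t : (0 < t)%R -> (0 <= k t)%R. Proof. by case: kqc => + _ _; exact. Qed.

(** No q occurs here: this is why the constants of the upper bounds can be chosen before q. *)
Definition majorant (t : R) : \bar R :=
  t%:E * norm_theta_q ((1 + theta_of t) / 2)%R +oo a.

Lemma profile_le_majorant (q : \bar R) t : 1 <= q -> (0 < t)%R -> (t < 1)%R ->
  theta_profile q a t <= 2%:E * majorant t.
Proof.
move=> q1 t0 t1; have [th2 th1] := theta_of_itv t0 t1.
rewrite /theta_profile /majorant muleCA lee_wpmul2l ?lee_fin ?(ltW t0)//.
by apply: norm_theta_upper => //; lra.
Qed.

Lemma profile_ge (q : \bar R) t : 1 <= q -> (0 < t)%R -> (t < 1)%R ->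
  (expR (-1) / 2 * k t)%:E <= theta_profile q a t.
Proof.
move=> q1 t0 t1; have [th2 th1] := theta_of_itv t0 t1.
have := norm_theta_lower Kfin th2 th1 t0 t1 q1.
move=> /(lee_wpmul2l (ltW t0 : 0 <= t%:E)); apply: le_trans.
rewrite -EFinM lee_fin.
have -> : (t * (2^-1 * t `^ (1 - theta_of t) * (fine (K_pair t a) / t)) =
   t `^ (1 - theta_of t) / 2 * k t * (t / t))%R by rewrite -/(k t); lra.
rewrite mulfV ?gt_eqF// mulr1 ler_wpM2r ?k0// ler_wpM2r//.
(* The factor exp (-1/2) is weakened to exp (-1), the one available at t^2, so that both lower
   bounds share a constant. *)
apply: le_trans (_ : expR (- 1 / 2) <= _)%R; first by rewrite ler_expR; lra.
by rewrite -[X in (_ <= _ `^ X)%R]mul1r; exact: powR_onem_theta.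
Qed.

Lemma profile_ge_square (q : \bar R) t : 1 <= q -> (0 < t)%R -> (t < 1)%R ->
  (expR (-1) / 2 * (k (t ^+ 2) / t))%:E <= theta_profile q a t.
Proof.
move=> q1 t0 t1; have [th2 th1] := theta_of_itv t0 t1.
have u0 : (0 < t ^+ 2)%R by rewrite exprn_gt0.
have u1 : (t ^+ 2 < 1)%R by rewrite exprn_ilt1 ?(ltW t0).
have := norm_theta_lower Kfin th2 th1 u0 u1 q1.
move=> /(lee_wpmul2l (ltW t0 : 0 <= t%:E)); apply: le_trans.
rewrite -EFinM lee_fin -/(k (t ^+ 2)).
have -> : (t * (2^-1 * (t ^+ 2) `^ (1 - theta_of t) * (k (t ^+ 2) / t ^+ 2)) =
   (t ^+ 2) `^ (1 - theta_of t) / 2 * (k (t ^+ 2) / t))%R.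
  rewrite exprS expr1 invfM.
  have -> : (t * (2^-1 * (t * t) `^ (1 - theta_of t) * (k (t * t) * (t^-1 * t^-1))) =
   (t * t) `^ (1 - theta_of t) / 2 * (k (t * t) / t) * (t / t))%R by lra.
  by rewrite mulfV ?gt_eqF// mulr1.
apply: ler_wpM2r; first by rewrite divr_ge0 ?k0 ?(ltW t0).
rewrite ler_wpM2r// -powR_mulrn ?(ltW t0)// -powRrM.
apply: le_trans (powR_onem_theta t0 t1 (_ : 0 <= 2%:R)%R) => //.
by rewrite ler_expR; lra.
Qed.

Lemma norm_theta_int_nd (q th1 th2 : R) : (0 < q)%R -> (th1 <= th2)%R ->
  (\int[leb]_(s in `]0%R, 1%R[) ((s `^ (- th1) * k s) `^ q * s^-1)%:E) `^ q^-1 <=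
  (\int[leb]_(s in `]0%R, 1%R[) ((s `^ (- th2) * k s) `^ q * s^-1)%:E) `^ q^-1.
Proof.
move=> q0 th12.
have I0 (th s : R) : [set` `]0%R, 1%R[] s ->
    0 <= ((s `^ (- th) * k s) `^ q * s^-1)%:E.
  rewrite /= in_itv/= => /andP[s0 _].
  by rewrite lee_fin mulr_ge0 ?powR_ge0// invr_ge0 ltW.
have J0 (th : R) : 0 <=
    \int[leb]_(s in `]0%R, 1%R[) ((s `^ (- th) * k s) `^ q * s^-1)%:E.
  by apply: integral_ge0 => s; exact: I0.
have le_pow (x y : \bar R) : 0 <= x -> x <= y -> x `^ q^-1 <= y `^ q^-1.
  move=> x0 xy; apply: gt0_ler_poweR => //.
  - by rewrite invr_ge0 ltW.
  - by rewrite in_itv/= x0 leey.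
  - by rewrite in_itv/= leey andbT (le_trans x0).
apply: le_pow; first exact: J0.
apply: ge0_le_integral.
- exact: measurable_itv.
- by move=> s; exact: I0.
- exact: measurable_integrand.
- exact: measurable_integrand.
- move=> s /=; rewrite in_itv/= => /andP[s0 s1].
  rewrite lee_fin; apply: ler_wpM2r; first by rewrite invr_ge0 (ltW s0).
  have ks := k0 s0.
  apply: ge0_ler_powR; rewrite ?nnegrE ?(ltW q0) ?mulr_ge0 ?powR_ge0//.
  apply: ler_wpM2r => //; apply: ger_powR; first by rewrite s0 ltW.
  by rewrite lerN2.
Qed.

Lemma norm_theta_y_nd (th1 th2 : R) : (th1 <= th2)%R ->
  norm_theta_q th1 +oo a <= norm_theta_q th2 +oo a.
Proof.
move=> th12; apply: ge_ereal_sup => _ [s + <-]; rewrite /= in_itv/= => /andP[s0 s1].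
rewrite /norm_theta_q; apply: le_ereal_sup_tmp; exists ((s `^ (- th2))%:E * K_pair s a).
  by exists s => //=; rewrite in_itv/= s0.
rewrite lee_wpmul2r//.
  by apply: K_ge0; [exact: ext_norm0|exact: ext_norm1|exact: ltW].
rewrite lee_fin; apply: ger_powR; first by rewrite s0 ltW.
by rewrite lerN2.
Qed.

Lemma theta_profile_ge0 (q : \bar R) t : 1 <= q -> I01 t -> 0 <= theta_profile q a t.
Proof.
rewrite /I01/= in_itv/= => q1 /andP[t0 t1]; rewrite mule_ge0//.
case: q q1 => [q q1|_|//]; last exact: norm_theta_y_ge0.
by rewrite norm_theta_finE// mule_ge0 ?lee_fin ?powR_ge0 ?poweR_ge0.
Qed.

(** The unnormalised norm increases with theta since s < 1, and theta decreases in t, so this factor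
    is monotone. The normalising factor varies the other way and is treated by its explicit formula.
    Measurability is what allows solidity of F to be applied to the profile. *)
Lemma measurable_theta_profile (q : \bar R) : 1 <= q ->
  measurable_fun (@I01 R) (theta_profile q a).
Proof.
move=> q1; apply: (@emeasurable_fun_itv_cc _ _ _ false true).
apply: emeasurable_funM; first exact/measurable_EFinP.
case: q q1 => [q|_|//]; last first.
  apply: nonincreasing_emeasurable => s t s0 st t1.
  by apply: norm_theta_y_nd; exact: theta_of_ni.
rewrite lee_fin => q1; have q0 : (0 < q)%R by exact: lt_le_trans q1.
have -> : (fun t => norm_theta_q (theta_of t) q%:E a) = (fun t =>
    ((q * theta_of t * (1 - theta_of t)) `^ q^-1)%:E *
    (\int[leb]_(s in `]0%R, 1%R[) ((s `^ (- theta_of t) * k s) `^ q * s^-1)%:E) `^ q^-1).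
  by apply/funext => t; exact: norm_theta_finE.
apply: emeasurable_funM.
  apply/measurable_EFinP; apply: (measurableT_comp (measurable_powR q^-1)).
  have mth := @measurable_theta_of R.
  apply: measurable_funM; last by apply: measurable_funB.
  by apply: measurable_funM.
apply: nonincreasing_emeasurable => s t s0 st t1.
by apply: norm_theta_int_nd => //; exact: theta_of_ni.
Qed.

End profile.

(** * Iterates of the square dilation *)

Section square_dilation_iterates.
Context {R : realType}.

(** With N = 2^n this is T^n f(t) = t f(t^N) / t^N, multiplied out: the iterates sample f at the
    ends of the blocks. *)
Lemma iter_square_dilation (f : R -> R) n (t : R) : (t != 0)%R ->
  (iter n square_dilation f t * t ^+ (2 ^ n) = t * f (t ^+ (2 ^ n)))%R.
Proof.
elim: n t => [|n IH] t t0; first by rewrite expn0 expr1 /= mulrC.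
have := IH (t ^+ 2)%R (expf_neq0 _ t0); rewrite -!exprM -expnS => H.
rewrite iterS /square_dilation mulrAC H; set y := f _.
have -> : (t ^+ 2 * y / t = t * y * (t / t))%R by rewrite expr2; lra.
by rewrite mulfV// mulr1.
Qed.

(* The weights exp (-2^j/8) beat the geometric growth of the norms of T^j. *)
Lemma exp_double_dominates (D : R) : (0 < D)%R ->
  exists2 M : R, (0 < M)%R &
    forall j, (D ^+ j * expR (- (2 ^+ j / 8)) <= M)%R.
Proof.
move=> D0; pose m := (Num.truncn D).+1.
have Dm : (D <= 2 ^+ m)%R.
  apply: (le_trans (ltW (truncnS_gt D))).
  by rewrite -/m -natrX ler_nat; apply: ltnW; exact: ltn_expl.
(* With x = 2^j / 8 and D <= 2^m, D^j <= (2^j)^m = 8^m x^m <= 8^m m! exp x. *)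
exists (8 ^+ m * m`!%:R)%R; first by rewrite mulr_gt0 ?exprn_gt0 ?ltr0n ?fact_gt0.
move=> j; rewrite expRN ler_pdivrMr ?expR_gt0//.
have x0 : (0 <= (2 ^+ j / 8 : R))%R by rewrite divr_ge0 ?exprn_ge0.
have := expR_ge1Dxn (Num.truncn D) x0; rewrite -/m => H.
apply: (@le_trans _ _ (8 ^+ m * m`!%:R * ((2 ^+ j / 8) ^+ m / m`!%:R)))%R; last first.
  by rewrite ler_wpM2l ?mulr_ge0 ?exprn_ge0//; lra.
rewrite expr_div_n.
have -> : (8 ^+ m * m`!%:R * ((2 ^+ j) ^+ m / 8 ^+ m / m`!%:R) =
   ((2 ^+ j) ^+ m) * (8 ^+ m / 8 ^+ m) * (m`!%:R / m`!%:R) :> R)%R by lra.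
rewrite !mulfV ?expf_neq0 ?pnatr_eq0 -?lt0n ?fact_gt0// !mulr1.
by rewrite exprAC lerXn2r ?nnegrE ?exprn_ge0 ?(ltW D0).
Qed.

End square_dilation_iterates.

(** * The majorant is bounded in F when T is *)

Section majorant.
Context {R : realType} (F : banach_lattice R).
Notation leb := (@lebesgue_measure R).

(** The exponent is (1 - theta)/2 = 1/(4 (1 - ln t)), and ln t / (1 - ln t) <= -1/2 for t <= 1/e;
    hence the 1/8. *)
Lemma onem_eta_exp (t : R) (n : nat) : (0 < t)%R -> (t <= expR (-1))%R ->
  ((t ^+ n) `^ (1 - (1 + theta_of t) / 2) <= expR (- (n%:R / 8)))%R.
Proof.
move=> t0 te; rewrite -powR_mulrn ?(ltW t0)// -powRrM /powR gt_eqF// ler_expR.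
have ln1 : (ln t <= -1)%R by rewrite -(expRK (-1)%R) ler_ln ?posrE ?expR_gt0.
have -> : (1 - (1 + theta_of t) / 2 = (1 - theta_of t) / 2)%R by lra.
rewrite onem_thetaE//.
have d0 : (0 < 2 * (1 - ln t))%R by lra.
have -> : (n%:R * ((2 * (1 - ln t))^-1 / 2) * ln t =
   (n%:R * ln t / 2) / (2 * (1 - ln t)))%R by lra.
rewrite ler_pdivrMr//.
have -> : (- (n%:R / 8) * (2 * (1 - ln t)) = n%:R * ((ln t - 1) / 4))%R by lra.
by rewrite -mulrA ler_wpM2l//; lra.
Qed.

(** On the block containing s, the factor s^(1 - et) is bounded at the right end, where it is
    exponentially small, and k s / s at the left end, where it becomes an iterate of T. For s >= t
    the first factor is at most 1. *)
Lemma quasi_concave_block (k : R -> R) (t s : R) : quasi_concave k ->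
  (0 < t)%R -> (t <= expR (-1))%R -> (0 < s)%R -> (s < 1)%R ->
  let w := (t * (s `^ (- ((1 + theta_of t) / 2)) * k s))%R in
  (w <= k t)%R \/ exists j,
    (w <= expR (- (2 ^+ j / 8)) * iter j.+1 square_dilation k t)%R.
Proof.
move=> [k0 kn kq] t0 te s0 s1.
have t1 : (t < 1)%R by rewrite (le_lt_trans te)// expR_lt1; lra.
have [th2 th1] := theta_of_itv t0 t1.
set et := ((1 + theta_of t) / 2)%R.
have et1 : (0 <= 1 - et)%R by rewrite /et; lra.
have Es : (s `^ (- et) = s `^ (1 - et) / s)%R.
  rewrite (_ : s `^ (- et) = s `^ ((1 - et) + -1))%R; last by congr (_ `^ _)%R; lra.
  rewrite powRD; last by rewrite (gt_eqF s0) implybT.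
  by rewrite powR_inv1// ltW.
have bound (x y : R) : (0 < y)%R -> (y <= s)%R -> (s `^ (1 - et) <= x)%R ->
    (t * (s `^ (- et) * k s) <= x * (t * k y / y))%R.
  move=> y0 ys sx.
  have ksy : (k s / s <= k y / y)%R.
    by rewrite ler_pdivrMr// mulrAC ler_pdivlMr// mulrC [leRHS]mulrC; exact: kq.
  rewrite Es.
  have -> : (t * (s `^ (1 - et) / s * k s) = s `^ (1 - et) * (t * (k s / s)))%R by lra.
  apply: ler_pM => //; first exact: powR_ge0.
    by rewrite mulr_ge0 ?(ltW t0)// divr_ge0 ?(ltW s0)// k0.
  by rewrite -mulrA ler_wpM2l// ltW.
have [ts|st] := leP t s.
  left; have := @bound 1%R t t0 ts.
  rewrite mul1r mulrAC mulfV ?gt_eqF// mul1r; apply.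
  by rewrite -[leRHS](powRr0 s); apply: ger_powR => //; rewrite s0 ltW.
right.
have ex : exists j, (t ^+ (2 ^ j.+1) <= s)%R.
  exists (Num.truncn s^-1); set N := (Num.truncn s^-1).
  have tN : (t ^+ (2 ^ N.+1) <= expR (- (2 ^ N.+1)%:R))%R.
    apply: (@le_trans _ _ (expR (-1) ^+ (2 ^ N.+1))%R).
      by rewrite lerXn2r ?nnegrE ?expR_ge0 ?(ltW t0).
    by rewrite -expRM_natl mulrN1.
  apply: (le_trans tN); rewrite expRN invf_ple ?posrE ?expR_gt0//.
  apply: (@le_trans _ _ N.+1%:R); first by apply: ltW; exact: truncnS_gt.
  apply: (@le_trans _ _ (2 ^ N.+1)%:R%R); first by rewrite ler_nat ltnW// ltn_expl.
  by apply: le_trans (expR_ge1Dx _); lra.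
(* Minimality of j gives s <= t^(2^j); for j = 0 this is s < t. *)
case: (ex_minnP ex) => j tj minj; exists j.
have sj : (s <= t ^+ (2 ^ j))%R.
  case: j {tj} minj => [|j] minj; first by rewrite expn0 expr1 ltW.
  have [//|/ltW tj] := leP s (t ^+ (2 ^ j.+1))%R.
  by have := minj j tj; rewrite ltnn.
have v0 : (0 < t ^+ (2 ^ j.+1))%R by rewrite exprn_gt0.
have := @bound (expR (- (2 ^+ j / 8))) _ v0 tj.
have -> : (t * k (t ^+ (2 ^ j.+1)) / t ^+ (2 ^ j.+1) = iter j.+1 square_dilation k t)%R.
  by rewrite -iter_square_dilation ?mulfK ?gt_eqF.
apply.
apply: (@le_trans _ _ ((t ^+ (2 ^ j)) `^ (1 - et))%R).
  by rewrite ge0_ler_powR ?nnegrE ?(ltW s0) ?exprn_ge0 ?(ltW t0).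
by have := onem_eta_exp (2 ^ j) t0 te; rewrite natrX.
Qed.

(** Away from 0 an indicator belongs to L^oo(1/t), hence to F. These test functions convert norms in
    F into pointwise bounds near 1. *)
Lemma lattice_indic (hF : interpolation_lattice F) (a b : R) :
  (0 < a)%R -> (a < b)%R -> (b <= 1)%R ->
  exists2 r : R, (0 < r)%R & F (\1_(`[a, b]%classic : set R)) = r%:E.
Proof.
move=> a0 ab b1; have [[C C0 HC] _ _] := hF.
have mi : measurable_fun (@I01 R) (\1_(`[a, b]%classic : set R) : R -> R).
  exact: measurable_indic.
have L : norm_Linfty_inv (\1_(`[a, b]%classic : set R) : R -> R) <= (a^-1)%:E.
  apply: norm_Linfty_inv_le => //; first by rewrite invr_ge0 ltW.
  apply: ae_I01_oo => t t0 t1; rewrite indicE mem_setE in_itv/=.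
  case: (boolP (a <= t <= b)%R) => [/andP[at_ _]|_]; last first.
    by rewrite normr0 mulr_ge0 ?invr_ge0 ?ltW.
  by rewrite normr1 mulrC ler_pdivlMr// mul1r.
have Fi : carrier F (\1_(`[a, b]%classic : set R)).
  rewrite /carrier/=.
  have c : carrier norm_Linfty_inv (\1_(`[a, b]%classic : set R) : R -> R).
    by rewrite /carrier/= (le_lt_trans L)// ltry.
  apply: (le_lt_trans (HC _ c)); apply: (@le_lt_trans _ _ (C%:E * (a^-1)%:E)).
    by rewrite lee_wpmul2l// lee_fin ltW.
  by rewrite -EFinM ltry.
have [r r0 Er] := lattice_fin_num Fi; exists r => //.
rewrite lt_neqAle r0 andbT eq_sym; apply/eqP => rE; move: Er; rewrite rE.
move=> /lattice_norm_eq0 /(ae_exists_itv (ltW a0) ab b1)[t [at_ tb]].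
rewrite indicE mem_setE in_itv/= (ltW at_) (ltW tb)/= => /eqP.
by rewrite oner_eq0.
Qed.

(** The block estimate only covers t <= p = 1/e. As the norm N t decreases in t, t N(t) <= N(p) for
    t >= p, while N(p) <= N(t) <= |f t| / p^2 on the window [p^2, p]. The norm of f thus bounds
    N(p), and a multiple of the indicator of [p, 1] completes the majorant. *)
Lemma majorant_bounded : interpolation_lattice F ->
  bounded_operator F F square_dilation ->
  exists2 C : R, (0 < C)%R & forall (A : banach_pair R) (a : ambient A),
    (forall t, (0 < t)%R -> K_pair t a < +oo) ->
    carrier F (fun t => fine (K_pair t a)) ->
    exists f, [/\ forall t, (0 <= f t)%R,
      F f <= C%:E * F (fun t => fine (K_pair t a)) &
      {ae leb, forall t, I01 t -> majorant a t <= (f t)%:E}].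
Proof.
move=> hF [C C0 HC].
pose p := (expR (-1) : R); have p0 : (0 < p)%R by exact: expR_gt0.
have p1 : (p < 1)%R by rewrite /p expR_lt1; lra.
have pp : (p ^+ 2 < p)%R by rewrite expr2 gtr_pMr.
have pp0 : (0 < p ^+ 2)%R by rewrite exprn_gt0.
have [rw rw0 Ew] := lattice_indic hF pp0 pp (ltW p1).
have [rv rv0 Ev] := lattice_indic hF p0 p1 (lexx _).
have C20 : (0 < 2 * C)%R by rewrite mulr_gt0.
have [M1 M10 HM1] := exp_double_dominates C20.
(* The 2 pays for the weight 1/2 of the term k; the rest pays for the weight 2^-(j+2) of the term
   T^(j+1) k, whose powers of 2 are absorbed by using 2 C instead of C in the choice of M1. *)
pose M := (2 + 2 * (2 * C) * M1)%R.
have M0 : (0 < M)%R by rewrite /M addr_gt0 ?mulr_gt0.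
exists (M * (1 + rv / (p ^+ 2 * rw)))%R.
  by rewrite mulr_gt0// addr_gt0// divr_gt0// mulr_gt0.
move=> A a Kfin; set k := (fun t => fine (K_pair t a)) => Fk.
have kqc : quasi_concave k by exact: K_pair_quasi_concave.
have [k0 kn kq] := kqc.
have [rk rk0 Ek] := lattice_fin_num Fk.
have iterF n : F (iter n square_dilation k) <= (C ^+ n * rk)%:E.
  elim: n => [|n IH]; first by rewrite /= Ek expr0 mul1r.
  rewrite iterS; apply: (@le_trans _ _ (C%:E * F (iter n square_dilation k))).
    by apply: HC; rewrite /carrier/= (le_lt_trans IH)// ltry.
  apply: (@le_trans _ _ (C%:E * (C ^+ n * rk)%:E)).
    by rewrite lee_wpmul2l// lee_fin ltW.
  by rewrite -EFinM exprS mulrA.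
(* The terms are cut off at t <= 0 because [quasi_concave] controls k only for t > 0, whereas
   [lattice_series] asks for nonnegativity on all of [0, 1]. *)
pose u n := if n is j.+1 then
    fun t => (expR (- (2 ^+ j / 8)) * (if (0 < t)%R then iter j.+1 square_dilation k t else 0%R))%R
  else fun t => if (0 < t)%R then k t else 0%R.
have uz t : u 0%N t = (if (0 < t)%R then k t else 0%R) by [].
have us j t : u j.+1 t = (expR (- (2 ^+ j / 8)) *
  (if (0 < t)%R then iter j.+1 square_dilation k t else 0%R))%R by [].
have iter_ge0 n t : (0 < t)%R -> (0 <= iter n square_dilation k t)%R.
  move=> t0; rewrite -(pmulr_lge0 _ (_ : 0 < t ^+ (2 ^ n))%R) ?exprn_gt0//.
  by rewrite iter_square_dilation ?gt_eqF// mulr_ge0 ?k0 ?exprn_gt0 ?ltW.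
have u0 n t : (0 <= u n t)%R.
  case: n => [|j].
    by rewrite uz; case: ifPn => // t0; exact: k0.
  rewrite us; case: ifPn => t0; last by rewrite mulr0.
  by rewrite mulr_ge0 ?expR_ge0 ?iter_ge0.
have trunc f : carrier F f -> F (fun t => if (0 < t)%R then f t else 0%R) <= F f.
  move=> Ff; have mf := lattice_measurable Ff.
  apply: lattice_solid; last by apply: ae_I01_oo => t ->.
  apply: measurable_fun_if => //.
  - exact: measurable_I01.
  - exact: (@measurable_fun_ltr _ _ _ _ (cst 0%R) id).
  - by apply: measurable_funS mf; [exact: measurable_I01|move=> x []].
have uF n : F (u n) <= (M * rk / 2 ^+ n.+1)%:E.
  case: n => [|j].
    rewrite /u expr1; apply: (le_trans (trunc _ Fk)); rewrite Ek lee_fin ler_pdivlMr//.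
    rewrite mulrC ler_wpM2r// /M lerDl; apply: ltW.
    by rewrite !mulr_gt0.
  rewrite /u lattice_norm_pZ ?expR_ge0//.
  apply: (@le_trans _ _ ((expR (- (2 ^+ j / 8)))%:E * (C ^+ j.+1 * rk)%:E)).
    rewrite lee_wpmul2l ?lee_fin ?expR_ge0//; apply: le_trans (iterF _).
    by apply: trunc; rewrite /carrier/= (le_lt_trans (iterF j.+1))// ltry.
  rewrite -EFinM lee_fin ler_pdivlMr ?exprn_gt0//.
  have -> : (expR (- (2 ^+ j / 8)) * (C ^+ j.+1 * rk) * 2 ^+ j.+2 =
     2 * (2 * C) * ((2 * C) ^+ j * expR (- (2 ^+ j / 8))) * rk)%R.
    by rewrite [((2 * C) ^+ j)%R]exprMn !exprS; lra.
  rewrite ler_wpM2r// (@le_trans _ _ (2 * (2 * C) * M1))%R//.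
    by rewrite ler_wpM2l ?HM1// mulr_ge0// ltW.
  by rewrite /M lerDr.
have Mrk0 : (0 <= M * rk)%R by rewrite mulr_ge0 ?(ltW M0).
have [f [Ff uf]] := lattice_series Mrk0 (fun n t _ => u0 n t) uF.
have cf : carrier F f by rewrite /carrier/= (le_lt_trans Ff)// ltry.
have mf := lattice_measurable cf.
have maj_small : {ae leb, forall t, I01 t ->
    (0 < t)%R -> (t <= p)%R -> majorant a t <= (`|f t|)%:E}.
  move: uf; apply: ae_I01S => t tI uft t0 tp.
  rewrite /majorant -lee_pdivlMl//; apply: ge_ereal_sup => _ [s + <-].
  rewrite /= in_itv/= => /andP[s0 s1].
  rewrite -(fineK (_ : K_pair s a \is a fin_num)); last first.
    rewrite ge0_fin_numE ?Kfin//.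
    by apply: K_ge0; [exact: ext_norm0|exact: ext_norm1|exact: ltW].
  rewrite lee_pdivlMl// -!EFinM lee_fin (le_trans _ (ler_norm _))//.
  have un n : (u n t <= f t)%R.
    apply: le_trans (uft n.+1); rewrite big_ord_recr/= lerDr.
    by apply: sumr_ge0 => i _.
  have [H|[j H]] := quasi_concave_block kqc t0 tp s0 s1.
    by apply: (le_trans H); have := un 0%N; rewrite uz t0.
  by apply: (le_trans H); have := un j.+1; rewrite us t0.
pose N (t : R) := norm_theta_q ((1 + theta_of t) / 2)%R +oo a.
have Nni (s t : R) : (0 < s)%R -> (s <= t)%R -> (t < 1)%R -> N t <= N s.
  move=> s0 st t1; apply: norm_theta_y_nd.
  by have := theta_of_ni s0 st t1; lra.
have Nf : {ae leb, forall t, I01 t -> (p ^+ 2 <= t <= p)%R ->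
    N p <= (`|f t| / p ^+ 2)%:E}.
  move: maj_small; apply: ae_I01S => t _ H /andP[tp2 tp].
  have t0 : (0 < t)%R by exact: lt_le_trans tp2.
  have Npt := Nni _ _ t0 tp p1.
  apply: (le_trans Npt); have := H t0 tp; rewrite /majorant -/(N t) => H1.
  rewrite -lee_pdivlMl// in H1; apply: (le_trans H1).
  rewrite -EFinM lee_fin mulrC ler_wpM2l// lef_pV2 ?posrE//.
have N0 : 0 <= N p by exact: norm_theta_y_ge0.
have Nfin : N p < +oo.
  have [t [tp2 tp H]] := ae_exists_itv (ltW pp0) pp (ltW p1) Nf.
  by apply: (le_lt_trans (H _)); rewrite ?ltry// !ltW.
pose m := fine (N p); have m0 : (0 <= m)%R by rewrite fine_ge0.
have NpE : N p = m%:E by rewrite fineK// ge0_fin_numE.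
have mbound : (m <= M * rk / (p ^+ 2 * rw))%R.
  rewrite ler_pdivlMr ?mulr_gt0// -lee_fin mulrA EFinM -Ew.
  rewrite -lattice_norm_pZ ?mulr_ge0 ?exprn_ge0 ?(ltW p0)//.
  apply: le_trans Ff; apply: lattice_solid.
    by apply: measurable_funM => //; exact: measurable_indic.
  move: Nf; apply: ae_I01S => t _; rewrite NpE indicE mem_setE in_itv/=.
  case: (p ^+ 2 <= t <= p)%R => [/(_ isT)|_]; last by rewrite mulr0 normr0.
  rewrite mulr1 lee_fin ler_pdivlMr// => H.
  by rewrite ger0_norm// mulr_ge0// ltW.
exists (fun t => `|f t| + m * \1_(`[p, 1%R]%classic : set R) t)%R; split.
- by move=> t; rewrite addr_ge0// mulr_ge0.
- apply: (le_trans (lattice_normD _ _ _)).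
  rewrite lattice_norm_abs// lattice_norm_pZ// Ev Ek -!EFinM.
  apply: (@le_trans _ _ ((M * rk)%:E + (M * rk / (p ^+ 2 * rw) * rv)%:E)).
    by apply: leeD => //; rewrite lee_fin ler_wpM2r// ltW.
  rewrite -EFinD lee_fin; move: (p ^+ 2 * rw)^-1%R => D.
  by rewrite le_eqVlt; apply/orP; left; apply/eqP; lra.
- have Ht : {ae leb, forall t, I01 t -> (0 < t)%R /\ (t < 1)%R} by apply: ae_I01_oo.
  move: maj_small Ht; apply: ae_I01S2 => t _ H [t0 t1].
  rewrite indicE mem_setE in_itv/= (ltW t1) andbT.
  have [pt|tp] := leP p t; last first.
    by rewrite mulr0 addr0; apply: H => //; exact: ltW.
  rewrite mulr1 (@le_trans _ _ m%:E)//; last by rewrite lee_fin lerDr.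
  rewrite /majorant -/(N t) (@le_trans _ _ (t%:E * N p))//.
    by rewrite lee_wpmul2l ?lee_fin ?(ltW t0)//; exact: Nni.
  by rewrite NpE -EFinM lee_fin ler_piMl// ltW.
Qed.

End majorant.

(** * Least concave majorants *)

Section average.
Context {R : realType}.
Notation leb := (@lebesgue_measure R).
Implicit Types (E : set R) (g h : R -> R).

(** On a null set the quotient is 0, so that upper bounds hold for every E. *)
Definition average E g : R := (\int[leb]_(s in E) g s / fine (leb E))%R.

Lemma leb_subset_fin E : measurable E -> E `<=` @I01 R -> leb E \is a fin_num.
Proof.
move=> mE EI; rewrite ge0_fin_numE//; apply: (@le_lt_trans _ _ (leb (@I01 R))).
  by apply: le_measure; rewrite ?inE//; exact: measurable_I01.
by rewrite leb_I01_eq1 ltry.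
Qed.

Lemma ae_bounded_integrable E g (c : R) : measurable E -> E `<=` @I01 R ->
  measurable_fun E g -> (0 <= c)%R ->
  {ae leb, forall s, I01 s -> (E s -> `|g s| <= c)%R} ->
  leb.-integrable E (EFin \o g) /\
  (`|\int[leb]_(s in E) g s| <= c * fine (leb E))%R.
Proof.
move=> mE EI mg c0 H; have fE := leb_subset_fin mE EI.
have B : \int[leb]_(s in E) `|(EFin \o g) s| <= (c * fine (leb E))%:E.
  rewrite EFinM fineK// -integral_cst//; apply: ae_ge0_le_integral => //.
  - by apply: measurableT_comp => //; exact/measurable_EFinP.
  - by move: H; apply: (@filterS _ _ (ae_filter_ringOfSetsType leb)) => s Hs Es;
      rewrite /= lee_fin; apply: Hs => //; exact: EI.
have ig : leb.-integrable E (EFin \o g).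
  by apply/integrableP; split; [exact/measurable_EFinP|rewrite (le_lt_trans B)// ltry].
split => //; rewrite -lee_fin EFin_normr_Rintegral//; apply: le_trans B.
by apply: le_abse_integral => //; exact/measurable_EFinP.
Qed.

Lemma average_le E g (c : R) : measurable E -> E `<=` @I01 R ->
  measurable_fun E g -> (0 <= c)%R ->
  {ae leb, forall s, I01 s -> (E s -> `|g s| <= c)%R} -> (`|average E g| <= c)%R.
Proof.
move=> mE EI mg c0 H; have [_ B] := ae_bounded_integrable mE EI mg c0 H.
rewrite /average normrM normfV; have [->|n0] := eqVneq (fine (leb E)) 0%R.
  by rewrite normr0 invr0 mulr0.
have f0 : (0 < fine (leb E))%R by rewrite lt_neqAle eq_sym n0 fine_ge0.
by rewrite (gtr0_norm f0) ler_pdivrMr.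
Qed.

Lemma average_ge E g (c : R) : measurable E -> E `<=` @I01 R ->
  leb.-integrable E (EFin \o g) -> 0 < leb E ->
  (forall s, E s -> (c <= g s)%R) -> (c <= average E g)%R.
Proof.
move=> mE EI ig E0 H; have fE := leb_subset_fin mE EI.
have f0 : (0 < fine (leb E))%R by rewrite fine_gt0// E0 -ge0_fin_numE.
rewrite /average ler_pdivlMr// -Rintegral_cst//.
apply: le_Rintegral => //.
by have [] := @ae_bounded_integrable E (cst c) `|c|%R mE EI (measurable_cst _)
  (normr_ge0 _) (ae_I01W (fun t _ => lexx _)).
Qed.

Lemma averageD E g h (c : R) : measurable E ->
  leb.-integrable E (EFin \o g) -> leb.-integrable E (EFin \o h) ->
  average E (fun s => c * g s + h s)%R = (c * average E g + average E h)%R.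
Proof.
move=> mE ig ih; rewrite /average RintegralD//.
  by rewrite RintegralZl// mulrDl mulrA.
rewrite (_ : EFin \o _ = (fun x => c%:E * (EFin \o g) x))//.
exact: integrableZl.
Qed.

End average.

(** * The least nondecreasing concave majorant *)

Section concave_majorant.
Context {R : realType}.
Notation leb := (@lebesgue_measure R).
Implicit Types (f : R -> R).

(** Nonnegative slopes make the infimum of these bounds nondecreasing as well as concave. *)
Definition affine_bound f (a b : R) :=
  [/\ (0 <= a)%R, (0 <= b)%R &
    {ae leb, forall s, I01 s -> (`|f s| <= a + b * s)%R}].

Definition concave_hull f (t : R) : R :=
  inf [set y | exists a b, affine_bound f a b /\ y = (a + b * t)%R].

Lemma affine_bound_Linfty f : carrier norm_Linfty f ->
  exists2 a, (0 <= a)%R & affine_bound f a 0.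
Proof.
move=> /carrier_norm_LinftyP[M M0 /eqP]; rewrite eq_le => /andP[+ _].
move=> /(norm_LinftyP _ M0)[mf H]; exists M => //; split => //.
by move: H; apply: ae_I01S => s _; rewrite mul0r addr0.
Qed.

Section bounded.
Variable f : R -> R.
Hypothesis fL : carrier norm_Linfty f.

Let S (t : R) := [set y : R | exists a b, affine_bound f a b /\ y = (a + b * t)%R].

Let S_inf t : (0 <= t)%R -> has_inf (S t).
Proof.
move=> t0; split.
  by have [a a0 H] := affine_bound_Linfty fL; exists (a + 0 * t)%R; exists a, 0%R.
by exists 0%R => _ [a [b [[a0 b0 _] ->]]]; rewrite addr_ge0// mulr_ge0.
Qed.

Lemma concave_hull_le a b t : (0 <= t)%R -> affine_bound f a b -> (concave_hull f t <= a + b * t)%R.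
Proof.
by move=> t0 H; apply: ge_inf; [have [] := S_inf t0|exists a, b].
Qed.

Lemma concave_hull_ge c t : (0 <= t)%R ->
  (forall a b, affine_bound f a b -> (c <= a + b * t)%R) -> (c <= concave_hull f t)%R.
Proof.
move=> t0 H; apply: lb_le_inf; first by have [] := S_inf t0.
by move=> _ [a [b [/H + ->]]].
Qed.

Lemma concave_hull_ge0 t : (0 <= t)%R -> (0 <= concave_hull f t)%R.
Proof.
by move=> t0; apply: concave_hull_ge => // a b [a0 b0 _]; rewrite addr_ge0// mulr_ge0.
Qed.

Lemma concave_hull_nd s t : (0 <= s)%R -> (s <= t)%R -> (concave_hull f s <= concave_hull f t)%R.
Proof.
move=> s0 st; have t0 := le_trans s0 st; apply: concave_hull_ge => // a b H.
have [_ b0 _] := H.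
by apply: (le_trans (concave_hull_le s0 H)); rewrite lerD2l ler_wpM2l.
Qed.

Lemma concave_hull_concave : convex_function (@I01 R) (fun t => - concave_hull f t)%R.
Proof.
move=> l x y; rewrite !inE /I01/= !in_itv/= => /andP[x0 _] /andP[y0 _].
have l0 : (0 <= l%:num)%R by [].
have l1 : (0 <= 1 - l%:num)%R by rewrite subr_ge0.
have H : (l%:num * concave_hull f x + (1 - l%:num) * concave_hull f y <=
    concave_hull f (l%:num * x + (1 - l%:num) * y))%R.
  apply: concave_hull_ge; first by rewrite addr_ge0 ?mulr_ge0.
  move=> a b H.
  have -> : (a + b * (l%:num * x + (1 - l%:num) * y) =
    l%:num * (a + b * x) + (1 - l%:num) * (a + b * y))%R by lra.
  by apply: lerD; rewrite ler_wpM2l//; exact: concave_hull_le.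
change (- concave_hull f (l%:num * x + (1 - l%:num) * y) <=
  l%:num * (- concave_hull f x) + (1 - l%:num) * (- concave_hull f y))%R.
by move: (concave_hull f _) (concave_hull f _) (concave_hull f _) H => u v w H; lra.
Qed.

Lemma concave_hull_measurable : measurable_fun (@I01 R) (concave_hull f).
Proof.
apply: (@eq_measurable_fun _ _ R R _ (fun t => if (0 <= t)%R then concave_hull f t else 0%R)).
  by move=> t; rewrite inE /I01/= in_itv/= => /andP[->].
apply: nondecreasing_measurable; first exact: measurable_I01.
move=> s t st; case: ifPn => s0.
  by rewrite (le_trans s0 st); exact: concave_hull_nd.
by case: ifPn => // t0; exact: concave_hull_ge0.
Qed.

(** Each affine bound has its own null set, and there are uncountably many of them. Rounding both
    coefficients up to multiples of 1/(n+1) keeps the bound valid and raises it by at most 2/(n+1)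
    on [0, 1], so countably many bounds suffice. *)
Lemma concave_hull_ae_ge : {ae leb, forall t, I01 t -> (`|f t| <= concave_hull f t)%R}.
Proof.
have H (i j n : nat) : {ae leb, forall t, I01 t ->
    (affine_bound f (i%:R / n.+1%:R) (j%:R / n.+1%:R) ->
     `|f t| <= i%:R / n.+1%:R + j%:R / n.+1%:R * t)%R}.
  have [Y|N] := pselect (affine_bound f (i%:R / n.+1%:R) (j%:R / n.+1%:R)).
    by have [_ _] := Y; apply: ae_I01S.
  by apply: ae_I01W => t /N.
have {}H : {ae leb, forall t, forall i j n, I01 t ->
    (affine_bound f (i%:R / n.+1%:R) (j%:R / n.+1%:R) ->
     `|f t| <= i%:R / n.+1%:R + j%:R / n.+1%:R * t)%R}.
  apply: ae_foralln => i; apply: ae_foralln => j; apply: ae_foralln => n.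
  exact: H.
apply: (@filterS _ _ (ae_filter_ringOfSetsType leb) _ _ _ H) => t {}H tI.
have := tI; rewrite /I01/= in_itv/= => /andP[t0 t1].
apply: concave_hull_ge => // a b [a0 b0 ab]; apply/ler_addgt0Pr => e e0.
pose n := Num.truncn (2 / e); have n0 : (0 < n.+1%:R :> R)%R by rewrite ltr0n.
have ne : (2 / n.+1%:R < e)%R.
  by rewrite ltr_pdivrMr// mulrC -ltr_pdivrMr//; exact: truncnS_gt.
have round (x : R) : (0 <= x)%R -> exists2 i : nat, (x <= i%:R / n.+1%:R)%R &
    (i%:R / n.+1%:R <= x + n.+1%:R^-1)%R.
  move=> x0; exists (Num.truncn (x * n.+1%:R)).+1.
    by rewrite ler_pdivlMr// ltW// truncnS_gt.
  rewrite ler_pdivrMr// mulrDl mulVf ?gt_eqF// -natr1 lerD2r.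
  by rewrite Num.Theory.truncn_le mulr_ge0.
have [i ai ia] := round a a0; have [j bj jb] := round b b0.
have := H i j n tI; move=> /(_ _)/le_trans -> //.
- split.
  + by rewrite divr_ge0.
  + by rewrite divr_ge0.
  + move: ab; apply: ae_I01S => s; rewrite /I01/= in_itv/= => /andP[s0 _].
    by move=> /le_trans; apply; rewrite lerD// ler_wpM2r.
- have : (i%:R / n.+1%:R + j%:R / n.+1%:R * t <=
    a + n.+1%:R^-1 + (b + n.+1%:R^-1) * t)%R by rewrite lerD// ler_wpM2r.
  have : (n.+1%:R^-1 * t <= n.+1%:R^-1)%R by rewrite ler_piMr.
  move: ne; move: (n.+1%:R^-1)%R => N.
  move: (i%:R * N)%R (j%:R * N)%R => I J; lra.
Qed.

End bounded.

Lemma concave_hull_le_ae f g : carrier norm_Linfty f -> carrier norm_Linfty g ->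
  {ae leb, forall t, I01 t -> (`|f t| <= `|g t|)%R} ->
  forall t, (0 <= t)%R -> (concave_hull f t <= concave_hull g t)%R.
Proof.
move=> fL gL fg t t0; apply: concave_hull_ge => // a b [a0 b0 H]; apply: concave_hull_le => //.
by split => //; move: fg H; apply: ae_I01S2 => s _; exact: le_trans.
Qed.

Lemma concave_hullZ f (c : R) t : carrier norm_Linfty f ->
  carrier norm_Linfty (fun t => c * f t)%R -> (0 < c)%R -> (0 <= t)%R ->
  (c * concave_hull f t <= concave_hull (fun t => c * f t)%R t)%R.
Proof.
move=> fL cL c0 t0; apply: concave_hull_ge => // a b [a0 b0 H].
rewrite mulrC -ler_pdivlMr// mulrDl mulrAC; apply: concave_hull_le => //.
split; rewrite ?divr_ge0 ?(ltW c0)//.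
move: H; apply: ae_I01S => s _; rewrite normrM (gtr0_norm c0) => H.
by rewrite mulrAC -mulrDl ler_pdivlMr// mulrC.
Qed.

End concave_majorant.

Section log_step.
Context {R : realType}.
Notation leb := (@lebesgue_measure R).

(** The value is n exactly when e^-(n+1) < t <= e^-n, for t in ]0, 1]. Functions constant on these
    countably many intervals are measurable, whatever their values. *)
Definition log_index (t : R) : nat := Num.truncn (- ln t)%R.

Lemma log_indexP (t : R) : (0 < t)%R -> (t <= 1)%R ->
  (t <= expR (- (log_index t)%:R))%R /\
  (expR (- (log_index t)%:R) <= expR 1 * t)%R.
Proof.
move=> t0 t1; have l0 : (0 <= - ln t)%R by rewrite oppr_ge0 ln_le0.
have /andP[H1 H2] := truncn_itv l0; rewrite -/(log_index t) in H1 H2.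
split.
  by rewrite -{1}(lnK (_ : t \is Num.pos)) ?posrE// ler_expR; lra.
rewrite -{2}(lnK (_ : t \is Num.pos)) ?posrE// -expRD ler_expR.
by move: H2; rewrite -natr1; lra.
Qed.

Lemma measurable_log_step (lam : nat -> R) :
  measurable_fun (@I01 R) (fun t => lam (log_index t)).
Proof.
apply: (@measurable_fun_itv_cc _ _ _ false true) => _ Y mY.
have -> : `]0%R, 1%R[%classic `&` (fun t => lam (log_index t)) @^-1` Y =
    \bigcup_(n in [set n | Y (lam n)]) (`]0%R, 1%R[%classic `&` [set t : R | log_index t = n]).
  apply/seteqP; split => t /=.
    by move=> [t01 Yt]; exists (log_index t).
  by move=> [n /= Yn [t01 tn]]; split => //; rewrite tn.
apply: bigcup_measurable => n _; apply: is_interval_measurable => s t/=.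
rewrite !in_itv/= => -[/andP[s0 s1] sn] [/andP[t0 t1] tn] u /andP[su ut].
have u0 : (0 < u)%R by exact: lt_le_trans su.
have u1 : (u < 1)%R by exact: le_lt_trans t1.
split; first by apply/andP; split.
apply/eqP; rewrite eqn_leq -{1}sn -{1}tn; apply/andP; split;
  by apply: le_truncn; rewrite lerN2 ler_ln ?posrE.
Qed.

End log_step.

(** * The concave majorant of a function of F belongs to F *)

Section concave_hull_in_lattice.
Context {R : realType} (F : banach_lattice R).
Notation leb := (@lebesgue_measure R).
Hypothesis hF : interpolation_lattice F.

Lemma carrier_Linfty f : carrier F f -> carrier norm_Linfty f.
Proof.
have [_ [C C0 HC] _] := hF.
move=> Ff; have [r r0 Er] := lattice_fin_num Ff.
by rewrite /carrier/= (le_lt_trans (HC f Ff))// Er -EFinM ltry.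
Qed.

(* With m = concave_hull f (p n), the affine function m/3 (1 + s / p n) has value
   2m/3 < m at p n, so it fails to dominate |f| on a set E n of positive measure.
   There |f s| min(1, p n / s) > m/3; T averages h s * min(1, p n / s) over E n,
   where n is the integer part of - ln t.  The two terms of the minimum give the
   bounds on L^oo and on L^oo(1/t). *)
Section step_operator.
Variable f : R -> R.
Hypothesis Ff : carrier F f.
Let fL : carrier norm_Linfty f := carrier_Linfty Ff.
Let mf : measurable_fun (@I01 R) f := lattice_measurable Ff.

Let p (n : nat) : R := expR (- n%:R).
Let p0 n : (0 < p n)%R. Proof. exact: expR_gt0. Qed.

Let E n : set R := `]0%R, 1%R]%classic `&`
  [set s | (concave_hull f (p n) / 3 * (1 + s / p n) < `|f s|)%R].

Let w n (s : R) : R := Num.min 1%R (p n / s)%R.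

Let EI n : E n `<=` @I01 R.
Proof.
by move=> s [+ _]; rewrite /I01/= !in_itv/= => /andP[/ltW -> ->].
Qed.

Let mE n : measurable (E n).
Proof.
have -> : E n = `]0%R, 1%R]%classic `&` (@I01 R `&`
    (fun s => (concave_hull f (p n) / 3 * (1 + s / p n) < `|f s|)%R) @^-1` [set true]).
  apply/seteqP; split => s /=.
    by move=> [s01 H]; split => //; split => //; exact: (@EI n).
  by move=> [? [_ ?]].
apply: measurableI; first exact: measurable_itv.
have : measurable_fun (@I01 R) (fun s => (concave_hull f (p n) / 3 * (1 + s / p n) < `|f s|)%R).
  apply: measurable_fun_ltr; last exact: measurableT_comp.
  by apply: measurable_funM => //; apply: measurable_funD => //; exact: measurable_funM.
by move=> /(_ measurable_I01) H; exact: H.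
Qed.

Let mw n : measurable_fun (E n) (w n).
Proof.
apply: measurable_minr => //; apply: measurable_funM => //.
apply: (@eq_measurable_fun _ _ R R _ (fun t : R => t `^ (-1))%R).
  by move=> s; rewrite inE/= => -[/=]; rewrite in_itv/= => /andP[s0 _] _; rewrite powR_inv1// ltW.
exact: measurable_powR_on.
Qed.

Let T (h : R -> R) (t : R) : R :=
  average (E (log_index t)) (fun s => h s * w (log_index t) s)%R.

Let w_ge0 n s : E n s -> (0 <= w n s)%R.
Proof.
move=> [+ _]; rewrite /= in_itv/= => /andP[s0 _].
by rewrite /w le_min ler01/= divr_ge0 ?(ltW s0)// ltW.
Qed.

Let mhw (h : R -> R) n : measurable_fun (@I01 R) h -> measurable_fun (E n) (fun s => h s * w n s)%R.
Proof.
move=> mh; apply: measurable_funM => //.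
by apply: measurable_funS mh; [exact: measurable_I01|exact: EI].
Qed.

Let hw1 (h : R -> R) n (M : R) : (0 <= M)%R ->
  {ae leb, forall s, I01 s -> (`|h s| <= M)%R} ->
  {ae leb, forall s, I01 s -> (E n s -> `|h s * w n s| <= M)%R}.
Proof.
move=> M0; apply: ae_I01S => s _ H Es; have := w_ge0 Es.
rewrite normrM => w0; rewrite (ger0_norm w0) -[leRHS]mulr1.
by apply: ler_pM => //; rewrite /w ge_min lexx.
Qed.

Let hw2 (h : R -> R) n (M : R) : (0 <= M)%R ->
  {ae leb, forall s, I01 s -> (`|h s| <= M * s)%R} ->
  {ae leb, forall s, I01 s -> (E n s -> `|h s * w n s| <= M * p n)%R}.
Proof.
move=> M0; apply: ae_I01S => s _ H Es; have w0 := w_ge0 Es.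
have [+ _] := Es; rewrite /= in_itv/= => /andP[s0 _].
rewrite normrM (ger0_norm w0).
apply: (@le_trans _ _ (M * s * (p n / s)))%R; last first.
  by rewrite mulrACA mulfV ?gt_eqF// mulr1.
by apply: ler_pM => //; rewrite /w ge_min lexx orbT.
Qed.

Let hw_int (h : R -> R) n : carrier norm_Linfty h ->
  leb.-integrable (E n) (EFin \o (fun s => h s * w n s)%R).
Proof.
move=> /carrier_norm_LinftyP[M M0 /eqP]; rewrite eq_le => /andP[+ _].
move=> /(norm_LinftyP _ M0)[mh H].
by have [] := ae_bounded_integrable (@mE n) (@EI n) (@mhw h n mh) M0 (@hw1 h n M M0 H).
Qed.

Let T_linear : linear_on_Linfty T.
Proof.
move=> c h g hL gL; apply: ae_I01W => t; rewrite /T -averageD//; try exact: hw_int.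
by congr average; apply/funext => s; rewrite mulrDl mulrA.
Qed.

Let T_meas (h : R -> R) : measurable_fun (@I01 R) (T h).
Proof.
exact: (measurable_log_step (fun n => average (E n) (fun s => h s * w n s)%R)).
Qed.

Let T_Linfty : bounded_operator norm_Linfty norm_Linfty T.
Proof.
exists 1%R => // h /carrier_norm_LinftyP[M M0 EM]; rewrite EM mul1e.
have := lexx (norm_Linfty h); rewrite {2}EM => /(norm_LinftyP _ M0)[mh H].
apply/norm_LinftyP => //; split => //; apply: ae_I01W => t.
by apply: average_le => //; [exact: mhw|exact: hw1].
Qed.

Let T_Linfty_inv : bounded_operator norm_Linfty_inv norm_Linfty_inv T.
Proof.
(* The factor e is the price of constancy on blocks: the bound obtained is M p n, and p n <= e t. *)
exists (expR 1); first exact: expR_gt0.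
move=> h hc; have := hc; move=> /carrier_norm_Linfty_invP[M M0 EM]; rewrite EM -EFinM.
have := lexx (norm_Linfty_inv h); rewrite {2}EM => /(norm_Linfty_inv_bound M0) H.
have [mhd _] : measurable_fun (@I01 R) (fun t => h t / t)%R /\
    {ae leb, forall t, I01 t -> (`|h t / t| <= M)%R}.
  by apply/norm_LinftyP => //; rewrite -EM.
apply: norm_Linfty_inv_le => //.
  by rewrite mulr_ge0 ?expR_ge0.
apply: ae_I01_oo => t t0 t1.
have [_ tp] := log_indexP t0 (ltW t1); rewrite -/(p _) in tp.
apply: (@le_trans _ _ (M * p (log_index t)))%R; last first.
  by rewrite [(_ * M)%R]mulrC -mulrA ler_wpM2l.
apply: average_le => //.
- apply: measurable_funM => //.
  apply: (@eq_measurable_fun _ _ R R _ (fun s : R => (h s / s) * s)%R).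
    move=> s; rewrite inE/= => -[/=]; rewrite in_itv/= => /andP[s0 _] _.
    by rewrite divfK// gt_eqF.
  apply: measurable_funM => //.
  by apply: measurable_funS mhd; [exact: measurable_I01|exact: EI].
- by rewrite mulr_ge0// ltW.
- exact: hw2.
Qed.

Let E_pos n : (0 < concave_hull f (p n))%R -> 0 < leb (E n).
Proof.
move=> m0; rewrite lt0e measure_ge0 andbT; apply/eqP => E0.
have : affine_bound f (concave_hull f (p n) / 3) (concave_hull f (p n) / 3 / p n).
  split; [by rewrite divr_ge0 ?ltW|by rewrite !divr_ge0 ?ltW|].
  have H1 : {ae leb, forall t, I01 t -> (0 < t)%R} by apply: ae_I01_oo.
  have H2 : {ae leb, forall t, I01 t -> ~ E n t}.
    exists (E n); split; [exact: mE|exact: E0|].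
    by move=> t /= H; apply: contrapT => nE; exact: H.
  move: H1 H2; apply: ae_I01S2 => s; rewrite /I01/= in_itv/= => /andP[_ s1] s0 nE.
  rewrite leNgt; apply/negP => H; apply: nE; split; first by rewrite /= in_itv/= s0.
  rewrite /=; apply: le_lt_trans H.
  by rewrite mulrDr mulr1 lerD2l mulrCA mulrC -mulrA mulrC.
move=> /(concave_hull_le fL (ltW (p0 n))); rewrite divfK ?gt_eqF//.
by move: m0; move: (concave_hull f _) => m; lra.
Qed.

Let T_ge t : (0 < t)%R -> (t <= 1)%R -> (concave_hull f t <= 3 * T (fun s => `|f s|) t)%R.
Proof.
move=> t0 t1; have [tp _] := log_indexP t0 t1; rewrite -/(p _) in tp.
apply: (le_trans (concave_hull_nd fL (ltW t0) tp)).
rewrite -ler_pdivrMl// mulrC; set n := log_index t.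
have absL : carrier norm_Linfty (fun s => `|f s|)%R.
  by apply: carrier_Linfty; rewrite /carrier/= lattice_norm_abs.
have [m0|] := ltP 0%R (concave_hull f (p n)); last first.
  move=> m0; apply: (@le_trans _ _ 0%R); first by rewrite mulr_le0_ge0.
  rewrite /T -/n /average; apply: divr_ge0; last by rewrite fine_ge0.
  apply: Rintegral_ge0 => s Es.
  by rewrite mulr_ge0// w_ge0.
apply: average_ge => //; [exact: hw_int|exact: E_pos|].
move=> s Es; have [+ Hs] := Es; rewrite /= in_itv/= => /andP[s0 s1].
apply: (@le_trans _ _ (concave_hull f (p n) / 3 * (1 + s / p n) * w n s))%R; last first.
  by rewrite ler_wpM2r ?w_ge0// ltW.
(* It remains that (1 + x) min (1, 1/x) >= 1 for x = s / p n, checked on each branch of the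
   minimum. *)
rewrite -mulrA ler_peMr//; first by rewrite divr_ge0 ?ltW.
rewrite /w; case: (leP 1%R (p n / s)%R) => H.
  by rewrite mulr1 lerDl divr_ge0 ?ltW.
rewrite mulrDl mul1r mulrA divfK ?gt_eqF// mulfV ?gt_eqF//.
by rewrite lerDr divr_ge0 ?ltW.
Qed.

Lemma concave_hull_in_lattice : carrier F (concave_hull f).
Proof.
have [_ _ interp] := hF.
have [C C0 HC] := interp T T_linear T_Linfty T_Linfty_inv.
have Fabs : carrier F (fun s => `|f s|)%R by rewrite /carrier/= lattice_norm_abs.
rewrite /carrier/=; apply: (@le_lt_trans _ _ (3%:E * F (T (fun s => `|f s|)%R))).
  apply: lattice_le => //; first exact: concave_hull_measurable.
  apply: ae_I01_oo => t t0 t1.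
  rewrite ger0_norm ?concave_hull_ge0 ?(ltW t0)//.
  by apply: (le_trans (T_ge t0 (ltW t1))); rewrite ler_wpM2l// ler_norm.
have [r _ Er] := lattice_fin_num Fabs; have := HC _ Fabs; rewrite Er -EFinM.
move=> H; apply: (@le_lt_trans _ _ (3%:E * (C * r)%:E)).
  by rewrite lee_wpmul2l.
by rewrite -EFinM ltry.
Qed.

End step_operator.

(** The averaging operator, hence its norm, depends on f. A uniform constant comes from
    [positive_bounded], as f |-> F (concave_hull f) is monotone and superhomogeneous for positive
    scalars. *)
Lemma concave_hull_bounded : exists2 C : R, (0 < C)%R & forall f, carrier F f ->
  F (concave_hull f) <= C%:E * F f.
Proof.
have [|||C C0 HC] := @positive_bounded R F (fun f => F (concave_hull f)).
- move=> f g Ff Fg f0 fg; apply: lattice_solid.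
    by apply: concave_hull_measurable; exact: carrier_Linfty.
  apply: ae_I01_oo => t t0 t1.
  have fL := carrier_Linfty Ff; have gL := carrier_Linfty Fg.
  rewrite !ger0_norm ?concave_hull_ge0 ?(ltW t0)//; apply: concave_hull_le_ae => //; last exact: ltW.
  move: fg; apply: ae_I01S => s /f0 fs; rewrite (ger0_norm fs) => /le_trans; apply.
  exact: ler_norm.
- move=> c f c0 Ff; rewrite -lattice_norm_pZ ?(ltW c0)//.
  have fL := carrier_Linfty Ff.
  have cL : carrier norm_Linfty (fun t => c * f t)%R.
    apply: carrier_Linfty; rewrite /carrier/= lattice_norm_pZ ?(ltW c0)//.
    by have [r _ ->] := lattice_fin_num Ff; rewrite -EFinM ltry.
  apply: lattice_solid.
    by apply: measurable_funM => //; exact: concave_hull_measurable.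
  apply: ae_I01_oo => t t0 t1.
  rewrite !ger0_norm ?mulr_ge0 ?concave_hull_ge0 ?(ltW c0) ?(ltW t0)//.
  by apply: concave_hullZ => //; exact: ltW.
- by move=> f Ff _; exact: concave_hull_in_lattice.
exists C => // f Ff.
have Fabs : carrier F (fun s => `|f s|)%R.
  by rewrite /carrier/= lattice_norm_abs//; exact: (lattice_measurable Ff).
rewrite -(lattice_norm_abs F (lattice_measurable Ff)).
apply: le_trans (HC _ Fabs (fun t _ => normr_ge0 _)).
apply: lattice_solid; first by apply: concave_hull_measurable; exact: carrier_Linfty.
apply: ae_I01_oo => t t0 t1.
rewrite !ger0_norm ?concave_hull_ge0 ?(ltW t0)//; try exact: carrier_Linfty.
apply: concave_hull_le_ae; try exact: carrier_Linfty; last exact: ltW.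
by apply: ae_I01W => s; rewrite normr_id.
Qed.

End concave_hull_in_lattice.

(** * Nonsingularity of t |-> t^2 *)

Section square_nonsingular.
Context {R : realType}.
Notation leb := (@lebesgue_measure R).

(** On [d, +oo[ one has |t - s| <= |t^2 - s^2| / d, so the preimage lies within (b - a)/d of any of
    its points; the two sides give the factor 2/d. *)
Let square_preimage_itv (d a b : R) : (0 < d)%R ->
  leb [set t | (d <= t)%R /\ `]a, b[%classic (t ^+ 2)%R]
    <= (2 / d)%:E * leb `]a, b[%classic.
Proof.
move=> d0; set S := [set t | _].
have [[s0 [ds0 s0ab]]|nS] := pselect (S !=set0); last first.
  have -> : S = set0 by apply/eqP; apply: contra_notT nS => /set0P.
  by rewrite measure0 mule_ge0 ?measure_ge0// lee_fin divr_ge0// ltW.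
move: s0ab; rewrite /= in_itv/= => /andP[as0 s0b].
have ab : (a < b)%R by exact: lt_trans s0b.
rewrite lebesgue_measure_itv/= lte_fin ab -EFinD -EFinM.
pose r := ((b - a) / d)%R; have r0 : (0 <= r)%R.
  by rewrite /r divr_ge0 ?(ltW d0)//; lra.
have SI : S `<=` `[(s0 - r)%R, (s0 + r)%R]%classic.
  move=> t [dt]; rewrite /= !in_itv/= => /andP[at_ tb].
  have t0 : (0 < t)%R by exact: lt_le_trans dt.
  have s00 : (0 < s0)%R by exact: lt_le_trans ds0.
  have H : (`|t - s0| <= r)%R.
    rewrite /r ler_pdivlMr// (@le_trans _ _ (`|t - s0| * (t + s0)))%R//.
      by rewrite ler_wpM2l//; lra.
    rewrite -(@ger0_norm _ (t + s0)%R); last by lra.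
    by rewrite -normrM -subr_sqr ler_norml; lra.
  by move: H; rewrite ler_norml; lra.
have : leb S <= leb `[(s0 - r)%R, (s0 + r)%R]%classic by exact: (le_outer_measure leb).
move=> /le_trans; apply; rewrite lebesgue_measure_itv/= lte_fin; case: ifP => _; last first.
  by rewrite lee_fin mulr_ge0 ?divr_ge0 ?(ltW d0)//; lra.
by rewrite -EFinD lee_fin /r; lra.
Qed.

Lemma square_preimage_null (N : set R) (d : R) : (0 < d)%R -> leb N = 0 ->
  leb [set t | (d <= t)%R /\ N (t ^+ 2)%R] = 0.
Proof.
move=> d0 N0; apply/eqP; rewrite eq_le measure_ge0 andbT.
apply/lee_addgt0Pr => e e0; rewrite add0e.
have [F [Fi NF] Fe] : exists2 I_, open_itv_cover N I_ &
    \sum_(0 <= k <oo) wlength idfun (I_ k) <= (e * (d / 2))%:E.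
  have N1 : mu_ext (@wlength R idfun) N = 0 by exact: N0.
  have fN : mu_ext (@wlength R idfun) N \is a fin_num by rewrite N1.
  have ed0 : (0 < e * (d / 2))%R by rewrite mulr_gt0// divr_gt0.
  have := @lb_ereal_inf_adherent R
    [set \sum_(k <oo) wlength idfun (F k) | F in open_itv_cover N] _ ed0.
  rewrite -outer_measure_open_itv_cover => /(_ fN)[_ [G NG <-] H].
  by exists G => //; apply: ltW; move: H; rewrite /= N1 add0e.
pose S k := [set t : R | (d <= t)%R /\ F k (t ^+ 2)%R].
have sub : [set t | (d <= t)%R /\ N (t ^+ 2)%R] `<=` \bigcup_k S k.
  by move=> t [dt /NF[k _ Fk]]; exists k.
apply: (le_trans (le_outer_measure leb _ _ sub)).
apply: (le_trans (outer_measure_sigma_subadditive leb S)).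
apply: (@le_trans _ _ (\sum_(0 <= k <oo) (2 / d)%:E * wlength idfun (F k))).
  apply: lee_nneseries => // k _ /=.
  rewrite /S; have [[a b] ->] := Fi k.
  apply: (le_trans (square_preimage_itv a b d0)).
  by rewrite wlength_itv/= -(@lebesgue_measure_itv R `]a, b[).
rewrite nneseriesZl//.
apply: (@le_trans _ _ ((2 / d)%:E * (e * (d / 2))%:E)).
  by rewrite lee_wpmul2l// lee_fin divr_ge0// ltW.
rewrite -EFinM lee_fin.
have -> : (2 / d * (e * (d / 2)) = e * (d / d))%R by lra.
by rewrite mulfV ?gt_eqF// mulr1.
Qed.

(** The square root is not Lipschitz at 0, so the exceptional set is exhausted by its parts in t >=
    1/(n+1). *)
Lemma ae_I01_square (P : R -> Prop) :
  {ae leb, forall t, I01 t -> P t} -> {ae leb, forall t, I01 t -> P (t ^+ 2)%R}.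
Proof.
move=> [N [mN N0 subN]].
have H (n : nat) : {ae leb, forall t, I01 t -> ((n.+1%:R^-1 <= t)%R -> P (t ^+ 2)%R)}.
  have n0 : (0 < n.+1%:R^-1 :> R)%R by rewrite invr_gt0.
  exists [set t | (n.+1%:R^-1 <= t)%R /\ N (t ^+ 2)%R]; split.
  - rewrite (_ : [set t | _] = `[(n.+1%:R^-1)%R, +oo[%classic `&`
        ((fun t : R => t ^+ 2)%R @^-1` N)); last first.
      by apply/seteqP; split => t /=; rewrite in_itv/= andbT.
    by apply: exprn_measurable => //; exact: measurable_itv.
  - exact: square_preimage_null.
  - move=> t /= nP; split.
      by apply: contrapT => nt; apply: nP => _ /nt.
    apply: subN => /= PI; apply: nP => tI nt; apply: PI.
    move: tI; rewrite /I01/= !in_itv/= => /andP[t0 t1].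
    by rewrite exprn_ge0//= exprn_ile1.
have H1 : {ae leb, forall t, I01 t -> (0 < t)%R} by apply: ae_I01_oo.
have H2 := ae_foralln (mu := leb) H.
move: H1 H2; apply: (@filterS2 _ _ (ae_filter_ringOfSetsType leb)) => t t0 Ht tI.
have {}t0 := t0 tI; apply: (Ht (Num.truncn t^-1) tI).
by rewrite invf_ple ?posrE//; apply: ltW; exact: truncnS_gt.
Qed.

Lemma measurable_square_dilation (f : R -> R) : measurable_fun (@I01 R) f ->
  measurable_fun (@I01 R) (square_dilation f).
Proof.
move=> mf; apply: measurable_fun_divt.
apply: (measurable_comp (F := @I01 R)) => //; first exact: measurable_I01.
  move=> _ [t tI <-]; move: tI; rewrite /I01/= !in_itv/= => /andP[t0 t1].
  by rewrite exprn_ge0//= exprn_ile1.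
Qed.

End square_nonsingular.

Section square_dilation_bounded.
Context {R : realType} (F : banach_lattice R).
Notation leb := (@lebesgue_measure R).

Lemma square_dilation_bounded :
  (forall f, carrier F f -> F (square_dilation f) < +oo) ->
  bounded_operator F F square_dilation.
Proof.
move=> H; have [|||C C0 HC] := @positive_bounded R F (fun f => F (square_dilation f)).
- move=> f g Ff Fg f0 fg; apply: lattice_solid.
    by apply: measurable_square_dilation; exact: (lattice_measurable Ff).
  move/ae_I01_square : fg; apply: ae_I01S => t; rewrite /I01/= in_itv/= => /andP[t0 t1] fg.
  rewrite /square_dilation !normrM ler_wpM2r// (le_trans _ (ler_norm _))// ger0_norm//.
  by apply: f0; rewrite /I01/= in_itv/= exprn_ge0//= exprn_ile1.
- move=> c f c0 Ff; rewrite -lattice_norm_pZ ?(ltW c0)//.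
  rewrite (_ : square_dilation (fun t => c * f t)%R =
     (fun t => c * square_dilation f t)%R)//.
  by apply/funext => t; rewrite /square_dilation mulrA.
- by move=> f Ff _; exact: H.
exists C => // f Ff; have mf := lattice_measurable Ff.
have Fabs : carrier F (fun s => `|f s|)%R by rewrite /carrier/= lattice_norm_abs.
rewrite -(lattice_norm_abs F mf).
apply: le_trans (HC _ Fabs (fun t _ => normr_ge0 _)).
apply: lattice_solid; first exact: measurable_square_dilation.
by apply: ae_I01W => t; rewrite /square_dilation !normrM normr_id.
Qed.

End square_dilation_bounded.

(** * An abundant pair *)

Section bounded_functions.
Context (T : Type) (R : realType).

Definition bounded_pred : {pred T -> R} :=
  fun f => `[< exists M : R, forall x, (`|f x| <= M)%R >].

Lemma bounded_predP (f : T -> R) :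
  reflect (exists M : R, forall x, (`|f x| <= M)%R) (f \in bounded_pred).
Proof. exact: asboolP. Qed.

Lemma bounded_pred_submod_closed : submod_closed bounded_pred.
Proof.
split; first by apply/bounded_predP; exists 0%R => x; rewrite normr0.
move=> c f g /bounded_predP[M Mf] /bounded_predP[N Ng]; apply/bounded_predP.
exists (`|c| * M + N)%R => x.
rewrite (le_trans (ler_normD _ _))// lerD ?Ng//=.
by rewrite normrM ler_wpM2l.
Qed.

HB.instance Definition _ := GRing.isSubmodClosed.Build R (T -> R) bounded_pred
  bounded_pred_submod_closed.

(** Boundedness is required at every point rather than up to null sets, so that a decomposition can
    be evaluated at the single point t to bound K(t, a) from below. *)
Record bounded_function := BoundedFunction {
  bounded_val :> T -> R ;
  bounded_valP : bounded_val \in bounded_pred }.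

HB.instance Definition _ := [isSub for bounded_val].
HB.instance Definition _ := [Choice of bounded_function by <:].
HB.instance Definition _ := [SubChoice_isSubLmodule of bounded_function by <:].

Implicit Types f g : bounded_function.

Lemma bounded_functionP f : exists M : R, (0 <= M)%R /\ forall x, (`|f x| <= M)%R.
Proof.
have /bounded_predP[M Mf] := bounded_valP f; exists `|M|%R; split => // x.
by rewrite (le_trans (Mf x))// ler_norm.
Qed.

Definition sup_norm f : R :=
  inf [set M : R | (0 <= M)%R /\ forall x, (`|f x| <= M)%R].

Lemma sup_norm_le f M : (0 <= M)%R -> (forall x, `|f x| <= M)%R ->
  (sup_norm f <= M)%R.
Proof. by move=> M0 H; apply: ge_inf => //; exists 0%R => x []. Qed.

Lemma sup_norm_ge f x : (`|f x| <= sup_norm f)%R.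
Proof.
have [M HM] := bounded_functionP f.
by apply: lb_le_inf; [exists M|move=> N [_]; exact].
Qed.

Lemma sup_norm_ge0 f : (0 <= sup_norm f)%R.
Proof.
have [M HM] := bounded_functionP f.
by apply: lb_le_inf; [exists M|move=> N []].
Qed.

Lemma sup_normD f g : (sup_norm (f + g) <= sup_norm f + sup_norm g)%R.
Proof.
apply: sup_norm_le => [|x]; first by rewrite addr_ge0 ?sup_norm_ge0.
by rewrite (le_trans (ler_normD _ _))// lerD ?sup_norm_ge.
Qed.

Lemma sup_normZ (c : R) f : sup_norm (c *: f) = (`|c| * sup_norm f)%R.
Proof.
have H (d : R) g : (sup_norm (d *: g) <= `|d| * sup_norm g)%R.
  apply: sup_norm_le => [|x]; first by rewrite mulr_ge0 ?sup_norm_ge0.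
  by rewrite normrM ler_wpM2l// sup_norm_ge.
apply/eqP; rewrite eq_le H/=.
have [->|c0] := eqVneq c 0%R; first by rewrite normr0 mul0r sup_norm_ge0.
rewrite -ler_pdivlMl ?normr_gt0// -normfV.
by apply: le_trans (H _ _); rewrite scalerA mulVf// scale1r.
Qed.

Lemma sup_norm0_eq0 f : sup_norm f = 0%R -> f = 0%R.
Proof.
move=> f0; apply/val_inj/funext => x; apply/eqP; rewrite -normr_le0.
by have := sup_norm_ge f x; rewrite f0.
Qed.

HB.instance Definition _ := Lmodule_isNormed.Build R bounded_function
  sup_normD sup_normZ sup_norm0_eq0.

Lemma bounded_functionB f g x : (f - g)%R x = (f x - g x)%R.
Proof. by []. Qed.

Lemma bounded_function_norm_ge f x : (`|f x| <= `|f|)%R.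
Proof. exact: sup_norm_ge. Qed.

Lemma bounded_function_norm_le f M : (0 <= M)%R -> (forall x, `|f x| <= M)%R ->
  (`|f| <= M)%R.
Proof. exact: sup_norm_le. Qed.

Lemma bounded_function_complete (G : set_system bounded_function) :
  ProperFilter G -> cauchy G -> cvg G.
Proof.
move=> GF /cauchyP Gc.
have ev x : cvg ((fun f => f x : R) @ G).
  apply: cauchy_cvg; apply/cauchyP => e e0.
  have [f0 Hf0] := Gc e e0; exists (f0 x).
  change (G [set f : bounded_function | ball (f0 x : R) e (f x)]).
  apply: filterS Hf0 => f; rewrite /= -!ball_normE /= => Hf.
  by apply: le_lt_trans Hf; rewrite -bounded_functionB; exact: bounded_function_norm_ge.
pose l x : R := lim ((fun f => f x : R) @ G).
have close e : (0 < e)%R -> exists f0, G [set f | forall x, (`|l x - f x| <= e)%R] /\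
    forall x, (`|l x - f0 x| <= e)%R.
  move=> e0; have [f0 Hf0] := Gc (e / 2)%R (divr_gt0 e0 (ltr0Sn _ 1)).
  have f0l x : (`|f0 x - l x| <= e / 2)%R.
    apply/ler_addgt0Pr => d d0.
    have /cvgrPdist_le/(_ d d0) Hl := ev x.
    have [f []] := filter_ex (filterI Hf0 Hl).
    rewrite -ball_normE /= => H1 H2.
    have -> : (f0 x - l x = (f0 - f)%R x + (f x - l x))%R by rewrite bounded_functionB; lra.
    apply: (le_trans (ler_normD _ _)); apply: lerD.
      by apply: ltW; apply: le_lt_trans H1; exact: bounded_function_norm_ge.
    by rewrite distrC.
  exists f0; split; last first.
    move=> x; rewrite distrC (le_trans (f0l x))//; lra.
  apply: filterS Hf0 => f; rewrite -ball_normE /= => H1 x.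
  have -> : (l x - f x = (l x - f0 x) + (f0 - f)%R x)%R by rewrite bounded_functionB; lra.
  apply: (le_trans (ler_normD _ _)); rewrite [leRHS](splitr e) lerD//.
    by rewrite distrC.
  by apply: ltW; apply: le_lt_trans H1; exact: bounded_function_norm_ge.
have lb : l \in bounded_pred.
  have [f0 [_ H]] := close 1%R ltr01; have [M [M0 HM]] := bounded_functionP f0.
  apply/bounded_predP; exists (1 + M)%R => x.
  have -> : (l x = (l x - f0 x) + f0 x)%R by lra.
  by rewrite (le_trans (ler_normD _ _))// lerD.
apply/cvg_ex; exists (BoundedFunction lb); apply/cvgrPdist_le => e e0.
have [_ [H _]] := close e e0; apply: filterS H => f Hf.
by apply: bounded_function_norm_le => [|x]; [exact: ltW|exact: Hf].
Qed.

HB.instance Definition _ := Uniform_isComplete.Build bounded_function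
  bounded_function_complete.

End bounded_functions.

Section weighted_pair.
Context (R : realType).
Notation B := (bounded_function R R).

(* The value off ]0, 1] only serves to keep the second embedding injective. *)
Definition weight (s : R) : R := if (0 < s <= 1)%R then s else 1%R.

Lemma weight_gt0 s : (0 < weight s)%R.
Proof. by rewrite /weight; case: ifP => // /andP[]. Qed.

Lemma weight_le1 s : (weight s <= 1)%R.
Proof. by rewrite /weight; case: ifP => // /andP[]. Qed.

Lemma weighted_bounded (f : B) :
  (fun s => weight s * f s)%R \in @bounded_pred R R.
Proof.
have [M [M0 HM]] := bounded_functionP f; apply/bounded_predP; exists M => s.
rewrite normrM (ger0_norm (ltW (weight_gt0 s))) -[leRHS]mul1r.
by rewrite ler_pM// ?weight_le1// ltW// weight_gt0.
Qed.

Definition weighted (f : B) : B := BoundedFunction (weighted_bounded f).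

Lemma weighted_linear : linear weighted.
Proof.
move=> c f g; apply/val_inj/funext => s.
change (weight s * (c * f s + g s) = c * (weight s * f s) + weight s * g s)%R.
by lra.
Qed.

HB.instance Definition _ := GRing.isLinear.Build R B B _ weighted weighted_linear.

Lemma weighted_inj : injective weighted.
Proof.
move=> f g /(congr1 (fun h : B => (h : R -> R))) fg.
apply/val_inj/funext => s; have := congr1 (fun h => h s) fg.
rewrite /= => /(mulfI _); apply.
by rewrite gt_eqF// weight_gt0.
Qed.

Lemma weighted_norm_le (f : B) : (`|weighted f| <= `|f|)%R.
Proof.
apply: bounded_function_norm_le => // s.
rewrite normrM (ger0_norm (ltW (weight_gt0 s))) -[leRHS]mul1r.
by rewrite ler_pM// ?weight_le1// ?bounded_function_norm_ge// ltW// weight_gt0.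
Qed.

Lemma weighted_continuous : continuous weighted.
Proof.
move=> f; apply/(@cvgrPdist_le _ _ _ (nbhs f) (nbhs_filter f)) => e e0.
have := @cvgr_dist_le _ _ _ (nbhs f) (nbhs_filter f) id f (@cvg_id _ (nbhs f)) e e0.
apply: (@filterS _ (nbhs f) (nbhs_filter f)) => g fg; rewrite -linearB.
exact: (le_trans (weighted_norm_le _)).
Qed.

Lemma idfun_continuous : continuous (idfun : B -> B).
Proof. by move=> f; exact: cvg_id. Qed.

(** The ambient space is the first space itself; the second is the same space embedded by
    multiplication, so its norm is the supremum of |x| / weight. *)
Definition weighted_pair : banach_pair R :=
  @BanachPair R B (@norm_hausdorff _ B) B B idfun weighted
    (@inj_id _) weighted_inj idfun_continuous weighted_continuous.

Lemma conv0_function_small (f : R -> R) (e : R) : conv0_function f -> (0 < e)%R ->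
  exists d, [/\ (0 < d)%R, (d <= 1)%R & (f d <= e)%R].
Proof.
move=> [f0 _ _ /cvgrPdist_le /(_ e) flim] e0.
have H1 : \forall d \near 0%R^'+, (d < 1 :> R)%R by exact: nbhs_right_lt.
have H2 : \forall d \near 0%R^'+, (0 < d :> R)%R by exact: nbhs_right_gt.
have [d [[d1 d0] fd]] := @filter_ex _ _ (at_right_proper_filter (0%R : R)) _
  (filterI (filterI H1 H2) (flim e0)).
exists d; split => //; first exact: ltW.
by move: fd; rewrite sub0r normrN; apply: le_trans; exact: ler_norm.
Qed.

Lemma conv0_function_at0 (f : R -> R) : conv0_function f -> f 0%R = 0%R.
Proof.
move=> [f0 fc fnd flim]; apply/eqP; rewrite eq_le f0 ?andbT; last first.
  by rewrite /I01/= in_itv/= lexx ler01.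
apply/ler_addgt0Pr => e e0; rewrite add0r.
have [d [d0 d1 fd]] := conv0_function_small (And4 f0 fc fnd flim) e0.
apply: le_trans fd; apply: fnd; rewrite ?inE /I01/= ?in_itv/= ?lexx ?ler01 ?d1 ?andbT//.
all: exact: ltW.
Qed.

(** Concavity on the segment from 0 to s, with f 0 = 0. *)
Lemma conv0_function_quasi (f : R -> R) s t : conv0_function f ->
  (0 < t)%R -> (t <= s)%R -> (s <= 1)%R -> (f s / s <= f t / t)%R.
Proof.
move=> cf t0 ts s1; have f00 := conv0_function_at0 cf.
have [f0 fconv fnd _] := cf; have s0 : (0 < s)%R by exact: lt_le_trans ts.
have l0 : (0 <= t / s)%R by rewrite divr_ge0 ?ltW.
have l1 : (t / s <= 1)%R by rewrite ler_pdivrMr// mul1r.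
have := fconv (Itv01 l0 l1) s 0%R.
rewrite !inE /I01/= !in_itv/= lexx ler01 (ltW s0) s1 => /(_ isT isT) H.
have {}H : (- f (t / s * s + (1 - t / s) * 0) <=
  t / s * (- f s) + (1 - t / s) * (- f 0))%R by exact: H.
move: H; rewrite f00 oppr0 !mulr0 !addr0 divfK ?gt_eqF// => H.
have {}H : (t / s * f s <= f t)%R by rewrite -lerN2 -mulrN.
by rewrite ler_pdivlMr// mulrAC -mulrA mulrC.
Qed.

(** The element is f itself, set to 0 off ]0, 1]. Cutting it at d leaves a part below d of norm at
    most f d and a part above of weighted norm at most f d / d; d = t gives the constant 2.
    Conversely any decomposition x + weight y of it, evaluated at t, gives f t <= |x| + t |y|. *)
Lemma weighted_pair_abundant : conv0_abundant weighted_pair.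
Proof.
exists 2%R => // f cf; have f00 := conv0_function_at0 cf.
have [f0 fconv fnd flim] := cf.
have in01 (s : R) : (0 < s <= 1)%R -> s \in @I01 R.
  by rewrite inE /I01/= in_itv/= => /andP[/ltW -> ->].
have I1 : 1%R \in @I01 R by rewrite in01// ltr01 lexx.
have f1 (s : R) : (0 < s <= 1)%R -> (0 <= f s <= f 1)%R.
  move=> s01; have := in01 s s01; rewrite inE => sI.
  by have /andP[s0 s1] := s01; rewrite f0//=; apply: fnd => //; exact: in01.
have f10 : (0 <= f 1)%R by have /andP[] := f1 1%R (ltac:(by rewrite ltr01 lexx)).
have cutb (P : R -> bool) : (fun s => if (0 < s <= 1)%R && P s then f s else 0%R)
    \in @bounded_pred R R.
  apply/bounded_predP; exists (f 1%R) => s; case: ifP => [/andP[s01 _]|_]; last by rewrite normr0.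
  by have /andP[? ?] := f1 s s01; rewrite ger0_norm.
pose cut P : B := BoundedFunction (cutb P).
pose a : B := cut xpredT.
have n0 (x : B) : @norm0 R weighted_pair x = `|x|%:E.
  exact: (@embedded_normE _ _ _ idfun x (@inj_id _)).
have n1 (y : B) : @norm1 R weighted_pair (weighted y) = `|y|%:E.
  exact: (@embedded_normE _ _ _ weighted y weighted_inj).
have h0 := ext_norm0 weighted_pair; have h1 := ext_norm1 weighted_pair.
exists (a : ambient weighted_pair).
  exists a, (weighted (0%R : B)); split.
  - by rewrite /carrier/= n0 ltry.
  - by rewrite /carrier/= n1 ltry.
  - by rewrite linear0 addr0.
have upper (d t : R) : (0 < d <= 1)%R -> (0 <= t)%R ->
    @K_pair R weighted_pair t a <= (f d + t * (f d / d))%:E.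
  move=> d01 t0; have /andP[d0 d1] := d01.
  have /andP[fd0 _] := f1 d d01.
  have yb : (fun s => cut (fun s => (d <= s)%R) s / weight s)%R \in @bounded_pred R R.
    apply/bounded_predP; exists (f d / d)%R => s; rewrite /=.
    case: ifP => [/andP[s01 ds]|_]; last by rewrite mul0r normr0 divr_ge0 ?(ltW d0).
    have /andP[fs0 _] := f1 s s01; have /andP[s0 s1] := s01.
    rewrite /weight s01 ger0_norm ?divr_ge0 ?(ltW s0)//.
    exact: conv0_function_quasi.
  pose y : B := BoundedFunction yb.
  have wy : weighted y = cut (fun s => (d <= s)%R).
    apply/val_inj/funext => s /=; rewrite mulrCA mulfV ?mulr1//.
    by rewrite gt_eqF// weight_gt0.
  have dec : a = (cut (fun s => (s < d)%R) + weighted y)%R.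
    apply/val_inj/funext => s; rewrite wy.
    change ((if (0 < s <= 1)%R && true then f s else 0) =
      (if (0 < s <= 1)%R && (s < d)%R then f s else 0) +
      (if (0 < s <= 1)%R && (d <= s)%R then f s else 0))%R.
    by case: (0 < s <= 1)%R => /=; rewrite ?addr0//; case: ltP => _; rewrite ?addr0 ?add0r.
  apply: (le_trans (K_le t (_ : carrier _ _) (_ : carrier _ _) dec)).
  - by rewrite /carrier/= n0 ltry.
  - by rewrite /carrier/= n1 ltry.
  - rewrite n0 n1 -EFinM -EFinD lee_fin; apply: lerD.
      apply: bounded_function_norm_le => // s /=; case: ifP => [/andP[s01 sd]|_];
        last by rewrite normr0.
      have /andP[fs0 _] := f1 s s01; rewrite ger0_norm//.
      by apply: fnd; rewrite ?in01//; exact: ltW.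
    rewrite ler_wpM2l//.
    apply: bounded_function_norm_le => [|s /=]; first by rewrite divr_ge0 ?(ltW d0).
    case: ifP => [/andP[s01 ds]|_]; last by rewrite mul0r normr0 divr_ge0 ?(ltW d0).
    have /andP[fs0 _] := f1 s s01; have /andP[s0 s1] := s01.
    rewrite /weight s01 ger0_norm ?divr_ge0 ?(ltW s0)//.
    exact: conv0_function_quasi.
have Kge (c t : R) : (0 <= t)%R -> (forall x y : B, a = (x + weighted y)%R ->
    (c <= `|x| + t * `|y|)%R) -> c%:E <= @K_pair R weighted_pair t a.
  move=> t0 H; apply: K_ge => x0 x1 _ /embedded_norm_ltP[y <-] Ea.
  by rewrite n0 n1 -EFinM -EFinD lee_fin; apply: H.
move=> t; rewrite /I01/= in_itv/= => /andP[t0 t1].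
(* At t = 0 the second part is free, and the first tends to 0 with d. *)
have [t00|t0'] := eqVneq t 0%R.
  rewrite t00 f00 !mulr0; split.
    by apply: Kge => // x y _; rewrite mul0r addr0.
  apply/lee_addgt0Pr => e e0; rewrite add0e.
  have [d [d0 d1 fd]] := conv0_function_small cf e0.
  have d01 : (0 < d <= 1)%R by rewrite d0.
  by apply: (le_trans (upper d 0%R d01 (lexx _))); rewrite mul0r addr0 lee_fin.
have t01 : (0 < t <= 1)%R by rewrite t1 andbT lt_neqAle eq_sym t0'.
have tp : (0 < t)%R by have /andP[] := t01.
split.
  apply: Kge => // x y Ea.
  have /andP[ft0 _] := f1 t t01.
  apply: (@le_trans _ _ (f t)); first by rewrite ler_piMl//; lra.
  have : f t = (x t + weight t * y t)%R.
    have := congr1 (fun h : B => h t) Ea.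
    by rewrite /= t01.
  rewrite /weight t01 => ->; apply: (le_trans (ler_norm _)).
  apply: (le_trans (ler_normD _ _)); rewrite normrM (ger0_norm t0).
  by apply: lerD; rewrite ?ler_wpM2l//; exact: bounded_function_norm_ge.
apply: (le_trans (upper t t t01 t0)).
by rewrite lee_fin mulrCA mulfV ?gt_eqF// mulr1; lra.
Qed.

End weighted_pair.

(** * The equivalences *)

Section K_space.
Context {R : realType} (F : banach_lattice R) (A : banach_pair R).
Notation leb := (@lebesgue_measure R).
Implicit Types a b : ambient A.

Let h0 := ext_norm0 A.
Let h1 := ext_norm1 A.

Lemma K_pairE a t : (0 <= t)%R -> K_pair t a < +oo ->
  K_pair t a = (fine (K_pair t a))%:E.
Proof. by move=> t0 Kt; rewrite fineK// ge0_fin_numE//; exact: K_ge0. Qed.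

Lemma K_pair_ae a : (forall t, (0 < t)%R -> K_pair t a < +oo) ->
  (fun t => K_pair t a) = EFin \o (fun t => fine (K_pair t a)) %[ae leb in @I01 R].
Proof. by move=> Kfin; apply: ae_I01_oo => t t0 _; rewrite /= -K_pairE ?Kfin// ltW. Qed.

Lemma K_pair_measurable a : (forall t, (0 < t)%R -> K_pair t a < +oo) ->
  measurable_fun (@I01 R) (fun t => fine (K_pair t a)).
Proof.
by move=> /K_pair_quasi_concave kqc; have [] := quasi_concave_measurable kqc.
Qed.

Lemma norm_FKE a : (forall t, (0 < t)%R -> K_pair t a < +oo) ->
  norm_FK F a = F (fun t => fine (K_pair t a)).
Proof.
by move=> Kfin; apply: on_extendedE; [exact: K_pair_measurable|exact: K_pair_ae].
Qed.

(** Finiteness at one point yields a decomposition of a, and that decomposition bounds K at every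
    t. *)
Lemma carrier_norm_FK_fin a : carrier (@norm_FK R F A) a ->
  forall t, (0 < t)%R -> K_pair t a < +oo.
Proof.
move=> /carrier_on_extended[h Kh _] t t0.
have [u [u0 _ Ku]] := ae_exists_itv (lexx _) ltr01 (lexx _) Kh.
apply: (K_lty_all h0 h1 u0 t0).
by rewrite -/(K_pair u a) Ku ltry.
Qed.

Lemma norm_FK_ge0 a : 0 <= norm_FK F a.
Proof. by apply: le_ereal_inf_tmp => _ [h _ <-]; exact: lattice_norm_ge0. Qed.

Lemma norm_FK_le (C : R) a f : (0 <= C)%R ->
  (forall t, (0 < t)%R -> K_pair t a < +oo) ->
  {ae leb, forall t, I01 t -> (fine (K_pair t a) <= C * `|f t|)%R} ->
  norm_FK F a <= C%:E * F f.
Proof.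
move=> C0 Kfin H; rewrite norm_FKE//; apply: lattice_le => //.
  exact: K_pair_measurable.
have [k0 _ _] := K_pair_quasi_concave Kfin.
have H1 : {ae leb, forall t, I01 t -> (0 < t)%R} by apply: ae_I01_oo.
move: H1 H; apply: ae_I01S2 => t _ t0.
by rewrite [X in (_ -> X <= _)%R]ger0_norm// k0.
Qed.

Lemma K_pair_finD a b : (forall t, (0 < t)%R -> K_pair t a < +oo) ->
  (forall t, (0 < t)%R -> K_pair t b < +oo) ->
  forall t, (0 < t)%R -> K_pair t (a + b)%R < +oo.
Proof.
move=> fa fb t t0; apply: (le_lt_trans (K_D h0 h1 a b (ltW t0))).
by rewrite lte_add_pinfty//; [exact: fa|exact: fb].
Qed.

Lemma fine_K_pairD a b t : (forall t, (0 < t)%R -> K_pair t a < +oo) ->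
  (forall t, (0 < t)%R -> K_pair t b < +oo) -> (0 < t)%R ->
  (fine (K_pair t (a + b)%R) <= fine (K_pair t a) + fine (K_pair t b))%R.
Proof.
move=> fa fb t0; rewrite -lee_fin EFinD -!K_pairE ?fa ?fb ?(ltW t0)//.
  by apply: K_D => //; exact: ltW.
exact: K_pair_finD.
Qed.

Lemma K_pair0 t : (0 < t)%R -> K_pair t (0 : ambient A)%R = 0.
Proof.
have [_ N00 _ _] := h0; move=> t0; apply/eqP; rewrite eq_le.
rewrite (K_ge0 h0 h1 _ (ltW t0)) andbT.
by rewrite -N00; exact: K_le0.
Qed.

Lemma norm_FK0 : norm_FK F (0 : ambient A)%R = 0.
Proof.
rewrite /norm_FK (@on_extendedE _ F _ (fun=> 0%R)) ?lattice_norm0//.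
by apply: ae_I01_oo => t t0 _ /=; rewrite K_pair0.
Qed.

Lemma norm_FKD a b : norm_FK F (a + b)%R <= norm_FK F a + norm_FK F b.
Proof.
have [aoo|] := eqVneq (norm_FK F a) +oo.
  by rewrite aoo addye ?leey// gt_eqF// (lt_le_trans _ (norm_FK_ge0 _)).
rewrite -ltey => /carrier_norm_FK_fin fa.
have [boo|] := eqVneq (norm_FK F b) +oo.
  by rewrite boo addey ?leey// gt_eqF// (lt_le_trans _ (norm_FK_ge0 _)).
rewrite -ltey => /carrier_norm_FK_fin fb.
rewrite (norm_FKE fa) (norm_FKE fb); apply: le_trans (lattice_normD _ _ _).
rewrite -[leRHS]mul1e; apply: norm_FK_le => //; first exact: K_pair_finD.
apply: ae_I01_oo => t t0 _; rewrite mul1r (le_trans _ (ler_norm _))//.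
exact: fine_K_pairD.
Qed.

Lemma norm_gagliardo1_ge0 a : 0 <= norm_gagliardo1 a.
Proof.
apply: (@le_trans _ _ ((1^-1)%:E * K_pair 1 a)).
  by rewrite mule_ge0 ?lee_fin ?invr_ge0//; exact: K_ge0.
by apply: ereal_sup_ubound; exists 1%R => //=.
Qed.

Lemma norm_gagliardo1_le (M : R) a :
  (forall t, (0 < t)%R -> K_pair t a <= (t * M)%:E) -> norm_gagliardo1 a <= M%:E.
Proof.
move=> H; apply: ge_ereal_sup => _ [t /= t0 <-].
by rewrite lee_pdivrMl// -EFinM; exact: H.
Qed.

Lemma carrier_norm_gagliardo1P a : carrier (@norm_gagliardo1 R A) a ->
  exists2 M : R, (0 <= M)%R & norm_gagliardo1 a = M%:E /\
    forall t, (0 < t)%R -> K_pair t a <= (t * M)%:E.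
Proof.
rewrite /carrier/= => G; have := norm_gagliardo1_ge0 a; move: G.
case EM : (norm_gagliardo1 a) => [M| |]//; rewrite lee_fin => _ M0.
exists M => //; split => // t t0; rewrite EFinM -lee_pdivrMl// -EM.
by apply: ereal_sup_ubound; exists t.
Qed.

Lemma norm_gagliardo1_0 : norm_gagliardo1 (0 : ambient A)%R = 0.
Proof.
apply/eqP; rewrite eq_le norm_gagliardo1_ge0 andbT.
by apply: norm_gagliardo1_le => t t0; rewrite mulr0 K_pair0.
Qed.

Lemma carrier_norm_gagliardo1_fin a : carrier (@norm_gagliardo1 R A) a ->
  forall t, (0 < t)%R -> K_pair t a < +oo.
Proof.
move=> /carrier_norm_gagliardo1P[M _ [_ H]] t t0.
by rewrite (le_lt_trans (H t t0))// ltry.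
Qed.

Lemma sum_space_fin a : sum_space (@norm_FK R F A) (@norm_gagliardo1 R A) a ->
  forall t, (0 < t)%R -> K_pair t a < +oo.
Proof.
move=> [a0 [a1 [/carrier_norm_FK_fin f0 /carrier_norm_gagliardo1_fin f1 ->]]].
exact: K_pair_finD.
Qed.

(** A Gagliardo norm M means K(t, a) <= M t, so K(., a) lies in L^oo(1/t) with norm at most M. *)
Lemma norm_FK_le_gagliardo1 (C : R) a : (0 < C)%R ->
  (forall f, carrier norm_Linfty_inv f -> F f <= C%:E * norm_Linfty_inv f) ->
  carrier (@norm_gagliardo1 R A) a -> norm_FK F a <= C%:E * norm_gagliardo1 a.
Proof.
move=> C0 HC Ga; have Kfin := carrier_norm_gagliardo1_fin Ga.
have [M M0 [-> HM]] := carrier_norm_gagliardo1P Ga.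
have [k0 _ _] := K_pair_quasi_concave Kfin.
have L : norm_Linfty_inv (fun t => fine (K_pair t a)) <= M%:E.
  apply: norm_Linfty_inv_le => //; first exact: K_pair_measurable.
  apply: ae_I01_oo => t t0 _; rewrite ger0_norm ?k0//.
  by rewrite -lee_fin -K_pairE ?Kfin ?(ltW t0)// mulrC; exact: HM.
rewrite norm_FKE//; apply: (le_trans (HC _ _)).
  by rewrite /carrier/= (le_lt_trans L)// ltry.
by rewrite lee_wpmul2l// lee_fin ltW.
Qed.

Lemma profile_lower q a : 1 <= q -> (forall t, (0 < t)%R -> K_pair t a < +oo) ->
  (expR (-1) / 2)%:E * norm_FK F a <= on_extended F (theta_profile q a).
Proof.
move=> q1 Kfin; apply: le_ereal_inf_tmp => _ [h ah <-].
have c0 : (0 < expR (-1) / 2 :> R)%R by rewrite divr_gt0 ?expR_gt0.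
rewrite -lee_pdivlMl//; apply: norm_FK_le; [by rewrite invr_ge0 ltW|by []|].
have H1 : {ae leb, forall t, I01 t -> (0 < t)%R /\ (t < 1)%R} by apply: ae_I01_oo.
move: H1 ah; apply: ae_I01S2 => t _ [t0 t1] ht.
have := profile_ge Kfin q1 t0 t1; rewrite ht /= lee_fin => H.
by rewrite ler_pdivlMl// (le_trans H)// ler_norm.
Qed.

End K_space.

(** At the price s the second component is never cheaper than in the first space, so the
    decomposition x + 0 is optimal. *)
Lemma K_functional_large {R : realType} (V : zmodType) (N0 N1 : V -> \bar R)
    (s : R) x :
  (forall x y, N0 (x + y)%R <= N0 x + N0 y) -> N1 0%R = 0 ->
  (forall x, carrier N1 x -> N0 x <= s%:E * N1 x) ->
  K_functional N0 N1 s x = N0 x.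
Proof.
move=> N0D N10 H; apply/eqP; rewrite eq_le; apply/andP; split.
  have [->|Nx] := eqVneq (N0 x) +oo; first exact: leey.
  apply: (le_trans (@K_le _ _ N0 N1 s x x 0%R _ _ _)).
  - by rewrite /carrier/= ltey.
  - by rewrite /carrier/= N10.
  - by rewrite addr0.
  - by rewrite N10 mule0 adde0.
apply: K_ge => x0 x1 _ c1 ->; apply: (le_trans (N0D _ _)).
by rewrite leeD2l//; exact: H.
Qed.

(** * From (a) to (b) *)

Section equivalences.
Context {R : realType} (F : banach_lattice R).
Notation leb := (@lebesgue_measure R).
Hypothesis hF : interpolation_lattice F.

Lemma norm_Linfty_inv0 : norm_Linfty_inv (0 : R -> R)%R = 0.
Proof.
apply/eqP; rewrite eq_le norm_Linfty_inv_ge0 andbT.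
apply: norm_Linfty_inv_le => //; first exact: measurable_cst.
by apply: ae_I01W => t; rewrite mul0r normr0.
Qed.

Lemma uniform_extrapolation : bounded_operator F F square_dilation ->
  exists2 C : R, (0 < C)%R & forall (A : banach_pair R) (a : ambient A) q,
    1 <= q -> carrier (@norm_FK R F A) a ->
    on_extended F (theta_profile q a) <= C%:E * norm_FK F a.
Proof.
move=> ha; have [C C0 HC] := majorant_bounded hF ha.
exists (2 * C)%R; first by rewrite mulr_gt0.
move=> A a q q1 ca; have Kfin := carrier_norm_FK_fin ca.
have Fk : carrier F (fun t => fine (K_pair t a)).
  by move: ca; rewrite /carrier/= norm_FKE.
have [f [f0 Ff Hf]] := HC A a Kfin Fk.
have Hp : {ae leb, forall t, I01 t -> theta_profile q a t <= (2 * f t)%:E}.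
  have H1 : {ae leb, forall t, I01 t -> (0 < t)%R /\ (t < 1)%R} by apply: ae_I01_oo.
  move: H1 Hf; apply: ae_I01S2 => t _ [t0 t1] Hf.
  apply: (le_trans (profile_le_majorant Kfin q1 t0 t1)).
  by rewrite EFinM lee_wpmul2l.
have p0 t := theta_profile_ge0 Kfin (t := t) q1.
have E := ae_fine_dominated p0 Hp.
apply: (le_trans (on_extended_le F E)).
rewrite norm_FKE// EFinM -muleA.
apply: (@le_trans _ _ (2%:E * F f)); last by rewrite lee_wpmul2l.
apply: lattice_le => //.
  by apply: measurableT_comp => //; exact: measurable_theta_profile.
move: Hp E; apply: ae_I01S2 => t tI; rewrite /= => + E; rewrite E lee_fin => H.
have g0 : (0 <= fine (theta_profile q a t))%R by rewrite fine_ge0// p0.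
rewrite /= (ger0_norm g0); apply: (le_trans H).
by rewrite ler_wpM2l// ler_norm.
Qed.

Lemma square_dilation_extrapolation : bounded_operator F F square_dilation ->
  forall (A : banach_pair R) q, 1 <= q -> extrapolation_description F A q.
Proof.
move=> /uniform_extrapolation[C C0 HC] A q q1.
exists (expR (-1) / 2)%R, C; split => //; move=> a ca; split; last exact: HC.
by apply: profile_lower => //; exact: (carrier_norm_FK_fin ca).
Qed.

End equivalences.

(** * From one abundant pair back to (a) *)

Section abundant.
Context {R : realType} (F : banach_lattice R).
Notation leb := (@lebesgue_measure R).
Hypothesis hF : interpolation_lattice F.
Variables (A : banach_pair R) (q : \bar R).
Hypotheses (hA : conv0_abundant A) (q1 : 1 <= q)
  (hext : extrapolation_description F A q).

(** Realize f as K(., a) up to a constant; h is then a real representative of the profile of a. Its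
    norm is controlled by the assumed equivalence, and testing at t^2 bounds it below. M and c do
    not depend on f, which the argument with ramps requires. *)
Lemma conv0_square_dominated : exists M c : R, [/\ (0 < M)%R, (0 < c)%R &
  forall f, conv0_function f -> carrier F f -> exists h,
    [/\ carrier F h, F h <= M%:E * F f &
      {ae leb, forall t, I01 t -> (c * (f (t ^+ 2) / t) <= h t)%R}]].
Proof.
have [C C0 HC] := hA; have [c' [C' [_ C'0 H']]] := hext.
pose e := (expR (-1) / 2 : R)%R; have e0 : (0 < e)%R by rewrite divr_gt0 ?expR_gt0.
exists (C' * C)%R, (e / C)%R; split; [by rewrite mulr_gt0|by rewrite divr_gt0|].
move=> f cf Ff; have [a sa Ha] := HC f cf.
have Kfin t : (0 < t)%R -> K_pair t a < +oo.
  by move=> t0; apply: K_lty => //; [exact: ext_norm0|exact: ext_norm1|exact: ltW].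
have [f0 _ _ _] := cf.
have Ka (t : R) : (0 < t)%R -> (t < 1)%R ->
    (C^-1 * f t <= fine (K_pair t a) <= C * f t)%R.
  move=> t0 t1; have [|] := Ha t; first by rewrite /I01/= in_itv/= !ltW.
  by rewrite K_pairE ?Kfin ?(ltW t0)// !lee_fin => -> ->.
have Ea : norm_FK F a <= C%:E * F f.
  apply: norm_FK_le => //; first exact: ltW.
  apply: ae_I01_oo => t t0 t1; have /andP[_ H] := Ka t t0 t1.
  by rewrite (le_trans H)// ler_pM2l// ler_norm.
have [r r0 Er] := lattice_fin_num Ff.
have ca : carrier (@norm_FK R F A) a.
  by rewrite /carrier/= (le_lt_trans Ea)// Er -EFinM ltry.
have [_ up] := H' a ca.
have up' : on_extended F (theta_profile q a) <= (C' * C)%:E * F f.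
  by rewrite EFinM -muleA (le_trans up)// lee_wpmul2l// lee_fin ltW.
have : on_extended F (theta_profile q a) < +oo.
  by rewrite (le_lt_trans up')// Er -EFinM ltry.
move=> /carrier_on_extended[h ah [Fh Eh]]; exists h; split => //.
  by rewrite -Eh.
have H1 : {ae leb, forall t, I01 t -> (0 < t)%R /\ (t < 1)%R} by apply: ae_I01_oo.
move: H1 ah; apply: ae_I01S2 => t _ [t0 t1] ht.
have := profile_ge_square Kfin q1 t0 t1; rewrite ht /= lee_fin; apply: le_trans.
have t20 : (0 < t ^+ 2)%R by rewrite exprn_gt0.
have t21 : (t ^+ 2 < 1)%R by rewrite exprn_ilt1 ?(ltW t0).
have /andP[Hk _] := Ka _ t20 t21.
rewrite -/e -mulrA ler_pM2l// mulrA ler_pM2r// invr_gt0//.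
Qed.

Lemma conv0_function_ramp (e : R) : (0 < e)%R ->
  conv0_function (fun t => Num.min 1 (t / e))%R.
Proof.
move=> e0; split.
- move=> t; rewrite /I01/= in_itv/= => /andP[t0 _].
  by rewrite le_min ler01 divr_ge0// ltW.
- move=> l x y _ _.
  have H : (l%:num * Num.min 1 (x / e) + (1 - l%:num) * Num.min 1 (y / e) <=
      Num.min 1 ((l%:num * x + (1 - l%:num) * y) / e))%R.
    have l0 : (0 <= l%:num)%R by [].
    have l1 : (0 <= 1 - l%:num)%R by rewrite subr_ge0.
    have Hx1 : (l%:num * Num.min 1 (x / e) <= l%:num * 1)%R.
      by rewrite ler_wpM2l// ge_min lexx.
    have Hy1 : ((1 - l%:num) * Num.min 1 (y / e) <= (1 - l%:num) * 1)%R.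
      by rewrite ler_wpM2l// ge_min lexx.
    have Hx2 : (l%:num * Num.min 1 (x / e) <= l%:num * (x / e))%R.
      by rewrite ler_wpM2l// ge_min lexx orbT.
    have Hy2 : ((1 - l%:num) * Num.min 1 (y / e) <= (1 - l%:num) * (y / e))%R.
      by rewrite ler_wpM2l// ge_min lexx orbT.
    by rewrite le_min; apply/andP; split; lra.
  change (- Num.min 1 ((l%:num * x + (1 - l%:num) * y) / e) <=
    l%:num * (- Num.min 1 (x / e)) + (1 - l%:num) * (- Num.min 1 (y / e)))%R.
  by move: H; move: (Num.min _ _) (Num.min _ _) (Num.min _ _) => u v w; lra.
- move=> s t _ _ st; rewrite le_min ge_min lexx/= ge_min.
  by rewrite ler_wpM2r ?orbT// invr_ge0 ltW.
- apply/cvgrPdist_le => d d0; near=> t.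
  have t0 : (0 < t)%R by near: t; exact: nbhs_right_gt.
  rewrite sub0r normrN ger0_norm; last by rewrite le_min ler01 divr_ge0// ltW.
  rewrite ge_min ler_pdivrMr//; apply/orP; right; apply: ltW.
  by near: t; apply: nbhs_right_lt; rewrite mulr_gt0.
Unshelve. all: by end_near. Qed.

(* Tested on the ramps min(1, t / d^2), which are bounded by 1 whereas their
   square dilations are 1 / t on ]d, 2d[. *)
Lemma carrier_cst1N : ~ carrier F (cst 1%R).
Proof.
move=> F1; have [r r0 Er] := lattice_fin_num F1.
have [M [c [M0 c0 H]]] := conv0_square_dominated.
have [_ [C C0 HC] _] := hF.
pose Bd := (C * (M * r))%R.
have Bd0 : (0 <= Bd)%R by rewrite /Bd !mulr_ge0// ltW.
have key (d : R) : (0 < d)%R -> (2 * d <= 1)%R -> (c <= 2 * d * Bd)%R.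
  move=> d0 d1; have d20 : (0 < d ^+ 2)%R by rewrite exprn_gt0.
  have cf := conv0_function_ramp d20; set f := (fun t => _) in cf.
  have [f0 _ _ _] := cf.
  have Ff1 : F f <= r%:E.
    rewrite -Er; apply: lattice_solid.
      by apply: measurable_minr => //; exact: measurable_funM.
    apply: ae_I01_oo => t t0 t1; rewrite normr1 ger0_norm.
      by rewrite /f ge_min lexx.
    by apply: f0; rewrite /I01/= in_itv/= !ltW.
  have Ff : carrier F f by rewrite /carrier/= (le_lt_trans Ff1)// ltry.
  have [h [Fh hM hf]] := H f cf Ff.
  have : norm_Linfty h <= Bd%:E.
    apply: (le_trans (HC h Fh)); rewrite /Bd EFinM lee_wpmul2l ?lee_fin ?(ltW C0)//.
    apply: (le_trans hM); rewrite EFinM lee_wpmul2l ?lee_fin ?(ltW M0)//.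
  move=> /(norm_LinftyP _ Bd0)[_ hB].
  have both : {ae leb, forall t, I01 t -> (c * (f (t ^+ 2) / t) <= Bd)%R}.
    move: hf hB; apply: ae_I01S2 => t _ h1 h2.
    by rewrite (le_trans h1)// (le_trans _ h2)// ler_norm.
  have d2 : (d < 2 * d)%R by lra.
  have [t [dt td]] := ae_exists_itv (ltW d0) d2 d1 both.
  have t0 : (0 < t)%R by exact: lt_trans dt.
  have -> : (f (t ^+ 2) = 1)%R.
    rewrite /f min_l// ler_pdivlMr// mul1r lerXn2r ?nnegrE ?(ltW d0) ?(ltW t0)//.
    exact: ltW.
  rewrite mul1r ler_pdivrMr// => /le_trans; apply.
  by rewrite mulrC ler_wpM2r// ltW.
(* The first bound keeps ]d, 2d[ inside [0, 1]; the second makes 2 d Bd smaller than c, against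
   [key]. *)
pose d : R := Num.min (1 / 2)%R (c / (4 * (Bd + 1)))%R.
have B1 : (0 < 4 * (Bd + 1))%R by lra.
have d0 : (0 < d)%R by rewrite lt_min divr_gt0//= divr_gt0.
have d2 : (d <= 1 / 2)%R by rewrite ge_min lexx.
have d3 : (d * (4 * (Bd + 1)) <= c)%R.
  by rewrite -ler_pdivlMr// ge_min lexx orbT.
have := key d d0 (ltac:(lra)); have : (0 <= d * Bd)%R by rewrite mulr_ge0// ltW.
lra.
Qed.

Lemma concave_hull_conv0 f : carrier F f -> conv0_function (concave_hull f).
Proof.
move=> Ff; have fL := carrier_Linfty hF Ff; split.
- by move=> t; rewrite /I01/= in_itv/= => /andP[t0 _]; exact: concave_hull_ge0.
- exact: concave_hull_concave.
- move=> s t; rewrite !inE /I01/= !in_itv/= => /andP[s0 _] _; exact: concave_hull_nd.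
(* If the majorant stayed above some e > 0, the constant 1 would be at most e^-1 times it, hence
   would lie in F. *)
- have small (e : R) : (0 < e)%R -> exists2 d : R, (0 < d)%R & (concave_hull f d < e)%R.
    move=> e0; apply: contrapT => nd; apply: carrier_cst1N.
    have Fh := concave_hull_in_lattice hF Ff; have [r _ Er] := lattice_fin_num Fh.
    rewrite /carrier/=; apply: (@le_lt_trans _ _ ((e^-1)%:E * F (concave_hull f))); last first.
      by rewrite Er -EFinM ltry.
    apply: lattice_le => //; first by rewrite invr_ge0 ltW.
    apply: ae_I01_oo => t t0 t1; rewrite normr1 ler_pdivlMl// mulr1.
    rewrite (le_trans _ (ler_norm _))// leNgt; apply/negP => H; apply: nd.
    by exists t.
  apply/cvgrPdist_le => e e0; have [d d0 de] := small e e0.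
  near=> t.
  have t0 : (0 < t)%R by near: t; exact: nbhs_right_gt.
  rewrite sub0r normrN ger0_norm ?concave_hull_ge0 ?(ltW t0)//.
  apply: le_trans (ltW de); apply: concave_hull_nd => //.
  by apply: ltW; near: t; exact: nbhs_right_lt.
Unshelve. all: by end_near. Qed.

(** The concave majorant of f is admissible for the domination of squares, and |f(t^2)| is at most
    its value at t^2 for almost every t because squaring pulls null sets back to null sets. *)
Lemma abundant_square_dilation : bounded_operator F F square_dilation.
Proof.
apply: square_dilation_bounded => f Ff; have fL := carrier_Linfty hF Ff.
have [M [c [M0 c0 H]]] := conv0_square_dominated.
have [h [Fh _ hf]] := H _ (concave_hull_conv0 Ff) (concave_hull_in_lattice hF Ff).
have [r _ Er] := lattice_fin_num Fh.
apply: (@le_lt_trans _ _ ((c^-1)%:E * F h)); last by rewrite Er -EFinM ltry.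
apply: lattice_le; first by rewrite invr_ge0 ltW.
  by apply: measurable_square_dilation; exact: (lattice_measurable Ff).
have H2 := ae_I01_square (concave_hull_ae_ge fL).
have H1 : {ae leb, forall t, I01 t -> (0 < t)%R} by apply: ae_I01_oo.
have H3 : {ae leb, forall t, I01 t ->
    (0 < t)%R /\ (`|f (t ^+ 2)| <= concave_hull f (t ^+ 2))%R}.
  by move: H1 H2; apply: ae_I01S2.
move: H3 hf; apply: ae_I01S2 => t _ [t0 h1] h2.
rewrite ler_pdivlMl// (le_trans _ (ler_norm _))// (le_trans _ h2)//.
rewrite ler_pM2l// /square_dilation normrM (gtr0_norm (_ : 0 < t^-1)%R) ?invr_gt0//.
by rewrite ler_wpM2r// invr_ge0 ltW.
Qed.

End abundant.

(** * Comparison of the K-functionals in (c) *)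

Section K_of_profile.
Context {R : realType} (F : banach_lattice R).
Notation leb := (@lebesgue_measure R).
Hypothesis hF : interpolation_lattice F.

(** The second summand contributes s^-et s M <= M, since s < 1 and et <= 1. *)
Lemma majorant_add_le (A : banach_pair R) (a0 a1 : ambient A) (M t : R) :
  (forall t, (0 < t)%R -> K_pair t a0 < +oo) ->
  (forall t, (0 < t)%R -> K_pair t a1 <= (t * M)%:E) -> (0 <= M)%R ->
  (0 < t)%R -> (t < 1)%R -> majorant (a0 + a1)%R t <= majorant a0 t + (t * M)%:E.
Proof.
move=> f0 H1 M0 t0 t1; have [th2 th1] := theta_of_itv t0 t1.
have h0 := ext_norm0 A; have h1 := ext_norm1 A.
rewrite /majorant EFinM -ge0_muleDr ?lee_fin ?norm_theta_y_ge0//.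
rewrite lee_wpmul2l ?lee_fin ?(ltW t0)//.
set et := ((1 + theta_of t) / 2)%R.
apply: ge_ereal_sup => _ [s + <-]; rewrite /= in_itv/= => /andP[s0 s1].
have p0 : 0 <= (s `^ (- et))%:E by rewrite lee_fin powR_ge0.
apply: (@le_trans _ _ ((s `^ (- et))%:E * (K_pair s a0 + K_pair s a1))).
  by rewrite lee_wpmul2l//; apply: K_D => //; exact: ltW.
have K0 (b : ambient A) : 0 <= K_pair s b by apply: K_ge0 => //; exact: ltW.
rewrite ge0_muleDr ?K0//.
apply: leeD.
  by apply: ereal_sup_ubound; exists s => //=; rewrite in_itv/= s0.
apply: (@le_trans _ _ ((s `^ (- et))%:E * (s * M)%:E)).
  by rewrite lee_wpmul2l//; exact: H1.
rewrite -EFinM lee_fin mulrA ler_piMl//.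
rewrite -{2}(powRr1 (ltW s0)) -powRD; last by rewrite (gt_eqF s0) implybT.
rewrite -[leRHS](powRr0 s); apply: ger_powR; first by rewrite s0 ltW.
by rewrite /et; lra.
Qed.

(** For a = a0 + a1 the profile h is at most 2 f + 2 M t, with f dominating the majorant of a0 and M
    the Gagliardo norm of a1. Then min (h, 2 f) is in F, and the remainder, at most 2 M t, is in
    L^oo(1/t). D bounds the coefficients 2 C and 2 of the two parts. *)
Lemma K_profile_le : bounded_operator F F square_dilation ->
  exists2 C : R, (0 < C)%R &
    forall (A : banach_pair R) (a : ambient A) (s : R) q, (0 < s)%R -> 1 <= q ->
    on_extended (K_functional F norm_Linfty_inv s) (theta_profile q a) <=
    C%:E * K_functional (@norm_FK R F A) (@norm_gagliardo1 R A) s a.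
Proof.
move=> ha; have [C C0 HC] := majorant_bounded hF ha.
pose D := (2 * C + 2)%R; have D0 : (0 < D)%R by rewrite /D; lra.
exists D => // A a s q s0 q1.
rewrite -lee_pdivrMl//; apply: K_ge => a0 a1 c0 c1 Ea.
rewrite lee_pdivrMl//.
have f0 := carrier_norm_FK_fin c0.
have [M M0 [EM HM]] := carrier_norm_gagliardo1P c1.
have Kfin t : (0 < t)%R -> K_pair t a < +oo.
  by rewrite Ea; apply: K_pair_finD => //; exact: (carrier_norm_gagliardo1_fin c1).
have Fk : carrier F (fun t => fine (K_pair t a0)).
  by move: c0; rewrite /carrier/= norm_FKE.
have [f [fp Ff Hf]] := HC A a0 f0 Fk.
rewrite -(norm_FKE F f0) in Ff.
have [r r0 Er] : exists2 r : R, (0 <= r)%R & norm_FK F a0 = r%:E.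
  by rewrite (norm_FKE F f0); exact: lattice_fin_num.
have cf : carrier F f by rewrite /carrier/= (le_lt_trans Ff)// Er -EFinM ltry.
have mf := lattice_measurable cf.
have Hp : {ae leb, forall t, I01 t ->
    theta_profile q a t <= (2 * f t + 2 * M * t)%:E}.
  have H1 : {ae leb, forall t, I01 t -> (0 < t)%R /\ (t < 1)%R} by apply: ae_I01_oo.
  move: H1 Hf; apply: ae_I01S2 => t _ [t0 t1] Hf.
  apply: (le_trans (profile_le_majorant Kfin q1 t0 t1)).
  apply: (@le_trans _ _ (2%:E * (f t + t * M)%:E)).
    rewrite lee_wpmul2l// Ea (le_trans (majorant_add_le f0 HM M0 t0 t1))//.
    by rewrite EFinD leeD2r.
  by rewrite -EFinM lee_fin; lra.
have p0 t := theta_profile_ge0 Kfin (t := t) q1.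
have E := ae_fine_dominated p0 Hp.
apply: (le_trans (on_extended_le _ E)).
set h := fine \o _ in E *.
have mh : measurable_fun (@I01 R) h.
  by apply: measurableT_comp => //; exact: measurable_theta_profile.
have hb : {ae leb, forall t, I01 t -> (0 <= h t <= 2 * f t + 2 * M * t)%R}.
  move: Hp E; apply: ae_I01S2 => t tI; rewrite /= => + E; rewrite E lee_fin => ->.
  by rewrite andbT /h /= fine_ge0// p0.
pose g0 t := Num.min (h t) (2 * f t)%R.
pose g1 t := (h t - g0 t)%R.
have mg0 : measurable_fun (@I01 R) g0.
  by apply: measurable_minr => //; exact: measurable_funM.
have mg1 : measurable_fun (@I01 R) g1 by exact: measurable_funB.
have Fg0 : F g0 <= (2 * C * r)%:E.
  apply: (@le_trans _ _ (2%:E * F f)).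
    apply: lattice_le => //; move: hb; apply: ae_I01S => t _ /andP[h0 _].
    have ft := fp t; rewrite ger0_norm; last by rewrite le_min h0 mulr_ge0.
    by rewrite (ger0_norm ft) ge_min lexx orbT.
  by rewrite -mulrA EFinM lee_wpmul2l// (le_trans Ff)// Er -EFinM.
have Lg1 : norm_Linfty_inv g1 <= (2 * M)%:E.
  apply: norm_Linfty_inv_le => //; first by rewrite mulr_ge0.
  have H1 : {ae leb, forall t, I01 t -> (0 < t)%R} by apply: ae_I01_oo.
  move: H1 hb; apply: ae_I01S2 => t _ t0 /andP[h0 h1].
  have Mt : (0 <= 2 * M * t)%R by rewrite !mulr_ge0// ltW.
  rewrite /g1 /g0; case: (leP (h t) (2 * f t)%R) => H.
    by rewrite subrr normr0.
  by rewrite ger0_norm; lra.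
apply: (le_trans (@K_le _ _ F norm_Linfty_inv s h g0 g1 _ _ _)).
- by rewrite /carrier/= (le_lt_trans Fg0)// ltry.
- by rewrite /carrier/= (le_lt_trans Lg1)// ltry.
- by apply/funext => t; rewrite /g1 /= [RHS]addrC subrK.
- rewrite Er EM; apply: (@le_trans _ _ ((2 * C * r)%:E + s%:E * (2 * M)%:E)).
    by apply: leeD => //; rewrite lee_wpmul2l// lee_fin ltW.
  rewrite -!EFinM -!EFinD lee_fin /D.
  have sM : (0 <= s * M)%R by rewrite mulr_ge0// ltW.
  have CsM : (0 <= C * (s * M))%R by rewrite mulr_ge0// ltW.
  lra.
Qed.

(* a is split almost optimally at t0 = sup {t | k t > la t}: b1 has
   K(t, b1) <= 2 la t, while K(t, b0) <= 3 k t below t0, where k <= 2 C1 |h0|, and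
   K(t, b0) <= 2 k t0 above t0, where the monotone concave majorant of h0 is used. *)
Lemma K_lift_split (A : banach_pair R) (a : ambient A) (C1 C2 B : R) (h0 : R -> R) :
  (forall t, (0 < t)%R -> K_pair t a < +oo) -> (0 < C1)%R -> (0 <= B)%R ->
  carrier F h0 -> F (concave_hull h0) <= C2%:E * F h0 -> (0 < C2)%R ->
  {ae leb, forall t, I01 t -> (fine (K_pair t a) <= C1 * (`|h0 t| + B * t))%R} ->
  exists b0 b1 : ambient A, [/\ a = (b0 + b1)%R,
    norm_FK F b0 <= (8 * C1 * C2 + 2 * C1)%:E * F h0 &
    norm_gagliardo1 b1 <= (4 * C1 * B)%:E].
Proof.
move=> Kfin C10 B0 Fh0 Hhull C20 Hk.
have e0 := ext_norm0 A; have e1 := ext_norm1 A.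
have hL := carrier_Linfty hF Fh0.
pose k t := fine (K_pair t a).
have kqc : quasi_concave k by exact: K_pair_quasi_concave.
have [k0 kn kq] := kqc.
have KE t : (0 < t)%R -> K_pair t a = (k t)%:E.
  by move=> t0; rewrite K_pairE ?Kfin ?ltW.
(* Where k t > la t, the term C1 B t is less than half of k t, so k t <= 2 C1 |h0 t|. *)
pose la := (2 * C1 * B)%R.
have la0 : (0 <= la)%R by rewrite /la !mulr_ge0// ltW.
(* Since k t / t is non-increasing, the set where k t > la t is an initial interval. *)
have ratio s t : (0 < s)%R -> (s <= t)%R -> (k s <= la * s)%R -> (k t <= la * t)%R.
  move=> s0 st ks; have t0 : (0 < t)%R by exact: lt_le_trans st.
  rewrite -(ler_pM2l s0); apply: (le_trans (kq s t s0 st)).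
  apply: (@le_trans _ _ (t * (la * s)))%R; first by rewrite ler_wpM2l// ltW.
  lra.
have Hk' : {ae leb, forall t, I01 t -> (la * t < k t -> k t <= 2 * C1 * `|h0 t|)%R}.
  by move: Hk; apply: ae_I01S => t _; rewrite -/(k t) /la => H1 H2; lra.
have [r r0 Er] := lattice_fin_num Fh0.
have C12 : (0 < C1 * C2)%R by rewrite mulr_gt0.
(* If that set misses ]0, 1[, all of a goes into b1; if it contains ]0, 1[, all of a goes into b0.
   Otherwise its supremum t0 lies in ]0, 1[. *)
have [all1|/existsNP[t1 /not_implyP[t10 /not_implyP[t11 /negP nt1]]]] :=
  pselect (forall t, 0 < t -> t < 1 -> k t <= la * t)%R.
  exists 0%R, a; split; first by rewrite add0r.
    by rewrite norm_FK0 Er -EFinM lee_fin mulr_ge0//; lra.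
  apply: norm_gagliardo1_le => t t0; rewrite KE// lee_fin.
  apply: (@le_trans _ _ (la * t)%R); last first.
    rewrite /la; have : (0 <= C1 * B * t)%R by rewrite !mulr_ge0// ltW.
    lra.
  have [t1|t1] := ltP t 1%R; first exact: all1.
  apply: (@ratio (1 / 2)%R) => //; [lra|by apply: all1; lra].
rewrite -ltNge in nt1.
have [all2|/existsNP[t2 /not_implyP[t20 /not_implyP[t21 /negP nt2]]]] :=
  pselect (forall t, 0 < t -> t < 1 -> la * t < k t)%R.
  exists a, 0%R; split; first by rewrite addr0.
    apply: (@le_trans _ _ ((2 * C1)%:E * F h0)); last first.
      by rewrite Er -!EFinM lee_fin ler_wpM2r//; lra.
    apply: norm_FK_le => //; first by rewrite mulr_ge0// ltW.
    have H1 : {ae leb, forall t, I01 t -> (0 < t)%R /\ (t < 1)%R} by apply: ae_I01_oo.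
    move: H1 Hk'; apply: ae_I01S2 => t _ [t0 t1']; apply; exact: all2.
  by rewrite norm_gagliardo1_0 lee_fin !mulr_ge0// ltW.
rewrite -leNgt in nt2.
pose S := [set t : R | [/\ (0 < t)%R, (t < 1)%R & (la * t < k t)%R]].
have St1 : S t1 by [].
have ubS : ubound S t2.
  move=> t [t0 _ Ht]; rewrite leNgt; apply/negP => t2t.
  by have := ratio _ _ t20 (ltW t2t) nt2; rewrite leNgt Ht.
have supS : has_sup S by split; [exists t1|exists t2].
pose t0 := sup S.
have t1t0 : (t1 <= t0)%R by apply: ub_le_sup => //; exists t2.
have t0t2 : (t0 <= t2)%R by apply: ge_sup => //; exists t1.
have t00 : (0 < t0)%R by exact: lt_le_trans t1t0.
have below t : (0 < t)%R -> (t < t0)%R -> (la * t < k t)%R.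
  move=> tp tt0; have /(sup_gt (ex_intro _ t1 St1))[u [u0 _ Hu] tu] := tt0.
  rewrite ltNge; apply/negP => H.
  by have := ratio _ _ tp (ltW tu) H; rewrite leNgt Hu.
(* The bound holds at t0 + d, which is outside S, and k is nondecreasing; d <= e / (la + 1) makes
   the excess la d at most e. *)
have kt0 : (k t0 <= la * t0)%R.
  apply/ler_addgt0Pr => e ep.
  pose d : R := Num.min (e / (la + 1))%R ((1 - t0) / 2)%R.
  have t01 : (t0 < 1)%R by exact: le_lt_trans t21.
  have d0 : (0 < d)%R by rewrite lt_min !divr_gt0//; lra.
  have d1 : (t0 + d < 1)%R.
    have : (d <= (1 - t0) / 2)%R by rewrite ge_min lexx orbT.
    lra.
  have d2 : (d * (la + 1) <= e)%R.
    by rewrite -ler_pdivlMr; [rewrite ge_min lexx|lra].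
  apply: (le_trans (kn t0 (t0 + d)%R t00 _)); first by lra.
  have : (k (t0 + d) <= la * (t0 + d))%R.
    rewrite leNgt; apply/negP => H.
    have : (t0 + d <= t0)%R.
      by apply: ub_le_sup; [exists t2|split => //; lra].
    lra.
  lra.
have k0p : (0 < k t0)%R.
  apply: (lt_le_trans _ (kn _ _ t10 t1t0)); apply: le_lt_trans nt1.
  by rewrite mulr_ge0// ltW.
have : K_pair t0 a < (2 * k t0)%:E by rewrite KE// lte_fin; lra.
move=> /K_ltP[b0 [b1 [cb0 cb1 Eab Hb]]].
have [n0_ge0 _ _ _] := e0; have [n1_ge0 _ _ _] := e1.
have [m1 m10 E1] : exists2 m : R, (0 <= m)%R & norm1 b1 = m%:E.
  move: cb1 (n1_ge0 b1); rewrite /carrier/=; case: (norm1 b1) => // m _.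
  by rewrite lee_fin => m_ge0; exists m.
have [m0 m00 E0] : exists2 m : R, (0 <= m)%R & norm0 b0 = m%:E.
  move: cb0 (n0_ge0 b0); rewrite /carrier/=; case: (norm0 b0) => // m _.
  by rewrite lee_fin => m_ge0; exists m.
have {}Hb : (m0 + t0 * m1 < 2 * k t0)%R.
  by move: Hb; rewrite E0 E1 -EFinM -EFinD lte_fin.
have t0m1 : (0 <= t0 * m1)%R by rewrite mulr_ge0// ltW.
have K1 t : (0 < t)%R -> K_pair t b1 <= (t * m1)%:E.
  by move=> tp; rewrite EFinM -E1; exact: K_le1.
have K1fin t : (0 < t)%R -> K_pair t b1 < +oo.
  by move=> tp; rewrite (le_lt_trans (K1 t tp))// ltry.
have K0 t : K_pair t b0 <= m0%:E by rewrite -E0; exact: K_le0.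
have K0fin t : (0 < t)%R -> K_pair t b0 < +oo.
  by move=> tp; rewrite (le_lt_trans (K0 t))// ltry.
have m1la : (m1 <= 2 * la)%R by rewrite -(ler_pM2l t00); lra.
exists b0, b1; split => //; last first.
  apply: norm_gagliardo1_le => t tp; apply: (le_trans (K1 t tp)).
  rewrite lee_fin ler_wpM2l ?(ltW tp)//; move: m1la; rewrite /la; lra.
have k0_low t : (0 < t)%R -> (t < t0)%R -> (fine (K_pair t b0) <= 3 * k t)%R.
  move=> tp tt0.
  have Eb0 : b0 = (a + - b1)%R by rewrite Eab addrK.
  have : K_pair t b0 <= (k t + t * m1)%:E.
    rewrite Eb0; apply: (le_trans (K_D e0 e1 _ _ (ltW tp))).
    rewrite (K_N e0 e1) EFinD; apply: leeD; first by rewrite -KE.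
    exact: K1.
  rewrite K_pairE ?K0fin ?(ltW tp)// lee_fin => /le_trans; apply.
  have H1 : (t0 * (t * m1) <= t * (2 * k t0))%R.
    by rewrite mulrCA ler_wpM2l ?(ltW tp)//; lra.
  have H2 := kq t t0 tp (ltW tt0).
  have : (t0 * (t * m1) <= t0 * (2 * k t))%R by lra.
  by rewrite ler_pM2l// => H3; lra.
have k0_high t : (0 < t)%R -> (fine (K_pair t b0) <= 2 * k t0)%R.
  move=> tp; rewrite -lee_fin -K_pairE ?K0fin ?(ltW tp)//.
  by apply: (le_trans (K0 t)); rewrite lee_fin; lra.
have Hhull1 : {ae leb, forall t, I01 t -> (la * t < k t -> k t <= 2 * C1 * concave_hull h0 t)%R}.
  move: Hk' (concave_hull_ae_ge hL); apply: ae_I01S2 => t _ H1 H2 /H1 /le_trans; apply.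
  by rewrite ler_pM2l//; lra.
(* The estimate by the concave majorant holds only almost everywhere, so t0 is replaced by a point u
   of ]t0/2, t0[, at the cost of a factor 2 in k. *)
have [u [u0 ut0 Hu]] : exists u, [/\ (t0 / 2 < u)%R, (u < t0)%R &
    (k u <= 2 * C1 * concave_hull h0 u)%R].
  have t02 : (0 <= t0 / 2)%R by lra.
  have t02' : (t0 / 2 < t0)%R by lra.
  have t01 : (t0 <= 1)%R by lra.
  have [u [ul ur Hu]] := ae_exists_itv t02 t02' t01 Hhull1.
  by exists u; split => //; apply: Hu; apply: below => //; lra.
have up : (0 < u)%R by lra.
have ktu : (k t0 <= 2 * k u)%R.
  have H1 := kq u t0 up (ltW ut0).
  have H2 : (t0 * k u <= 2 * u * k u)%R by rewrite ler_wpM2r ?k0//; lra.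
  by rewrite -(ler_pM2l up); lra.
have hull0 t : (0 < t)%R -> (0 <= concave_hull h0 t)%R.
  by move=> tp; apply: concave_hull_ge0 => //; exact: ltW.
(* Above t0: 2 k t0 <= 4 k u <= 8 C1 times the majorant at u, and the majorant is nondecreasing.
   Below t0: 3 k t is at most 6 C1 times the majorant. *)
apply: (@le_trans _ _ ((8 * C1)%:E * F (concave_hull h0))).
  apply: norm_FK_le => //; first by rewrite mulr_ge0// ltW.
  have H1 : {ae leb, forall t, I01 t -> (0 < t)%R} by apply: ae_I01_oo.
  move: H1 Hhull1; apply: ae_I01S2 => t _ tp Ht.
  have h0t := hull0 t tp; rewrite (ger0_norm h0t).
  have C1h : (0 <= C1 * concave_hull h0 t)%R by rewrite mulr_ge0// ltW.
  have [t0t|tt0] := leP t0 t; last first.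
    have := Ht (below t tp tt0); have := k0_low t tp tt0; lra.
  have : (C1 * concave_hull h0 u <= C1 * concave_hull h0 t)%R.
    by rewrite ler_pM2l//; apply: concave_hull_nd => //; lra.
  have := k0_high t tp; lra.
rewrite Er in Hhull *; apply: (@le_trans _ _ ((8 * C1)%:E * (C2%:E * r%:E))).
  by rewrite lee_wpmul2l// lee_fin mulr_ge0// ltW.
rewrite -!EFinM lee_fin.
have : (0 <= C1 * r)%R by rewrite mulr_ge0// ltW.
lra.
Qed.

Lemma K_profile_ge : exists2 C : R, (0 < C)%R &
    forall (A : banach_pair R) (a : ambient A) (s : R) q, (0 < s)%R -> 1 <= q ->
    (forall t, (0 < t)%R -> K_pair t a < +oo) ->
    K_functional (@norm_FK R F A) (@norm_gagliardo1 R A) s a <=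
    C%:E * on_extended (K_functional F norm_Linfty_inv s) (theta_profile q a).
Proof.
have [C2 C20 HC2] := concave_hull_bounded hF.
pose e := (expR (-1) / 2 : R)%R; have e0 : (0 < e)%R by rewrite divr_gt0 ?expR_gt0.
pose C1 := (e^-1)%R; have C10 : (0 < C1)%R by rewrite invr_gt0.
have C12 : (0 < C1 * C2)%R by rewrite mulr_gt0.
pose D := (8 * C1 * C2 + 4 * C1)%R; have D0 : (0 < D)%R by rewrite /D; lra.
exists D => // A a s q s0 q1 Kfin.
rewrite -lee_pdivrMl//; apply: le_ereal_inf_tmp => _ [h ah <-].
apply: K_ge => f0 f1 c0 c1 Eh; rewrite lee_pdivrMl//.
have [B B0 EB] := carrier_norm_Linfty_invP c1.
have := lexx (norm_Linfty_inv f1); rewrite {2}EB => /(norm_Linfty_inv_bound B0) Hf1.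
have [r r0 Er] := lattice_fin_num c0.
have Hk : {ae leb, forall t, I01 t ->
    (fine (K_pair t a) <= C1 * (`|f0 t| + B * t))%R}.
  have H1 : {ae leb, forall t, I01 t -> (0 < t)%R /\ (t < 1)%R} by apply: ae_I01_oo.
  have H2 : {ae leb, forall t, I01 t -> (fine (K_pair t a) <= C1 * h t)%R}.
    move: H1 ah; apply: ae_I01S2 => t _ [t0 t1] ht.
    by have := profile_ge Kfin q1 t0 t1; rewrite ht lee_fin /C1 ler_pdivlMl.
  move: H2 Hf1; apply: ae_I01S2 => t _ H2 H3; apply: (le_trans H2).
  rewrite ler_pM2l// Eh (le_trans (ler_norm _))//.
  by rewrite (le_trans (ler_normD _ _))// lerD2l.
have [b0 [b1 [Ea Hb0 Hb1]]] := K_lift_split Kfin C10 B0 c0 (HC2 _ c0) C20 Hk.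
rewrite Er -EFinM in Hb0.
have := @K_le _ _ (@norm_FK R F A) (@norm_gagliardo1 R A) s a b0 b1 _ _ Ea.
move=> /(_ (le_lt_trans Hb0 (ltry _)) (le_lt_trans Hb1 (ltry _)))/le_trans; apply.
apply: (@le_trans _ _ (((8 * C1 * C2 + 2 * C1) * r)%:E + s%:E * (4 * C1 * B)%:E)).
  by apply: leeD => //; rewrite lee_wpmul2l// lee_fin ltW.
rewrite Er EB -!EFinM -!EFinD lee_fin /D.
have Cr : (0 <= C1 * r)%R by rewrite mulr_ge0// ltW.
have sB : (0 <= s * B)%R by rewrite mulr_ge0// ltW.
have CsB : (0 <= (C1 * C2) * (s * B))%R by rewrite mulr_ge0// ltW.
lra.
Qed.

(** The embedding constant of L^oo(1/t) in F is also one for the Gagliardo completion in the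
    K-space, so a single s, independent of the pair, is large for both sides of (c). *)
Lemma K_norm_FK_large : exists2 s : R, (0 < s)%R &
  K_functional F norm_Linfty_inv s = F :> ((R -> R) -> \bar R) /\
  forall (A : banach_pair R) (a : ambient A),
    K_functional (@norm_FK R F A) (@norm_gagliardo1 R A) s a = norm_FK F a.
Proof.
have [[C C0 HC] _ _] := hF; exists C => //; split.
  apply/funext => f; apply: K_functional_large.
  - exact: lattice_normD.
  - exact: norm_Linfty_inv0.
  - exact: HC.
move=> A a; apply: K_functional_large.
- exact: norm_FKD.
- exact: norm_gagliardo1_0.
- by move=> x; exact: norm_FK_le_gagliardo1.
Qed.

End K_of_profile.

Theorem theorem2 (R : realType) (F : banach_lattice R)
    (hF : interpolation_lattice F) :
  let cond_a := bounded_operator F F square_dilation in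
  let cond_b := forall (A : banach_pair R) (q : \bar R), 1 <= q ->
    extrapolation_description F A q in
  let cond_c := forall A : banach_pair R,
    exists c C : R, [/\ (0 < c)%R, (0 < C)%R
      & forall (a : ambient A) (s : R) (q : \bar R),
          sum_space (@norm_FK R F A) (@norm_gagliardo1 R A) a ->
          (0 < s)%R -> 1 <= q ->
          let X := K_functional (@norm_FK R F A) (@norm_gagliardo1 R A) s a in
          let Y := on_extended (K_functional F norm_Linfty_inv s)
                     (theta_profile q a) in
          c%:E * X <= Y /\ Y <= C%:E * X] in
  let cond_d := exists (A : banach_pair R) (q : \bar R),
    [/\ conv0_abundant A, 1 <= q & extrapolation_description F A q] in
  [/\ cond_a <-> cond_b, cond_a <-> cond_c & cond_a <-> cond_d].
Proof.
move=> cond_a cond_b cond_c cond_d.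
have ab : cond_a -> cond_b by exact: square_dilation_extrapolation.
have bd : cond_b -> cond_d.
  move=> hb; exists (weighted_pair R), 1; split => //; last exact: hb.
  exact: weighted_pair_abundant.
have da : cond_d -> cond_a.
  by move=> [A [q [hA q1 hext]]]; exact: (abundant_square_dilation hF hA q1 hext).
have ac : cond_a -> cond_c.
  move=> ha A; have [C C0 HC] := K_profile_le hF ha.
  have [D D0 HD] := K_profile_ge hF.
  exists D^-1%R, C; split => //; first by rewrite invr_gt0.
  move=> a s q sa s0 q1 X Y; split; last exact: HC.
  by rewrite lee_pdivrMl//; apply: HD => //; exact: (sum_space_fin sa).
have cb : cond_c -> cond_b.
  move=> hc A q q1; have [s s0 [FE AE]] := K_norm_FK_large hF.
  have [c [C [c0 C0 H]]] := hc A; exists c, C; split => // a ca.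
  have sa : sum_space (@norm_FK R F A) (@norm_gagliardo1 R A) a.
    exists a, 0%R; split => //; last by rewrite addr0.
    by rewrite /carrier/= norm_gagliardo1_0.
  by have := H a s q sa s0 q1; rewrite FE AE.
split; split.
- exact: ab.
- by move=> /bd/da.
- exact: ac.
- by move=> /cb/bd/da.
- by move=> /ab/bd.
- exact: da.
Qed.
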